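(* Let $k$ be a field of characteristic zero, let $V,W$ be nonzero finite dimensional $k$-linear spaces, and let $u\in\mathcal L(V)\otimes\mathcal L(W)$ be an invertible element satisfying $(t\otimes id)u^{-1}=((t\otimes id)u)^{-1}$. If $(H,v,\pi)$ is the minimal model for the element $$u'=u_{12}\,((id\otimes t)u^{-1})_{13}\in\mathcal L(V)\otimes\mathcal L(W)\otimes\mathcal L(W^* )=\mathcal L(V)\otimes\mathcal L(W\otimes W^* )$$ then the lattice $L(\Box_u)$ is equal to the lattice $L(v)$.
   Context: Conventions. All algebras are unital with unital morphisms. $\mathcal L(V)$ is the algebra of $k$-linear endomorphisms of $V$; $t:\mathcal L(V)\to\mathcal L(V^* )$ is the transposition, $t(T)(f)=f\circ T$, and $V^{**}=V$. The equality assumed on $u$ includes invertibility of $(t\otimes id)u$. Subscripts such as $u_{12},u_{13}$ are leg-numbering notation. Models. A representation of a Hopf $k$-algebra $H$ is an algebra morphism $\pi:H\to\mathcal L(X)$, $X$ finite dimensional. A corepresentation is an element $v\in\mathcal L(V)\otimes H$, $V$ finite dimensional, with $(id\otimes\Delta)v=v_{12}v_{13}$ and $(id\otimes\varepsilon)v=1$; its coefficient space is $\mathcal C_v=\{(f\otimes id)v\mid f\in\mathcal L(V)^*\}$. A model for $w\in\mathcal L(V)\otimes\mathcal L(X)$ is a triple $(H,v,\pi)$ with $v\in\mathcal L(V)\otimes H$ a corepresentation and $\pi:H\to\mathcal L(X)$ a representation such that $(id\otimes\pi)v=w$. It is left-faithful if $H$ is generated as a unital algebra by $\bigcup_{n\ge0}S^n(\mathcal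 C_v)$. A morphism of left-faithful models $(H_1,v_1,\pi_1)\to(H_2,v_2,\pi_2)$ of $w$ is a Hopf algebra morphism $f:H_1\to H_2$ with $(id\otimes f)v_1=v_2$ and $\pi_1=\pi_2f$. The minimal model for $w$ is the universally attracting (terminal) object of the category of left-faithful models for $w$. (It exists for $u'$, since $u'$ satisfies the same equation as $u$; and the square of the antipode of its Hopf algebra is the identity.) The lattice $L(v)$. For corepresentations $a\in\mathcal L(X)\otimes H$, $b\in\mathcal L(Y)\otimes H$, put $a\otimes b:=a_{13}b_{23}\in\mathcal L(X\otimes Y)\otimes H$, $End(a)=\{T\in\mathcal L(X)\mid (T\otimes1)a=a(T\otimes1)\}$, and $\hat v=(t\otimes S)v=(t\otimes id)v^{-1}\in\mathcal L(V^* )\otimes H$. The lattice $L(v)$ is the family of algebras indexed by $0\le j\le i$ whose algebra at position $(i,-j)$ is $End$ of the alternating tensor product with $i-j$ factors, beginning with $v$ if $j$ is even and with $\hat v$ if $j$ is odd ($v\otimes\hat v\otimes v\otimes\cdots$ or $\hat v\otimes v\otimes\hat v\otimes\cdots$), and $k$ if $i=j$. The inclusions are $x\mapsto x\otimes id$ from position $(i,-j)$ to $(i+1,-j)$, and $x\mapsto id\otimes x$ from position $(i,-(j+1))$ to $(i,-j)$. The lattice $L(\Box_u)$. Let $\Box_u$ be the square of inclusions with $A_{00}=k$, $A_{10}=u(\mathcal L(V)\otimes k)u^{-1}$, $A_{01}=k\otimes\mathcal L(W)$, $A_{11}=\mathcal L(V)\otimes\mathcal L(W)$ (so $A_{00}\subset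 A_{10}\subset A_{11}$, $A_{00}\subset A_{01}\subset A_{11}$); under the assumption on $u$ it is a Markov commuting square. Perform the basic constructions in the horizontal direction: the tower $A_{01}\subset A_{11}\subset A_{21}\subset\cdots$ is the Jones tower, i.e. for $i\ge1$, $A_{i+1,1}$ is the algebra of endomorphisms of $A_{i1}$ as a right $A_{i-1,1}$-module, with $A_{i1}$ embedded by left multiplications, and $e_i\in A_{i+1,1}$ (the Jones projection) is the conditional expectation $A_{i1}\to A_{i-1,1}$ preserving the normalized trace of the full matrix algebra $A_{i1}$; and $A_{i+1,0}\subset A_{i+1,1}$ is the subalgebra generated by $A_{i0}$ and $e_i$. The lattice $L(\Box_u)$ is the family of algebras whose algebra at position $(i,-j)$, $0\le j\le i$, is $A_{j1}'\cap A_{i0}$ (the elements of $A_{i0}$ commuting with $A_{j1}$, inside $A_{i1}$), with the obvious inclusions $A_{j1}'\cap A_{i0}\subset A_{j1}'\cap A_{i+1,0}$ and $A_{j+1,1}'\cap A_{i0}\subset A_{j1}'\cap A_{i0}$. Equality of two lattices means that there is a family of algebra isomorphisms between the algebras in corresponding positions which is compatible with all the inclusions. *)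

(* Defs.v *)
From HB Require Import structures.
From mathcomp Require Import all_boot all_order all_algebra.
From mathcomp Require Import boolp classical_sets functions.

Set Implicit Arguments.
Unset Strict Implicit.
Unset Printing Implicit Defensive.

Import GRing.Theory.
Local Open Scope classical_set_scope.
Local Open Scope ring_scope.
Local Open Scope quotient_scope.

(* A linear form on a nonzero algebra, not vanishing at 1: this only serves to
   show that a tensor product of nonzero algebras is nonzero, as algType
   requires. *)
Section UnitForm.
Variables (k : fieldType) (A : algType k).

Lemma unit_form : exists f : A -> k^o, linear f /\ f 1 = 1.
Proof.
pose P (N : set A) := (forall c x y, N x -> N y -> N (c *: x + y)) /\ ~ N 1.
have [F FP Ftot|N [[Nlin N1] Nmax]] := @Zorn_bigcup A P.
  split=> [c x y [X FX Xx] [Y FY Yy]|[X FX X1]]; last by case: (FP _ FX).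
  by case: (Ftot _ _ FX FY) => XY; [exists Y|exists X] => //;
    apply: (proj1 (FP _ _)) => //; apply: XY.
have dec x : exists c, N (x - c *: 1).
  pose N' : set A := [set z | exists y c, [\/ N y | y = 0] /\ z = y + c *: x].
  have N'lin c y z : N' y -> N' z -> N' (c *: y + z).
    move=> [y1 [c1 [h1 ->]]] [z1 [d1 [h2 ->]]].
    exists (c *: y1 + z1), (c * c1 + d1); split; last first.
      by rewrite scalerDr scalerA scalerDl addrACA.
    case: h1 h2 => [h1|->] [h2|->].
    - by left; apply: Nlin.
    - have N0 : N 0 by rewrite -(addNr y1) -scaleN1r; apply: Nlin.
      by left; apply: Nlin.
    - by left; rewrite scaler0 add0r.
    - by right; rewrite scaler0 add0r.
  have NN' : N `<=` N'.
    by move=> y Ny; exists y, 0; rewrite scale0r addr0; split=> //; left.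
  have [N'1|N'1] := pselect (N' 1); last first.
    have PN' : P N' by split.
    have [eqN|neN] := pselect (N = N').
      exists 0; rewrite scale0r subr0 eqN.
      by exists 0, 1; rewrite scale1r add0r; split=> //; right.
    exfalso; apply: (Nmax N') => //; split=> // N'N; apply: neN.
    by apply/seteqP; split.
  have [y [c [hy e1]]] := N'1.
  have [c0|c0] := eqVneq c 0.
    move: e1; rewrite c0 scale0r addr0 => e1.
    case: hy => [|y0]; first by rewrite -e1.
    by move: (oner_neq0 A); rewrite e1 y0 eqxx.
  have ex : x - c^-1 *: 1 = (- c^-1) *: y.
    by rewrite e1 scalerDr scalerA mulVf // scale1r opprD addrCA subrr addr0 scaleNr.
  exists c^-1; rewrite ex.
  case: hy => [Ny|y0].
    have N0 : N 0 by rewrite -(addNr y) -scaleN1r; apply: Nlin.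
    by rewrite -[_ *: y]addr0; apply: Nlin.
  rewrite y0 scaler0.
  have [[z Nz]|nN] := pselect (exists z, N z).
    by rewrite -(addNr z) -scaleN1r; apply: Nlin.
  exfalso; apply: (Nmax [set 0]).
    split=> [z Nz|sub]; first by case: nN; exists z.
    by case: nN; exists 0; apply: sub.
  split=> [d u v -> ->|]; first by rewrite scaler0 addr0.
  by move=> /eqP; rewrite oner_eq0.
have N0 : N 0.
  have [c Nc] := dec 0.
  by rewrite -(addNr (0 - c *: 1)) -scaleN1r; apply: Nlin.
have [f fP] : exists f : A -> k, forall x, N (x - f x *: 1).
  by exists (fun x => projT1 (cid (dec x))) => x; case: cid.
have uniq x c d : N (x - c *: 1) -> N (x - d *: 1) -> c = d.
  move=> Nc Nd; apply/eqP; rewrite -subr_eq0; apply/eqP/eqP/negPn/negP => cd.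
  apply: N1.
  have -> : 1 = (c - d)^-1 *: ((-1) *: (x - c *: 1) + (x - d *: 1)) + 0 :> A.
    rewrite scaleN1r opprB addrA addrNK -scalerBl scalerA mulVf ?scale1r ?addr0 //.
  by apply: (Nlin) => //; apply: (Nlin).
exists f; split=> [c x y|].
  apply: (uniq (c *: x + y)) => //.
  have -> : c *: x + y - (c *: (f x : k^o) + f y) *: 1 =
     c *: (x - f x *: 1) + (y - f y *: 1).
    by rewrite scalerDl -scalerA scalerBr addrACA opprD.
  exact: Nlin.
by apply: (uniq 1) => //; rewrite scale1r subrr.
Qed.
End UnitForm.

(* The tensor product of two k-modules: formal sums of pure tensors
   a (x) b, represented by lists of pairs, two of them being identified when
   they have the same value under every bilinear map. *)
Section Tensor.
Variables (k : fieldType) (A B : lmodType k).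

Definition bilinear_map (M : lmodType k) (f : A -> B -> M) :=
  bilinear_for *:%R *:%R f.

Definition bval (M : lmodType k) (f : A -> B -> M) (s : seq (A * B)) : M :=
  \sum_(p <- s) f p.1 p.2.

Definition teqv (s t : seq (A * B)) : bool :=
  `[< forall (M : lmodType k) (f : A -> B -> M),
        bilinear_map f -> bval f s = bval f t >].

Lemma teqv_refl : reflexive teqv.
Proof. by move=> s; apply/asboolP. Qed.
Lemma teqv_sym : symmetric teqv.
Proof. by move=> s t; apply/asboolP/asboolP => h M f fb; rewrite h. Qed.
Lemma teqv_trans : transitive teqv.
Proof.
move=> t s r /asboolP h1 /asboolP h2; apply/asboolP => M f fb.
by rewrite h1 // h2.
Qed.
Canonical teqv_equiv := EquivRel teqv teqv_refl teqv_sym teqv_trans.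

Definition tensor := {eq_quot teqv}.
HB.instance Definition _ := Choice.on tensor.

Definition tpure (a : A) (b : B) : tensor := \pi_(tensor) [:: (a, b)].

(* The linear map induced by the bilinear map f; see tlift_tpure. *)
Definition tlift (M : lmodType k) (f : A -> B -> M) (x : tensor) : M :=
  bval f (repr x).

Lemma tlift_pi (M : lmodType k) (f : A -> B -> M) s :
  bilinear_map f -> tlift f (\pi_(tensor) s) = bval f s.
Proof.
move=> fb; rewrite /tlift; have : \pi_(tensor) (repr (\pi_(tensor) s)) = \pi_(tensor) s.
  by rewrite reprK.
by move/eqmodP/asboolP; apply.
Qed.

Lemma tensorP (x y : tensor) :
  (forall (M : lmodType k) (f : A -> B -> M),
     bilinear_map f -> tlift f x = tlift f y) -> x = y.
Proof.
move=> h; rewrite -[x]reprK -[y]reprK; apply/eqmodP/asboolP => M f fb.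
exact: h.
Qed.

Lemma bval_cat (M : lmodType k) (f : A -> B -> M) s t :
  bval f (s ++ t) = bval f s + bval f t.
Proof. exact: big_cat. Qed.

Definition tscale_seq (c : k) (s : seq (A * B)) := [seq (c *: p.1, p.2) | p <- s].

Lemma bval_scale (M : lmodType k) (f : A -> B -> M) c s :
  bilinear_map f -> bval f (tscale_seq c s) = c *: bval f s.
Proof.
move=> fb; rewrite /bval big_map scaler_sumr; apply: eq_bigr => p _ /=.
exact: (GRing.scalable_linear (fb.1 p.2)).
Qed.

Definition tzero : tensor := \pi_(tensor) [::].
Definition tadd (x y : tensor) : tensor := \pi_(tensor) (repr x ++ repr y).
Definition tscale (c : k) (x : tensor) : tensor :=
  \pi_(tensor) (tscale_seq c (repr x)).
Definition topp (x : tensor) : tensor := tscale (-1) x.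

Lemma tlift_zero (M : lmodType k) (f : A -> B -> M) :
  bilinear_map f -> tlift f tzero = 0.
Proof. by move=> fb; rewrite tlift_pi // /bval big_nil. Qed.
Lemma tlift_add (M : lmodType k) (f : A -> B -> M) x y :
  bilinear_map f -> tlift f (tadd x y) = tlift f x + tlift f y.
Proof. by move=> fb; rewrite tlift_pi // bval_cat. Qed.
Lemma tlift_scale (M : lmodType k) (f : A -> B -> M) c x :
  bilinear_map f -> tlift f (tscale c x) = c *: tlift f x.
Proof. by move=> fb; rewrite tlift_pi // bval_scale. Qed.

Let tE := (tlift_zero, tlift_add, tlift_scale).

Lemma taddA : associative tadd.
Proof. by move=> x y z; apply: tensorP => M f fb; rewrite !tE // addrA. Qed.
Lemma taddC : commutative tadd.
Proof. by move=> x y; apply: tensorP => M f fb; rewrite !tE // addrC. Qed.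
Lemma tadd0 : left_id tzero tadd.
Proof. by move=> x; apply: tensorP => M f fb; rewrite !tE // add0r. Qed.
Lemma taddN : left_inverse tzero topp tadd.
Proof.
by move=> x; apply: tensorP => M f fb; rewrite !tE // scaleN1r addNr.
Qed.
HB.instance Definition _ :=
  GRing.isZmodule.Build tensor taddA taddC tadd0 taddN.

Lemma tscaleA c d x : tscale c (tscale d x) = tscale (c * d) x.
Proof. by apply: tensorP => M f fb; rewrite !tE // scalerA. Qed.
Lemma tscale1 : left_id 1 tscale.
Proof. by move=> x; apply: tensorP => M f fb; rewrite !tE // scale1r. Qed.
Lemma tscaleDr : right_distributive tscale +%R.
Proof. by move=> c x y; apply: tensorP => M f fb; rewrite !tE // scalerDr. Qed.
Lemma tscaleDl x : {morph tscale^~ x : c d / c + d}.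
Proof. by move=> c d; apply: tensorP => M f fb; rewrite !tE // scalerDl. Qed.
HB.instance Definition _ := GRing.Zmodule_isLmodule.Build k tensor
  tscaleA tscale1 tscaleDr tscaleDl.

Lemma tlift_tpure (M : lmodType k) (f : A -> B -> M) a b :
  bilinear_map f -> tlift f (tpure a b) = f a b.
Proof. by move=> fb; rewrite tlift_pi // /bval big_seq1. Qed.

Lemma tlift_linear (M : lmodType k) (f : A -> B -> M) :
  bilinear_map f -> linear (tlift f).
Proof. by move=> fb c x y; rewrite tlift_add // tlift_scale. Qed.

Lemma tpure_bilinear : bilinear_map tpure.
Proof.
split=> [b c x y|a c x y]; apply: tensorP => M f fb;
  rewrite !tE // !tlift_tpure //.
- exact: fb.1.
- exact: fb.2.
Qed.

Lemma tensor_spanned (x : tensor) :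
  exists s : seq (A * B), x = \sum_(p <- s) tpure p.1 p.2.
Proof.
exists (repr x); apply: tensorP => M f fb.
have z0 : tlift f 0 = 0 by exact: tlift_zero.
rewrite (big_morph (tlift f) (fun x y => tlift_add x y fb) z0).
by apply: eq_bigr => p _; rewrite tlift_tpure.
Qed.

Lemma tensor_ext (M : lmodType k) (f g : tensor -> M) : linear f -> linear g ->
  (forall a b, f (tpure a b) = g (tpure a b)) -> f =1 g.
Proof.
move=> fl gl fg x; have [s ->] := tensor_spanned x.
pose F : {linear tensor -> M} := HB.pack f (GRing.isLinear.Build _ _ _ _ f fl).
pose G : {linear tensor -> M} := HB.pack g (GRing.isLinear.Build _ _ _ _ g gl).
rewrite -[f]/(F : _ -> _) -[g]/(G : _ -> _) !linear_sum.
by apply: eq_bigr => p _; apply: fg.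
Qed.

End Tensor.

Section TensorAlgebra.
Variables (k : fieldType) (A B : algType k).
Local Notation T := (tensor A B).
Implicit Types x y z : T.

Definition tmul x y : T :=
  tlift (fun a b => tlift (fun a' b' => tpure (a * a') (b * b')) y) x.
Definition tone : T := tpure 1 1.

Lemma tmul_inner_bilinear (a : A) (b : B) :
  bilinear_map (fun a' b' => tpure (a * a') (b * b')).
Proof.
have [hl hr] := @tpure_bilinear k A B.
split=> [b' c x y|a' c x y] /=.
- by rewrite mulrDr -scalerAr hl.
- by rewrite mulrDr -scalerAr hr.
Qed.

Lemma tmul_outer_bilinear y :
  bilinear_map
    (fun a b => tlift (fun a' b' => tpure (a * a') (b * b')) y).
Proof.
have [hl hr] := @tpure_bilinear k A B.
split=> [b c u v|a c u v] /=; move: y; apply: tensor_ext.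
- exact/tlift_linear/tmul_inner_bilinear.
- move=> d s t; rewrite !(tlift_linear (tmul_inner_bilinear _ _)).
  by rewrite !scalerDr !scalerA mulrC addrACA.
- move=> s t; rewrite !(tlift_tpure _ _ (tmul_inner_bilinear _ _)).
  by rewrite mulrDl -scalerAl hl.
- exact/tlift_linear/tmul_inner_bilinear.
- move=> d s t; rewrite !(tlift_linear (tmul_inner_bilinear _ _)).
  by rewrite !scalerDr !scalerA mulrC addrACA.
- move=> s t; rewrite !(tlift_tpure _ _ (tmul_inner_bilinear _ _)).
  by rewrite mulrDl -scalerAl hr.
Qed.

Lemma tmul_tpure a b a' b' :
  tmul (tpure a b) (tpure a' b') = tpure (a * a') (b * b').
Proof.
rewrite /tmul tlift_tpure; last exact: tmul_outer_bilinear.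
by rewrite tlift_tpure //; apply: tmul_inner_bilinear.
Qed.

Lemma tmul_linearl y : linear (tmul^~ y).
Proof. exact/tlift_linear/tmul_outer_bilinear. Qed.

Lemma tmul_linearr x : linear (tmul x).
Proof.
move=> c y z; move: x; apply: tensor_ext.
- exact: tmul_linearl.
- move=> d s t; rewrite !tmul_linearl.
  by rewrite !scalerDr !scalerA mulrC addrACA.
- move=> a b; rewrite /tmul !tlift_tpure;
    try exact: tmul_outer_bilinear.
  exact/tlift_linear/tmul_inner_bilinear.
Qed.

Lemma tmulA : associative tmul.
Proof.
move=> x y z; move: x; apply: tensor_ext.
- exact: tmul_linearl.
- by move=> c s t; rewrite !tmul_linearl.
move=> a b; move: y; apply: tensor_ext.
- by move=> c s t; rewrite tmul_linearl tmul_linearr.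
- by move=> c s t; rewrite tmul_linearr tmul_linearl.
move=> a' b'; move: z; apply: tensor_ext.
- by move=> c s t; rewrite !tmul_linearr.
- exact: tmul_linearr.
by move=> a'' b''; rewrite !tmul_tpure !mulrA.
Qed.

Lemma tmul1l : left_id tone tmul.
Proof.
apply: tensor_ext => //; first exact: tmul_linearr.
by move=> a b; rewrite tmul_tpure !mul1r.
Qed.
Lemma tmul1r : right_id tone tmul.
Proof.
apply: tensor_ext => //; first exact: tmul_linearl.
by move=> a b; rewrite tmul_tpure !mulr1.
Qed.
Lemma tmulDl : left_distributive tmul +%R.
Proof. by move=> x y z; have := tmul_linearl z 1 x y; rewrite !scale1r. Qed.
Lemma tmulDr : right_distributive tmul +%R.
Proof. by move=> x y z; have := tmul_linearr x 1 y z; rewrite !scale1r. Qed.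

Lemma tone_neq0 : tone != 0.
Proof.
have [f [fl f1]] := unit_form A; have [g [gl g1]] := unit_form B.
have fg : bilinear_map (fun a b => f a * g b : k^o).
  split=> [b c x y|a c x y] /=.
  - by rewrite fl mulrDl /= -mulrA.
  - by rewrite gl mulrDr /= mulrCA.
apply/eqP => /(congr1 (tlift (fun a b => f a * g b : k^o))).
rewrite tlift_tpure // f1 g1 mulr1.
have -> : tlift (fun a b => f a * g b : k^o) 0 = 0 by exact: tlift_zero.
by move/eqP; rewrite oner_eq0.
Qed.

HB.instance Definition _ := GRing.Zmodule_isNzRing.Build T
  tmulA tmul1l tmul1r tmulDl tmulDr tone_neq0.

Lemma tscaleAl (c : k) x y : c *: (x * y) = (c *: x) * y.
Proof. exact: esym (GRing.scalable_linear (tmul_linearl y) c x). Qed.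
Lemma tscaleAr (c : k) x y : c *: (x * y) = x * (c *: y).
Proof. exact: esym (GRing.scalable_linear (tmul_linearr x) c y). Qed.
HB.instance Definition _ := GRing.Lmodule_isLalgebra.Build k T tscaleAl.
HB.instance Definition _ := GRing.Lalgebra_isAlgebra.Build k T tscaleAr.

Lemma tpureM (a a' : A) (b b' : B) :
  tpure a b * tpure a' b' = tpure (a * a') (b * b').
Proof. exact: tmul_tpure. Qed.

Definition tinl (a : A) : T := tpure a 1.
Definition tinr (b : B) : T := tpure 1 b.

Lemma tinl_linear : linear tinl.
Proof. exact: (@tpure_bilinear k A B).1. Qed.
Lemma tinl_monoid : monoid_morphism tinl.
Proof. by split=> // a a'; rewrite /tinl tpureM mulr1. Qed.
HB.instance Definition _ := GRing.isLinear.Build k A T _ tinl tinl_linear.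
HB.instance Definition _ := GRing.isMonoidMorphism.Build A T tinl tinl_monoid.

Lemma tinr_linear : linear tinr.
Proof. exact: (@tpure_bilinear k A B).2. Qed.
Lemma tinr_monoid : monoid_morphism tinr.
Proof. by split=> // b b'; rewrite /tinr tpureM mulr1. Qed.
HB.instance Definition _ := GRing.isLinear.Build k B T _ tinr tinr_linear.
HB.instance Definition _ := GRing.isMonoidMorphism.Build B T tinr tinr_monoid.

End TensorAlgebra.

Section TensorMaps.
Variable k : fieldType.

Definition tmap (A A' B B' : lmodType k)
    (f : {linear A -> A'}) (g : {linear B -> B'}) : tensor A B -> tensor A' B' :=
  tlift (fun a b => tpure (f a) (g b)).

Lemma tmap_bilinear (A A' B B' : lmodType k)
    (f : {linear A -> A'}) (g : {linear B -> B'}) :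
  bilinear_map (fun a b => tpure (f a) (g b)).
Proof.
have [hl hr] := @tpure_bilinear k A' B'.
by split=> [b c x y|a c x y] /=; rewrite linearP ?hl ?hr.
Qed.

Lemma tmap_linear (A A' B B' : lmodType k)
    (f : {linear A -> A'}) (g : {linear B -> B'}) : linear (tmap f g).
Proof. exact/tlift_linear/tmap_bilinear. Qed.
HB.instance Definition _ (A A' B B' : lmodType k)
    (f : {linear A -> A'}) (g : {linear B -> B'}) :=
  GRing.isLinear.Build k (tensor A B) (tensor A' B') _ (tmap f g)
    (tmap_linear f g).

Lemma tmap_tpure (A A' B B' : lmodType k)
    (f : {linear A -> A'}) (g : {linear B -> B'}) a b :
  tmap f g (tpure a b) = tpure (f a) (g b).
Proof. by rewrite /tmap tlift_tpure //; apply: tmap_bilinear. Qed.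

(* (A (x) B) (x) C -> A (x) (B (x) C) *)
Definition tassoc (A B C : lmodType k) :
    tensor (tensor A B) C -> tensor A (tensor B C) :=
  tlift (fun x c => tlift (fun a b => tpure a (tpure b c)) x).

End TensorMaps.

(* The algebra of endomorphisms of a nonzero space V, with T * S = T \o S.
   (The ring structures on 'End(V) in vector and falgebra have the opposite
   product.) *)
Definition Lend (k : fieldType) (V : vectType k) (hV : (0 < dim V)%N) : Type :=
  'End(V).

Section Lend.
Variables (k : fieldType) (V : vectType k) (hV : (0 < dim V)%N).

HB.instance Definition _ := GRing.Lmodule.on (Lend hV).
HB.instance Definition _ := GRing.Zmodule_isNzRing.Build (Lend hV)
  (@comp_lfunA k V V V V) (@comp_lfun1l k V V) (@comp_lfun1r k V V)
  (@comp_lfunDl k V V V) (@comp_lfunDr k V V V) (lfun1_neq0 hV).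
HB.instance Definition _ := GRing.Lmodule_isLalgebra.Build k (Lend hV)
  (@comp_lfunZl k V V V).
HB.instance Definition _ := GRing.Lalgebra_isAlgebra.Build k (Lend hV)
  (@comp_lfunZr k V V V).

Lemma Lend_mulE (f g : Lend hV) : f * g = (f \o g)%VF.
Proof. by []. Qed.

End Lend.

Section Transposition.
Variables (k : fieldType) (V : vectType k) (hV : (0 < dim V)%N).

Definition dual (U : vectType k) := 'Hom(U, k^o).

Lemma dual_proper : (0 < dim (dual V))%N.
Proof. by rewrite /dim /= muln_gt0 hV. Qed.

Definition transp (f : Lend hV) : Lend dual_proper :=
  linfun (fun phi : dual V => (phi \o f)%VF).

Lemma transpE (f : Lend hV) (phi : dual V) : transp f phi = (phi \o f)%VF.
Proof.
have lin : linear (fun phi : dual V => (phi \o f)%VF).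
  by move=> c x y; rewrite comp_lfunDl comp_lfunZl.
pose F : {linear dual V -> dual V} :=
  HB.pack (fun phi : dual V => (phi \o f)%VF)
    (GRing.isLinear.Build _ _ _ _ _ lin).
exact: (lfunE F phi).
Qed.

Lemma transp_linear : linear transp.
Proof.
move=> c f g; apply/lfunP => phi.
rewrite add_lfunE scale_lfunE !transpE.
by rewrite comp_lfunDr comp_lfunZr.
Qed.
HB.instance Definition _ :=
  GRing.isLinear.Build k (Lend hV) (Lend dual_proper) _ transp transp_linear.

(* t (x) id *)
Definition ltransp (B : algType k) :
    tensor (Lend hV) B -> tensor (Lend dual_proper) B :=
  @tmap k (Lend hV) (Lend dual_proper) B B transp idfun.

(* id (x) t *)
Definition rtransp (B : algType k) :
    tensor B (Lend hV) -> tensor B (Lend dual_proper) :=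
  @tmap k B B (Lend hV) (Lend dual_proper) idfun transp.

End Transposition.

Definition inverse_of (R : nzRingType) (x y : R) := x * y = 1 /\ y * x = 1.

Definition gen_subalg (k : fieldType) (A : algType k) (X : set A) : set A :=
  [set x | forall P : {pred A}, subalg_closed P ->
             (forall y, X y -> y \in P) -> x \in P].

Section Hopf.
Variable k : fieldType.

Record hopfAlg := HopfAlg {
  hopf_alg :> algType k;
  comult : {lrmorphism hopf_alg -> tensor hopf_alg hopf_alg};
  counit : {lrmorphism hopf_alg -> k^o};
  antipode : {linear hopf_alg -> hopf_alg};
  comultA : forall h,
    tassoc (tmap comult idfun (comult h)) = tmap idfun comult (comult h);
  counitl : forall h, tlift (fun a b => counit a *: b) (comult h) = h;
  counitr : forall h, tlift (fun a b => counit b *: a) (comult h) = h;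
  antipodel : forall h,
    tlift (fun a b => antipode a * b) (comult h) = (counit h)%:A;
  antipoder : forall h,
    tlift (fun a b => a * antipode b) (comult h) = (counit h)%:A
}.

Definition is_hopf_morphism (H1 H2 : hopfAlg) (f : {lrmorphism H1 -> H2}) :=
  [/\ forall h, comult H2 (f h) = tmap f f (comult H1 h),
      forall h, counit H2 (f h) = counit H1 h &
      forall h, antipode H2 (f h) = f (antipode H1 h)].

(* Below A stands for L(V) and B for L(X), with V and X finite
   dimensional; L(V (x) W) is identified with L(V) (x) L(W). *)

Definition is_corep (A : algType k) (H : hopfAlg) (v : tensor A H) :=
  tmap idfun (comult H) v =
    tmap idfun (@tinl k H H) v * tmap idfun (@tinr k H H) v
  /\ tmap idfun (counit H) v = 1.

Definition coef_space (A : algType k) (H : hopfAlg) (v : tensor A H) : set H :=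
  [set c | exists f : {linear A -> k^o}, c = tlift (fun a h => f a *: h) v].

Record model (A B : algType k) (w : tensor A B) := Model {
  model_hopf : hopfAlg;
  model_corep : tensor A model_hopf;
  model_rep : {lrmorphism model_hopf -> B};
  model_corepP : is_corep model_corep;
  model_repP : tmap idfun model_rep model_corep = w
}.

Definition left_faithful (A B : algType k) (w : tensor A B) (M : model w) :=
  forall h, gen_subalg
    [set iter n (antipode (model_hopf M)) c
       | n in [set: nat] & c in coef_space (model_corep M)] h.

Definition is_model_morphism (A B : algType k) (w : tensor A B)
    (M N : model w) (f : {lrmorphism model_hopf M -> model_hopf N}) :=
  [/\ is_hopf_morphism f,
      tmap idfun f (model_corep M) = model_corep N &
      forall h, model_rep M h = model_rep N (f h)].

Definition minimal_model (A B : algType k) (w : tensor A B) (M : model w) :=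
  left_faithful M /\
  forall N : model w, left_faithful N ->
    exists f : {lrmorphism model_hopf N -> model_hopf M},
      is_model_morphism f /\
      forall g : {lrmorphism model_hopf N -> model_hopf M},
        is_model_morphism g -> f =1 g.

End Hopf.

(* A lattice of algebras; lat_alg j m is the algebra at position (j + m, -j),
   given as a subalgebra of the ambient algebra lat_amb j m.  Thus j and m range
   over all natural numbers, lat_right goes from (i, -j) to (i + 1, -j), and
   lat_up goes from (i, -(j + 1)) to (i, -j), with i = j + m + 1. *)
Record lattice (k : fieldType) := Lattice {
  lat_amb : nat -> nat -> algType k;
  lat_alg : forall j m, set (lat_amb j m);
  lat_right : forall j m, lat_amb j m -> lat_amb j m.+1;
  lat_up : forall j m, lat_amb j.+1 m -> lat_amb j m.+1
}.

Definition is_alg_iso_on (k : fieldType) (A B : algType k)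
    (S : set A) (T : set B) (f : A -> B) :=
  [/\ set_bij S T f, f 1 = 1,
      forall x y, S x -> S y -> f (x * y) = f x * f y &
      forall c x y, S x -> S y -> f (c *: x + y) = c *: f x + f y].

Definition lattice_eq (k : fieldType) (L1 L2 : lattice k) :=
  exists f : forall j m, lat_amb L1 j m -> lat_amb L2 j m,
    [/\ forall j m, is_alg_iso_on (@lat_alg _ L1 j m) (@lat_alg _ L2 j m) (f j m),
        forall j m x, @lat_alg _ L1 j m x ->
          f j m.+1 (lat_right x) = lat_right (f j m x) &
        forall j m x, @lat_alg _ L1 j.+1 m x ->
          f j m.+1 (lat_up x) = lat_up (f j.+1 m x)].

Section CorepLattice.
Variables (k : fieldType) (H : hopfAlg k).

Definition corep_tensor (A B : algType k) (a : tensor A H) (b : tensor B H) :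
    tensor (tensor A B) H :=
  tmap (@tinl k A B) idfun a * tmap (@tinr k A B) idfun b.

Definition corep_End (A : algType k) (a : tensor A H) : set A :=
  [set T | @tinl k A H T * a = a * @tinl k A H T].

Variables (V : vectType k) (hV : (0 < dim V)%N) (v : tensor (Lend hV) H).

Definition corep_hat : tensor (Lend (dual_proper hV)) H :=
  @tmap k (Lend hV) (Lend (dual_proper hV)) H H (@transp k V hV) (antipode H) v.

(* In alternating products the boolean b is true when the first factor is
   hat v. *)
Definition alt_factor (b : bool) : algType k :=
  if b then (Lend (dual_proper hV) : algType k) else (Lend hV : algType k).

Definition alt_corep1 (b : bool) : tensor (alt_factor b) H :=
  if b return tensor (alt_factor b) H then corep_hat else v.

(* The algebra of endomorphisms of the alternating product with m factors,
   bracketed to the right and ended by the trivial factor k. *)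
Fixpoint alt_alg (b : bool) (m : nat) : algType k :=
  if m is m'.+1 then tensor (alt_factor b) (alt_alg (~~ b) m') else k^o.

Fixpoint alt_corep (b : bool) (m : nat) : tensor (alt_alg b m) H :=
  match m return tensor (alt_alg b m) H with
  | 0 => 1
  | m'.+1 => corep_tensor (alt_corep1 b) (alt_corep (~~ b) m')
  end.

(* x |-> x (x) id *)
Fixpoint alt_append (b : bool) (m : nat) :
    {linear alt_alg b m -> alt_alg b m.+1} :=
  match m return {linear alt_alg b m -> alt_alg b m.+1} with
  | 0 => @tinr k (alt_factor b) k^o
  | m'.+1 => tmap (@idfun (alt_factor b)) (alt_append (~~ b) m')
  end.

(* x |-> id (x) x *)
Definition alt_prepend (b : bool) (m : nat) :
    alt_alg (~~ b) m -> alt_alg b m.+1 :=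
  @tinr k (alt_factor b) (alt_alg (~~ b) m).

Definition corep_lattice : lattice k :=
  @Lattice k (fun j m => alt_alg (odd j) m)
    (fun j m => corep_End (alt_corep (odd j) m))
    (fun j m => alt_append (odd j) m)
    (fun j m => @alt_prepend (odd j) m).

End CorepLattice.

Section RightEnd.
Variable k : fieldType.

Record inclusion := Inclusion {
  isrc : algType k;
  itgt : algType k;
  iemb : {lrmorphism isrc -> itgt}
}.

Variable I : inclusion.
Local Notation A := (itgt I).
Local Notation i := (iemb I).

(* The endomorphisms of the right isrc I-module itgt I. *)
Record rend := Rend {
  rend_fun :> A -> A;
  rend_lin : linear rend_fun;
  rend_mod : forall x b, rend_fun (x * i b) = rend_fun x * i b
}.

HB.instance Definition _ := gen_eqMixin rend.
HB.instance Definition _ := gen_choiceMixin rend.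

Lemma rendP (f g : rend) : (forall x, f x = g x) -> f = g.
Proof.
case: f g => [f f1 f2] [g g1 g2] /= fg.
have e : f = g by apply/funext.
subst g; congr Rend; exact: Prop_irrelevance.
Qed.

Lemma rzero_lin : linear (fun _ : A => 0 : A).
Proof. by move=> c x y; rewrite scaler0 addr0. Qed.
Lemma rzero_mod x b : (fun _ : A => 0 : A) (x * i b) = (fun _ : A => 0 : A) x * i b.
Proof. by rewrite /= mul0r. Qed.
Definition rzero : rend := Rend rzero_lin rzero_mod.

Lemma radd_lin (f g : rend) : linear (fun x : A => f x + g x).
Proof. by move=> c x y; rewrite !rend_lin scalerDr addrACA. Qed.
Lemma radd_mod (f g : rend) x b : (fun x : A => f x + g x) (x * i b) = (fun x : A => f x + g x) x * i b.
Proof. by rewrite /= !rend_mod mulrDl. Qed.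
Definition radd (f g : rend) : rend := Rend (@radd_lin f g) (@radd_mod f g).

Lemma rscale_lin (c : k) (f : rend) : linear (fun x : A => c *: f x).
Proof. by move=> d x y; rewrite !rend_lin scalerDr !scalerA mulrC. Qed.
Lemma rscale_mod (c : k) (f : rend) x b : (fun x : A => c *: f x) (x * i b) = (fun x : A => c *: f x) x * i b.
Proof. by rewrite /= rend_mod scalerAl. Qed.
Definition rscale (c : k) (f : rend) : rend := Rend (@rscale_lin c f) (@rscale_mod c f).

Lemma rcomp_lin (f g : rend) : linear (fun x : A => f (g x)).
Proof. by move=> c x y; rewrite !rend_lin. Qed.
Lemma rcomp_mod (f g : rend) x b : (fun x : A => f (g x)) (x * i b) = (fun x : A => f (g x)) x * i b.
Proof. by rewrite /= !rend_mod. Qed.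
Definition rcomp (f g : rend) : rend := Rend (@rcomp_lin f g) (@rcomp_mod f g).

Lemma rid_lin : linear (fun x : A => x).
Proof. by []. Qed.
Lemma rid_mod x b : (fun x : A => x) (x * i b) = (fun x : A => x) x * i b.
Proof. by []. Qed.
Definition rid : rend := Rend rid_lin rid_mod.

Lemma raddA : associative radd.
Proof. by move=> f g h; apply: rendP => x /=; rewrite addrA. Qed.
Lemma raddC : commutative radd.
Proof. by move=> f g; apply: rendP => x /=; rewrite addrC. Qed.
Lemma radd0 : left_id rzero radd.
Proof. by move=> f; apply: rendP => x /=; rewrite add0r. Qed.
Lemma raddN : left_inverse rzero (rscale (-1)) radd.
Proof. by move=> f; apply: rendP => x /=; rewrite scaleN1r addNr. Qed.
HB.instance Definition _ := GRing.isZmodule.Build rend raddA raddC radd0 raddN.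

Lemma rscaleA c d f : rscale c (rscale d f) = rscale (c * d) f.
Proof. by apply: rendP => x /=; rewrite scalerA. Qed.
Lemma rscale1 : left_id 1 rscale.
Proof. by move=> f; apply: rendP => x /=; rewrite scale1r. Qed.
Lemma rscaleDr : right_distributive rscale +%R.
Proof. by move=> c f g; apply: rendP => x /=; rewrite scalerDr. Qed.
Lemma rscaleDl f : {morph rscale^~ f : c d / c + d}.
Proof. by move=> c d; apply: rendP => x /=; rewrite scalerDl. Qed.
HB.instance Definition _ := GRing.Zmodule_isLmodule.Build k rend
  rscaleA rscale1 rscaleDr rscaleDl.

Lemma rcompA : associative rcomp.
Proof. by move=> f g h; apply: rendP. Qed.
Lemma rcomp1l : left_id rid rcomp.
Proof. by move=> f; apply: rendP. Qed.
Lemma rcomp1r : right_id rid rcomp.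
Proof. by move=> f; apply: rendP. Qed.
Lemma rcompDl : left_distributive rcomp +%R.
Proof. by move=> f g h; apply: rendP. Qed.
Lemma rcompDr : right_distributive rcomp +%R.
Proof.
move=> f g h; apply: rendP => x /=.
by have := rend_lin f 1 (g x) (h x); rewrite !scale1r.
Qed.
Lemma rid_neq0 : rid != 0.
Proof.
apply/eqP => /(congr1 (fun f : rend => f 1)) /= /eqP.
by rewrite oner_eq0.
Qed.
HB.instance Definition _ := GRing.Zmodule_isNzRing.Build rend
  rcompA rcomp1l rcomp1r rcompDl rcompDr rid_neq0.

Lemma rcompAl (c : k) (f g : rend) : c *: (f * g) = (c *: f) * g.
Proof. exact: rendP. Qed.
HB.instance Definition _ := GRing.Lmodule_isLalgebra.Build k rend rcompAl.
Lemma rcompAr (c : k) (f g : rend) : c *: (f * g) = f * (c *: g).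
Proof.
apply: rendP => x.
by rewrite [RHS](GRing.scalable_linear (rend_lin f)).
Qed.
HB.instance Definition _ := GRing.Lalgebra_isAlgebra.Build k rend rcompAr.

Lemma lmult_lin (a : A) : linear (fun x : A => a * x).
Proof. by move=> c x y; rewrite mulrDr scalerAr. Qed.
Lemma lmult_mod (a : A) x b : (fun x : A => a * x) (x * i b) = (fun x : A => a * x) x * i b.
Proof. by rewrite /= mulrA. Qed.
Definition lmult (a : A) : rend := Rend (@lmult_lin a) (@lmult_mod a).

Lemma lmult_linear : linear lmult.
Proof. by move=> c a b; apply: rendP => x /=; rewrite mulrDl -scalerAl. Qed.
Lemma lmult_monoid : monoid_morphism lmult.
Proof.
split=> [|a b]; apply: rendP => x /=; first by rewrite mul1r.
by rewrite mulrA.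
Qed.
HB.instance Definition _ := GRing.isLinear.Build k A rend _ lmult lmult_linear.
HB.instance Definition _ := GRing.isMonoidMorphism.Build A rend lmult lmult_monoid.

Definition basic_construction : inclusion := @Inclusion A rend lmult.

(* On a full matrix algebra in characteristic zero there is exactly one
   normalized trace. *)
Definition is_ntrace (tr : A -> k^o) :=
  [/\ linear tr, forall x y, tr (x * y) = tr (y * x) & tr 1 = 1].

Definition is_cond_exp (E : A -> isrc I) :=
  [/\ linear E, forall b, E (i b) = b,
      forall b x b', E (i b * x * i b') = b * E x * b' &
      exists2 tr, is_ntrace tr & forall x, tr (i (E x)) = tr x].

Definition jones_projection : set rend :=
  [set e | exists2 E, is_cond_exp E & forall x, e x = i (E x)].

End RightEnd.

Section SquareLattice.
Variables (k : fieldType) (V W : vectType k).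
Variables (hV : (0 < dim V)%N) (hW : (0 < dim W)%N).
Variables (u ui : tensor (Lend hV) (Lend hW)).

(* The element ui stands for the inverse of u.  The tower is built on the square
   A_{00} = k, A_{10} = u (L(V) (x) k) u^-1, A_{01} = k (x) L(W),
   A_{11} = L(V) (x) L(W).
   tower i is the inclusion of A_{i,1} into A_{i+1,1}; A_{01} = k (x) L(W) is
   identified with L(W). *)
Fixpoint tower (i : nat) : inclusion k :=
  if i is i'.+1 then basic_construction (tower i')
  else @Inclusion k (Lend hW) (tensor (Lend hV) (Lend hW))
         (@tinr k (Lend hV) (Lend hW)).

Definition A1 (i : nat) : algType k := isrc (tower i).

Definition A1_emb (i : nat) : A1 i -> A1 i.+1 := iemb (tower i).

Fixpoint A1_incl (j m : nat) : A1 j -> A1 (m + j) :=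
  match m return A1 j -> A1 (m + j) with
  | 0 => fun x => x
  | m'.+1 => fun x => A1_emb (A1_incl m' x)
  end.

(* The algebra A_{i,0} as a subset of A_{i,1}. *)
Fixpoint A0 (i : nat) : set (A1 i) :=
  match i return set (A1 i) with
  | 0 => [set c%:A | c in [set: k]]
  | i'.+1 =>
    match i' return set (A1 i') -> set (A1 i'.+1) with
    | 0 => fun _ => [set u * @tinl k (Lend hV) (Lend hW) T * ui | T in [set: Lend hV]]
    | i''.+1 => fun A0i =>
        gen_subalg ((@A1_emb i''.+1 @` A0i) `|` @jones_projection k (tower i''))
    end (@A0 i')
  end.

Definition A1_cast (i i' : nat) (e : i = i') (x : A1 i) : A1 i' :=
  let: erefl := e in x.

Definition square_lattice : lattice k :=
  @Lattice k (fun j m => A1 (m + j))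
    (fun j m =>
       [set x : A1 (m + j) | A0 x /\ forall y : A1 j, x * A1_incl m y = A1_incl m y * x])
    (fun j m => @A1_emb (m + j))
    (fun j m => @A1_cast (m + j.+1) (m.+1 + j) (addnS m j)).

(* u_12 ((id (x) t) u^-1)_13 *)
Definition uprime :
    tensor (Lend hV) (tensor (Lend hW) (Lend (dual_proper hW))) :=
  tmap idfun (@tinl k (Lend hW) (Lend (dual_proper hW))) u *
  tmap idfun (@tinr k (Lend hW) (Lend (dual_proper hW)))
    (rtransp ui).

End SquareLattice.

(* Main.v *)
Require Import Defs.
From HB Require Import structures.
From mathcomp Require Import all_boot all_order all_algebra.
From mathcomp Require Import boolp classical_sets functions.

(** Write L_1, L_2, L_3 and so on for L(V), L(V^* ), L(V) and so on, and u^
    for the contragredient (t (x) id) u^-1 of u.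

    The tower.  Since A_11 is A_01 (x) L(V), an endomorphism of A_11 as a right
    A_01-module is a combination of left multiplications and of right
    multiplications by L(V); the latter form the opposite algebra of L(V), which
    transposition identifies with L(V^* ).  Repeating this, A_{i,1} is generated by
    commuting copies of L_1, up to L_i and of L(W) (next_spanned, stageP).  Hence
    all these algebras have trivial centres, and the commutant of A_{j,1} in
    A_{i,1} is the product of L_{j+1}, up to L_i (theta_commutant).

    The bottom row.  Let U be the product u_1 u^_2 u_3 and so on with i factors,
    the l-th acting on L_l and L(W).  Then A_{i,0} is U D U^-1, where D is the
    commutant of L(W) (A0_conj).  Indeed the Jones projection e is the rank one
    projection attached to the canonical vector of two consecutive factors; a
    factor u on this vector can be moved from the first copy to the second at the
    price of a transposition, so that u_l u^_{l+1} fixes it, and the hypothesis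
    on u says that it fixes the corresponding linear form too (jones_twist).  So
    U commutes with e, and A_{i+1,0} is conjugated to the algebra generated by
    the previous commutant and by e, which contains the new factor because e and
    the old factor generate it (next_rho_jones).

    The comparison.  An element y of the product of L_{j+1}, up to L_i thus
    belongs to A_{i,0} if and only if U^-1 y U commutes with L(W), where now only
    the factors of U beyond the j-th matter (A0_theta).  Writing this as an
    equality between an element on the leg W and one on the leg W^*, it says that
    y commutes with the alternating product of u' and its contragredient
    (intertwiner_criterion, rep_alt_corep), that is, with the image under pi of
    the alternating product a of v and its contragredient.

    Minimality.  It remains to see that y intertwines a as soon as it intertwines
    the image of a under pi.  The coefficients of y a - a y span a coideal, so
    the two-sided ideal they generate is a Hopf ideal, and it lies in the kernel
    of pi.  The quotient by it is again a left-faithful model; by terminality the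
    projection onto the quotient has a left inverse, so the ideal is 0
    (minimal_ideal0, corep_End_of_rep). *)

Set Implicit Arguments.
Unset Strict Implicit.
Unset Printing Implicit Defensive.

Import GRing.Theory.
Local Open Scope ring_scope.

(** * Linear maps, algebra morphisms and tensors *)

Section LinearMaps.
Variable k : fieldType.

Definition linear_pack (A B : lmodType k) (f : A -> B) (fl : linear f) :
  {linear A -> B} := HB.pack f (GRing.isLinear.Build _ _ _ _ f fl).

Section Rules.
Variables (A B : lmodType k) (f : A -> B) (fl : linear f).
Lemma lin0 : f 0 = 0. Proof. exact: (linear0 (linear_pack fl)). Qed.
Lemma linD x y : f (x + y) = f x + f y.
Proof. exact: (linearD (linear_pack fl)). Qed.
Lemma linB x y : f (x - y) = f x - f y.
Proof. exact: (linearB (linear_pack fl)). Qed.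
Lemma linZ c x : f (c *: x) = c *: f x.
Proof. exact: (GRing.scalable_linear fl). Qed.
Lemma lin_sum (I : Type) (r : seq I) P (F : I -> A) :
  f (\sum_(i <- r | P i) F i) = \sum_(i <- r | P i) f (F i).
Proof. exact: (linear_sum (linear_pack fl)). Qed.
Lemma lin_inj : (forall x, f x = 0 -> x = 0) -> injective f.
Proof.
move=> h x y e; apply/eqP; rewrite -subr_eq0; apply/eqP; apply: h.
by rewrite linB e subrr.
Qed.
End Rules.

Lemma lin_comp (A B C : lmodType k) (f : A -> B) (g : B -> C) :
  linear f -> linear g -> linear (fun x => g (f x)).
Proof. by move=> fl gl c x y; rewrite fl gl. Qed.

Lemma lin_mulrl (A : lmodType k) (B : algType k) (f : A -> B) (b : B) :
  linear f -> linear (fun x => b * f x).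
Proof. by move=> fl c x y; rewrite fl mulrDr -scalerAr. Qed.

Lemma lin_mulrr (A : lmodType k) (B : algType k) (f : A -> B) (b : B) :
  linear f -> linear (fun x => f x * b).
Proof. by move=> fl c x y; rewrite fl mulrDl -scalerAl. Qed.

Lemma is_linear (A B : lmodType k) (f : {linear A -> B}) : linear f.
Proof. by move=> c x y; rewrite linearP. Qed.

Definition alg_morph (A B : algType k) (f : A -> B) :=
  [/\ linear f, {morph f : x y / x * y} & f 1 = 1].

Lemma alg_morph_lr (A B : algType k) (f : {lrmorphism A -> B}) : alg_morph f.
Proof. by split; [apply: is_linear|apply: rmorphM|apply: rmorph1]. Qed.

Lemma alg_morph_comp (A B C : algType k) (f : A -> B) (g : B -> C) :
  alg_morph f -> alg_morph g -> alg_morph (fun x => g (f x)).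
Proof.
move=> [fl fM f1] [gl gM g1]; split; first exact: lin_comp.
- by move=> x y; rewrite fM gM.
- by rewrite f1 g1.
Qed.

Definition lrmorph_pack (A B : algType k) (f : A -> B) (h : alg_morph f) :
  {lrmorphism A -> B} :=
  HB.pack f (GRing.isLinear.Build k A B _ f (let: And3 l _ _ := h in l))
    (GRing.isMonoidMorphism.Build A B f
       (let: And3 _ m o := h in (o, m))).

End LinearMaps.

Section TensorRules.
Variable k : fieldType.

Lemma bilin (A B M : lmodType k) (f : A -> B -> M) :
  (forall b, linear (f^~ b)) -> (forall a, linear (f a)) -> bilinear_map f.
Proof. by move=> h1 h2; split. Qed.

Section Pure.
Variables A B : lmodType k.

Lemma tpureDl (a a' : A) (b : B) : tpure (a + a') b = tpure a b + tpure a' b.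
Proof. exact: (linD ((tpure_bilinear A B).1 b)). Qed.
Lemma tpureDr (a : A) (b b' : B) : tpure a (b + b') = tpure a b + tpure a b'.
Proof. exact: (linD ((tpure_bilinear A B).2 a)). Qed.
Lemma tpureZl c (a : A) (b : B) : tpure (c *: a) b = c *: tpure a b.
Proof. exact: (linZ ((tpure_bilinear A B).1 b)). Qed.
Lemma tpureZr c (a : A) (b : B) : tpure a (c *: b) = c *: tpure a b.
Proof. exact: (linZ ((tpure_bilinear A B).2 a)). Qed.
Lemma tpure0l (b : B) : tpure (0 : A) b = 0.
Proof. exact: (lin0 ((tpure_bilinear A B).1 b)). Qed.
Lemma tpure0r (a : A) : tpure a (0 : B) = 0.
Proof. exact: (lin0 ((tpure_bilinear A B).2 a)). Qed.
Lemma tpure_suml (I : Type) (r : seq I) (P : pred I) (F : I -> A) (b : B) :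
  tpure (\sum_(i <- r | P i) F i) b = \sum_(i <- r | P i) tpure (F i) b.
Proof. exact: (lin_sum ((tpure_bilinear A B).1 b)). Qed.
Lemma tpure_sumr (I : Type) (r : seq I) (P : pred I) (F : I -> B) (a : A) :
  tpure a (\sum_(i <- r | P i) F i) = \sum_(i <- r | P i) tpure a (F i).
Proof. exact: (lin_sum ((tpure_bilinear A B).2 a)). Qed.

Lemma tensor_ind (P : tensor A B -> Prop) :
  (forall x y, P x -> P y -> P (x + y)) ->
  (forall a b, P (tpure a b)) -> forall x, P x.
Proof.
move=> PD Pp x; have [s ->] := tensor_spanned x.
by elim/big_rec: _ => [|p y _ Py]; [rewrite -(tpure0l 0)|apply: PD].
Qed.

End Pure.

Lemma mul_bilin (A B : lmodType k) (R : algType k) (f : A -> R) (g : B -> R) :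
  linear f -> linear g -> bilinear_map (fun a b => f a * g b).
Proof.
by move=> fl gl; apply: bilin => b; [apply: lin_mulrr|apply: lin_mulrl].
Qed.

(** Every embedding of a tensor product into a tower algebra or into a tensor
    product with more legs is of this form, for two commuting embeddings of the
    factors. *)
Definition mul_lift (A B : lmodType k) (R : algType k) (f : A -> R) (g : B -> R)
  (x : tensor A B) : R := tlift (fun a b => f a * g b) x.

Section MulLift.
Variables (A B R : algType k) (f : A -> R) (g : B -> R).

Lemma mul_lift_pure : linear f -> linear g ->
  forall a b, mul_lift f g (tpure a b) = f a * g b.
Proof. by move=> fl gl a b; rewrite /mul_lift tlift_tpure //; apply: mul_bilin. Qed.

Lemma mul_lift_linear : linear f -> linear g -> linear (mul_lift f g).
Proof. by move=> fl gl; apply/tlift_linear/mul_bilin. Qed.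

Hypotheses (fm : alg_morph f) (gm : alg_morph g).
Hypothesis fg : forall a b, f a * g b = g b * f a.

Lemma mul_lift_morph : alg_morph (mul_lift f g).
Proof.
have [fl fM f1] := fm; have [gl gM g1] := gm.
have ml := mul_lift_linear fl gl; have mp := mul_lift_pure fl gl.
split=> //; last by rewrite mp f1 g1 mulr1.
move=> x y; elim/tensor_ind: x => [x x' h h'|a b].
  by rewrite mulrDl !(linD ml) mulrDl h h'.
elim/tensor_ind: y => [y y' h h'|a' b'].
  by rewrite mulrDr !(linD ml) mulrDr h h'.
by rewrite tpureM !mp fM gM -!mulrA; congr (_ * _); rewrite !mulrA fg.
Qed.

Lemma mul_lift_inl a : mul_lift f g (tinl B a) = f a.
Proof. by case: fm gm => fl _ _ [gl _ g1]; rewrite mul_lift_pure // g1 mulr1. Qed.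
Lemma mul_lift_inr b : mul_lift f g (tinr A b) = g b.
Proof. by case: fm gm => fl _ f1 [gl _ _]; rewrite mul_lift_pure // f1 mul1r. Qed.

End MulLift.

Lemma tmapD (A A' B B' : lmodType k) (f : {linear A -> A'})
    (g : {linear B -> B'}) x y :
  tmap f g (x + y) = tmap f g x + tmap f g y.
Proof. exact: (linD (tmap_linear f g)). Qed.

Section Tmap.
Variables A A' B B' : lmodType k.

Lemma tmap_comp (A'' B'' : lmodType k)
    (f : {linear A -> A'}) (f' : {linear A' -> A''}) (F : {linear A -> A''})
    (g : {linear B -> B'}) (g' : {linear B' -> B''}) (G : {linear B -> B''}) x :
  (forall a, f' (f a) = F a) -> (forall b, g' (g b) = G b) ->
  tmap f' g' (tmap f g x) = tmap F G x.
Proof.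
move=> fF gG; elim/tensor_ind: x => [x y hx hy|a b].
  by rewrite !tmapD hx hy.
by rewrite !tmap_tpure fF gG.
Qed.

Lemma tmap_id (f : {linear A -> A}) (g : {linear B -> B}) x :
  f =1 id -> g =1 id -> tmap f g x = x.
Proof.
move=> fF gG; elim/tensor_ind: x => [x y hx hy|a b].
  by rewrite !tmapD hx hy.
by rewrite !tmap_tpure fF gG.
Qed.

Lemma tlift_tmap (M : lmodType k) (f : {linear A -> A'}) (g : {linear B -> B'})
    (h : A' -> B' -> M) x :
  bilinear_map h -> tlift h (tmap f g x) = tlift (fun a b => h (f a) (g b)) x.
Proof.
move=> hb; have hb' : bilinear_map (fun a b => h (f a) (g b)).
  apply: bilin => [b|a]; first exact: (lin_comp (is_linear f) (hb.1 (g b))).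
  exact: (lin_comp (is_linear g) (hb.2 (f a))).
elim/tensor_ind: x => [x y hx hy|a b].
  by rewrite tmapD !(linD (tlift_linear _)) // hx hy.
by rewrite tmap_tpure !tlift_tpure.
Qed.

End Tmap.

Lemma lin_tlift (A B M M' : lmodType k) (f : M -> M') (h : A -> B -> M) x :
  linear f -> bilinear_map h -> f (tlift h x) = tlift (fun a b => f (h a b)) x.
Proof.
move=> fl hb; have hb' : bilinear_map (fun a b => f (h a b)).
  apply: bilin => [b|a]; first exact: (lin_comp (hb.1 b) fl).
  exact: (lin_comp (hb.2 a) fl).
elim/tensor_ind: x => [x y hx hy|a b].
  by rewrite !(linD (tlift_linear _)) // (linD fl) hx hy.
by rewrite !tlift_tpure.
Qed.

Lemma eq_tlift (A B M : lmodType k) (f g : A -> B -> M) x :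
  (forall a b, f a b = g a b) -> tlift f x = tlift g x.
Proof. by move=> fg; apply: eq_bigr => p _; apply: fg. Qed.

Lemma tmap_legs (A H H' : algType k) (f : {lrmorphism H -> H'}) (x : tensor A H) :
  tmap idfun (@tinl k H' H') (tmap idfun f x) =
    tmap idfun (tmap f f) (tmap idfun (@tinl k H H) x) /\
  tmap idfun (@tinr k H' H') (tmap idfun f x) =
    tmap idfun (tmap f f) (tmap idfun (@tinr k H H) x).
Proof.
elim/tensor_ind: x => [x y [h1 h2] [h1' h2']|a h].
  by rewrite !tmapD h1 h2 h1' h2'.
by rewrite !tmap_tpure; split=> //=; rewrite /tinl /tinr tmap_tpure rmorph1.
Qed.

Section TmapMul.
Variables (A A' B B' : algType k) (f : {linear A -> A'}) (g : {linear B -> B'}).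

Lemma tmapM : {morph f : x y / x * y} -> {morph g : x y / x * y} ->
  {morph tmap f g : x y / x * y}.
Proof.
move=> fM gM x y; elim/tensor_ind: x => [x x' h h'|a b].
  by rewrite mulrDl !tmapD mulrDl h h'.
elim/tensor_ind: y => [y y' h h'|a' b'].
  by rewrite mulrDr !tmapD mulrDr h h'.
by rewrite tpureM !tmap_tpure fM gM tpureM.
Qed.

Lemma tmap1 : f 1 = 1 -> g 1 = 1 -> tmap f g 1 = 1.
Proof. by move=> f1 g1; rewrite -[1]/(tpure 1 1) tmap_tpure f1 g1. Qed.

Lemma tmap_morph : alg_morph f -> alg_morph g -> alg_morph (tmap f g).
Proof.
move=> [_ fM f1] [_ gM g1]; split; first exact: is_linear.
- exact: tmapM.
- exact: tmap1.
Qed.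

End TmapMul.

Lemma tmap_comm (A1 A2 A B1 B2 B : algType k)
    (f1 : {linear A1 -> A}) (g1 : {linear B1 -> B})
    (f2 : {linear A2 -> A}) (g2 : {linear B2 -> B}) x y :
  (forall a b, f1 a * f2 b = f2 b * f1 a) ->
  (forall a b, g1 a * g2 b = g2 b * g1 a) ->
  tmap f1 g1 x * tmap f2 g2 y = tmap f2 g2 y * tmap f1 g1 x.
Proof.
move=> fc gc; elim/tensor_ind: x => [x x' h h'|a b].
  by rewrite !tmapD mulrDl mulrDr h h'.
elim/tensor_ind: y => [y y' h h'|a' b'].
  by rewrite !tmapD mulrDl mulrDr h h'.
by rewrite !tmap_tpure !tpureM fc gc.
Qed.

Lemma tinlr_comm (A B : algType k) (a : A) (b : B) :
  tinl B a * tinr A b = tinr A b * tinl B a.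
Proof. by rewrite /tinl /tinr !tpureM !mulr1 !mul1r. Qed.

End TensorRules.

(** * Matrix units *)

Section MatrixUnits.
Variable k : fieldType.

Definition matrix_units (R : algType k) (I : finType) (e : I -> I -> R) :=
  (forall a b c d, e a b * e c d = if b == c then e a d else 0)
  /\ \sum_a e a a = 1.

(** Kept apart from the relations: the image of a system of matrix units in a
    larger algebra keeps the relations and no longer spans. *)
Definition units_span (R : algType k) (I : finType) (e : I -> I -> R) :=
  forall x, exists c : I -> I -> k, x = \sum_a \sum_b c a b *: e a b.

(** The coefficient of e a b in x, written inside R: when R contains commuting
    copies of N and of a matrix algebra that generate it, it lies in N. *)
Definition mcoef (R : algType k) (I : finType) (e : I -> I -> R) x a b : R :=
  \sum_c e c a * x * e b c.

Section Coefs.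
Variables (R : algType k) (I : finType) (e : I -> I -> R).
Hypothesis eP : matrix_units e.

Let eM a b c d : e a b * e c d = if b == c then e a d else 0.
Proof. exact: eP.1. Qed.

Lemma sum_if (M : lmodType k) (F : I -> M) i :
  \sum_j (if j == i then F j else 0) = F i.
Proof. by rewrite -big_mkcond big_pred1_eq. Qed.
Lemma sum_if' (M : lmodType k) (F : I -> M) i :
  \sum_j (if i == j then F j else 0) = F i.
Proof. by rewrite -(sum_if F i); apply: eq_bigr => j _; rewrite eq_sym. Qed.

Lemma mcoef_linear a b : linear (mcoef e ^~ a ^~ b).
Proof.
move=> c x y; rewrite /mcoef scaler_sumr -big_split; apply: eq_bigr => i _.
by rewrite mulrDr mulrDl -scalerAr -scalerAl.
Qed.

Lemma mul_mcoef p q x a b : e p q * mcoef e x a b = e p a * x * e b q.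
Proof.
rewrite /mcoef mulr_sumr -(sum_if' (fun c => e p a * x * e b c) q).
apply: eq_bigr => c _; rewrite !mulrA eM; case: ifP => // _.
by rewrite !mul0r.
Qed.

Lemma mcoef_mul p q x a b : mcoef e x a b * e p q = e p a * x * e b q.
Proof.
rewrite /mcoef mulr_suml -(sum_if (fun c => e c a * x * e b q) p).
apply: eq_bigr => c _; rewrite -!mulrA eM; case: ifP => // _.
by rewrite !mulr0.
Qed.

Lemma mcoef_comm p q x a b : e p q * mcoef e x a b = mcoef e x a b * e p q.
Proof. by rewrite mul_mcoef mcoef_mul. Qed.

Lemma mcoef_expand x : x = \sum_a \sum_b mcoef e x a b * e a b.
Proof.
rewrite -[LHS]mul1r -[LHS]mulr1 -!eP.2 !mulr_suml.
apply: eq_bigr => a _; rewrite mulr_sumr; apply: eq_bigr => b _.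
by rewrite mcoef_mul.
Qed.

Lemma mcoef_centr x y a b :
  (forall p q, y * e p q = e p q * y) -> y * x = x * y ->
  y * mcoef e x a b = mcoef e x a b * y.
Proof.
move=> ye yx; rewrite /mcoef mulr_sumr mulr_suml; apply: eq_bigr => c _.
by rewrite !mulrA ye -(mulrA (e c a)) yx -!mulrA ye.
Qed.

Lemma mcoef_mull y x a b : (forall p q, y * e p q = e p q * y) ->
  mcoef e (y * x) a b = y * mcoef e x a b.
Proof.
move=> ye; rewrite /mcoef mulr_sumr; apply: eq_bigr => c _.
by rewrite !mulrA ye.
Qed.

Lemma mcoef_mulr y x a b : (forall p q, y * e p q = e p q * y) ->
  mcoef e (x * y) a b = mcoef e x a b * y.
Proof.
move=> ye; rewrite /mcoef mulr_suml; apply: eq_bigr => c _.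
by rewrite -!mulrA ye.
Qed.

Lemma mcoef1 a b : mcoef e 1 a b = if a == b then 1 else 0.
Proof.
rewrite /mcoef; case: (eqVneq a b) => [->|ab].
  by rewrite -[RHS]eP.2; apply: eq_bigr => c _; rewrite mulr1 eM eqxx.
by apply: big1 => c _; rewrite mulr1 eM (negbTE ab).
Qed.

Lemma mcoef_unit p q a b :
  mcoef e (e p q) a b = if (a == p) && (q == b) then 1 else 0.
Proof.
rewrite /mcoef; case: (eqVneq a p) => [->|ap] /=; last first.
  by apply: big1 => c _; rewrite eM (negbTE ap) mul0r.
case: (eqVneq q b) => [->|qb]; last first.
  by apply: big1 => c _; rewrite eM eqxx eM (negbTE qb).
by rewrite -[RHS]eP.2; apply: eq_bigr => c _; rewrite !eM !eqxx eM eqxx.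
Qed.

Lemma mcoef_sum (y : I -> I -> R) a b :
  (forall a b p q, y a b * e p q = e p q * y a b) ->
  mcoef e (\sum_p \sum_q y p q * e p q) a b = y a b.
Proof.
move=> ye; rewrite (lin_sum (mcoef_linear _ _)).
rewrite -[RHS](sum_if' (fun p => y p b)); apply: eq_bigr => p _.
rewrite (lin_sum (mcoef_linear _ _)).
rewrite -[y p b](sum_if (fun q => y p q)).
case: (eqVneq a p) => ap; last first.
  rewrite big1 // => q _; rewrite mcoef_mull // mcoef_unit (negbTE ap).
  by rewrite mulr0.
apply: eq_bigr => q _; rewrite mcoef_mull // mcoef_unit ap eqxx /=.
by case: ifP; rewrite ?mulr1 ?mulr0.
Qed.

Lemma units_nonempty : exists a : I, True.
Proof.
have [[a _]|n] := pselect (exists a : I, True); first by exists a.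
have := oner_neq0 R; rewrite -eP.2 big1 ?eqxx // => a _.
by case: n; exists a.
Qed.

Hypothesis eS : units_span e.

Lemma mcoef_scalar x a b : exists c : k, mcoef e x a b = c%:A.
Proof.
have [c ->] := eS x; exists (c a b).
have E : \sum_p \sum_q c p q *: e p q = \sum_p \sum_q (c p q)%:A * e p q.
  by do 2!(apply: eq_bigr => ? _); rewrite mulr_algl.
by rewrite E mcoef_sum // => p q ? ?; rewrite mulr_algl mulr_algr.
Qed.

Lemma units_center (x : R) : (forall y, x * y = y * x) -> exists c : k, x = c%:A.
Proof.
move=> xc; have [a _] := units_nonempty; have [c ca] := mcoef_scalar x a a.
exists c; rewrite -ca -[x in mcoef _ x]mulr1 mcoef_mull ?mcoef1 ?eqxx ?mulr1 //.
Qed.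

End Coefs.

Lemma matrix_units_morph (A R : algType k) (f : A -> R) (I : finType)
    (e : I -> I -> A) :
  alg_morph f -> matrix_units e -> matrix_units (fun a b => f (e a b)).
Proof.
move=> [fl fM f1] [eM e1]; split; last by rewrite -(lin_sum fl) e1.
by move=> a b c d; rewrite -fM eM; case: ifP => // _; rewrite lin0.
Qed.

Lemma mcoef_morph (A R : algType k) (f : A -> R) (I : finType)
    (e : I -> I -> A) x a b :
  alg_morph f -> mcoef (fun a b => f (e a b)) (f x) a b = f (mcoef e x a b).
Proof.
move=> [fl fM f1]; rewrite /mcoef (lin_sum fl).
by apply: eq_bigr => c _; rewrite !fM.
Qed.

Lemma tensor_units_expand (A : lmodType k) (P : algType k) (I : finType)
    (e : I -> I -> P) (z : tensor A P) : units_span e ->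
  exists y : I -> I -> A, z = \sum_a \sum_b tpure (y a b) (e a b).
Proof.
move=> eS; elim/tensor_ind: z => [z z' [y ->] [y' ->]|m p].
  exists (fun a b => y a b + y' a b); rewrite -big_split; apply: eq_bigr => a _.
  by rewrite -big_split; apply: eq_bigr => b _; rewrite tpureDl.
have [c ->] := eS p; exists (fun a b => c a b *: m).
rewrite tpure_sumr; apply: eq_bigr => a _.
by rewrite tpure_sumr; apply: eq_bigr => b _; rewrite tpureZr tpureZl.
Qed.

(** The coefficients of a tensor on the matrix units can be read off from its
    image by mcoef, which reduces injectivity to that of the other factor. *)
Lemma mul_lift_inj (A P R : algType k) (I : finType) (e : I -> I -> P)
    (f : A -> R) (g : P -> R) :
  matrix_units e -> units_span e -> linear f -> alg_morph g ->
  (forall a p, f a * g p = g p * f a) -> injective f ->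
  injective (mul_lift f g).
Proof.
move=> eP eS fl gm fg fi; have gl : linear g by case: gm.
have ml := mul_lift_linear fl gl.
apply: (lin_inj ml) => z; have [y ->] := tensor_units_expand z eS.
rewrite (lin_sum ml) => z0.
have y0 a b : y a b = 0.
  apply: fi; rewrite (lin0 fl).
  pose e' a b := g (e a b); have e'P : matrix_units e' by exact: matrix_units_morph.
  rewrite -(mcoef_sum e'P (y := fun a b => f (y a b))) /=.
    set s := (X in mcoef _ X _ _); have -> : s = 0.
      rewrite -[RHS]z0; apply: eq_bigr => p _; rewrite (lin_sum ml).
      by apply: eq_bigr => q _; rewrite mul_lift_pure.
    exact: (lin0 (mcoef_linear e' a b)).
  by move=> *; apply: fg.
by apply: big1 => a _; apply: big1 => b _; rewrite y0 tpure0l.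
Qed.

Lemma mul_lift_injl (A P R : algType k) (I : finType) (e : I -> I -> P)
    (f : P -> R) (g : A -> R) :
  matrix_units e -> units_span e -> alg_morph f -> linear g ->
  (forall p a, f p * g a = g a * f p) -> injective g ->
  injective (mul_lift f g).
Proof.
move=> eP eS fm gl fg gi; have [fl _ _] := fm.
have sb : bilinear_map (fun (p : P) (a : A) => tpure a p).
  by split; [exact: (tpure_bilinear _ _).2|exact: (tpure_bilinear _ _).1].
have sb' : bilinear_map (fun (a : A) (p : P) => tpure p a).
  by split; [exact: (tpure_bilinear _ _).2|exact: (tpure_bilinear _ _).1].
pose sw := tlift (fun (p : P) (a : A) => tpure a p).
have swl : linear sw := tlift_linear sb.
have swi : injective sw.
  apply: (can_inj (g := tlift (fun a p => tpure p a))) => z.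
  elim/tensor_ind: z => [z z' h h'|p a].
    by rewrite (linD swl) (linD (tlift_linear sb')) h h'.
  by rewrite /sw !tlift_tpure.
have gf a p : g a * f p = f p * g a by rewrite fg.
apply: (eq_inj (inj_comp (mul_lift_inj eP eS gl fm gf gi) swi)) => z /=.
elim/tensor_ind: z => [z z' h h'|p a].
  rewrite (linD swl) (linD (mul_lift_linear gl fl)) h h'.
  by rewrite (linD (mul_lift_linear fl gl)).
by rewrite /sw tlift_tpure // !mul_lift_pure.
Qed.

End MatrixUnits.

(** * Quotient of an algebra by a two-sided ideal *)

Record ideal (k : fieldType) (A : algType k) := Ideal {
  ideal_mem :> A -> Prop;
  ideal_lin : forall c x y, ideal_mem x -> ideal_mem y -> ideal_mem (c *: x + y);
  ideal_mull : forall x y, ideal_mem y -> ideal_mem (x * y);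
  ideal_mulr : forall x y, ideal_mem x -> ideal_mem (x * y);
  ideal_0 : ideal_mem 0;
  ideal_1 : ~ ideal_mem 1
}.

Section Quotient.
Local Open Scope quotient_scope.
Variables (k : fieldType) (A : algType k) (I : ideal A).

Definition ieqv (x y : A) : bool := `[< I (x - y) >].

Lemma idealN x : I x -> I (- x).
Proof.
move=> Ix; rewrite -[- x]addr0 -scaleN1r.
by apply: ideal_lin => //; apply: ideal_0.
Qed.
Lemma idealD x y : I x -> I y -> I (x + y).
Proof. by move=> Ix Iy; rewrite -[x]scale1r; apply: ideal_lin. Qed.
Lemma ieqv_refl : reflexive ieqv.
Proof. by move=> x; apply/asboolP; rewrite subrr; apply: ideal_0. Qed.
Lemma ieqv_sym : symmetric ieqv.
Proof. by move=> x y; apply/asboolP/asboolP => /idealN; rewrite opprB. Qed.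
Lemma ieqv_trans : transitive ieqv.
Proof.
move=> y x z /asboolP h1 /asboolP h2; apply/asboolP.
by have := idealD h1 h2; rewrite addrA subrK.
Qed.
Canonical ieqv_equiv := EquivRel ieqv ieqv_refl ieqv_sym ieqv_trans.

Definition quot := {eq_quot ieqv}.
HB.instance Definition _ := Choice.on quot.

Definition qproj (x : A) : quot := \pi_(quot) x.

Lemma qprojP x y : (qproj x = qproj y) <-> I (x - y).
Proof.
split; first by move/eqmodP/asboolP.
by move=> h; apply/eqmodP/asboolP.
Qed.

Lemma qprojK (q : quot) : qproj (repr q) = q.
Proof. exact: reprK. Qed.

Lemma quot_ind (P : quot -> Prop) : (forall x, P (qproj x)) -> forall q, P q.
Proof. by move=> h q; rewrite -(qprojK q). Qed.

Lemma qrepr x : I (repr (qproj x) - x).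
Proof. by apply/qprojP; rewrite qprojK. Qed.

Definition qadd (p q : quot) := qproj (repr p + repr q).
Definition qmul (p q : quot) := qproj (repr p * repr q).
Definition qscale (c : k) (p : quot) := qproj (c *: repr p).

Lemma qaddE x y : qadd (qproj x) (qproj y) = qproj (x + y).
Proof.
by apply/qprojP; rewrite opprD addrACA; apply: idealD; apply: qrepr.
Qed.
Lemma qscaleE c x : qscale c (qproj x) = qproj (c *: x).
Proof.
apply/qprojP; rewrite -scalerBr -[_ *: _]addr0.
by apply: ideal_lin; [apply: qrepr|apply: ideal_0].
Qed.
Lemma qmulE x y : qmul (qproj x) (qproj y) = qproj (x * y).
Proof.
apply/qprojP; rewrite -(subrK (x * repr (qproj y)) (_ * _)) -addrA.
apply: idealD; first by rewrite -mulrBl; apply: ideal_mulr; apply: qrepr.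
by rewrite -mulrBr; apply: ideal_mull; apply: qrepr.
Qed.

Lemma qaddA : associative qadd.
Proof. by do 3!elim/quot_ind=> ?; rewrite !qaddE addrA. Qed.
Lemma qaddC : commutative qadd.
Proof. by do 2!elim/quot_ind=> ?; rewrite !qaddE addrC. Qed.
Lemma qadd0 : left_id (qproj 0) qadd.
Proof. by elim/quot_ind=> ?; rewrite !qaddE add0r. Qed.
Lemma qaddN : left_inverse (qproj 0) (qscale (-1)) qadd.
Proof. by elim/quot_ind=> ?; rewrite qscaleE qaddE scaleN1r addNr. Qed.
HB.instance Definition _ := GRing.isZmodule.Build quot qaddA qaddC qadd0 qaddN.

Lemma qscaleA c d q : qscale c (qscale d q) = qscale (c * d) q.
Proof. by elim/quot_ind: q => ?; rewrite !qscaleE scalerA. Qed.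
Lemma qscale1 : left_id 1 qscale.
Proof. by elim/quot_ind=> ?; rewrite !qscaleE scale1r. Qed.
Lemma qscaleDr : right_distributive qscale +%R.
Proof.
by move=> c; do 2!elim/quot_ind=> ?; rewrite [_ + _]qaddE !qscaleE [RHS]qaddE scalerDr.
Qed.
Lemma qscaleDl q : {morph qscale^~ q : c d / c + d}.
Proof.
by elim/quot_ind: q => ? c d; rewrite !qscaleE [RHS]qaddE scalerDl.
Qed.
HB.instance Definition _ := GRing.Zmodule_isLmodule.Build k quot
  qscaleA qscale1 qscaleDr qscaleDl.

Lemma qmulA : associative qmul.
Proof. by do 3!elim/quot_ind=> ?; rewrite !qmulE mulrA. Qed.
Lemma qmul1l : left_id (qproj 1) qmul.
Proof. by elim/quot_ind=> ?; rewrite !qmulE mul1r. Qed.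
Lemma qmul1r : right_id (qproj 1) qmul.
Proof. by elim/quot_ind=> ?; rewrite !qmulE mulr1. Qed.
Lemma qmulDl : left_distributive qmul +%R.
Proof.
by do 3!elim/quot_ind=> ?; rewrite [_ + _]qaddE !qmulE [RHS]qaddE mulrDl.
Qed.
Lemma qmulDr : right_distributive qmul +%R.
Proof.
by do 3!elim/quot_ind=> ?; rewrite [_ + _]qaddE !qmulE [RHS]qaddE mulrDr.
Qed.
Lemma qone_neq0 : qproj 1 != 0.
Proof.
apply/eqP => /qprojP; rewrite subr0; exact: ideal_1.
Qed.
HB.instance Definition _ := GRing.Zmodule_isNzRing.Build quot
  qmulA qmul1l qmul1r qmulDl qmulDr qone_neq0.

Let qprojZ c x : c *: qproj x = qproj (c *: x). Proof. exact: qscaleE. Qed.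
Let qprojM x y : qproj x * qproj y = qproj (x * y). Proof. exact: qmulE. Qed.

Lemma qscaleAl (c : k) (p q : quot) : c *: (p * q) = (c *: p) * q.
Proof.
elim/quot_ind: p => x; elim/quot_ind: q => y.
by rewrite qprojM !qprojZ qprojM scalerAl.
Qed.
Lemma qscaleAr (c : k) (p q : quot) : c *: (p * q) = p * (c *: q).
Proof.
elim/quot_ind: p => x; elim/quot_ind: q => y.
by rewrite qprojM !qprojZ qprojM scalerAr.
Qed.
HB.instance Definition _ := GRing.Lmodule_isLalgebra.Build k quot qscaleAl.
HB.instance Definition _ := GRing.Lalgebra_isAlgebra.Build k quot qscaleAr.

Lemma qproj_linear : linear qproj.
Proof.
by move=> c x y; rewrite [c *: qproj x]qscaleE [RHS]qaddE.
Qed.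
Lemma qproj_monoid : monoid_morphism qproj.
Proof. by split=> // x y; rewrite [RHS]qmulE. Qed.
HB.instance Definition _ := GRing.isLinear.Build k A quot _ qproj qproj_linear.
HB.instance Definition _ := GRing.isMonoidMorphism.Build A quot qproj qproj_monoid.

Lemma qproj0 x : qproj x = 0 <-> I x.
Proof. by rewrite -[x in I x]subr0; apply: qprojP. Qed.

Definition qlift (B : lmodType k) (f : A -> B) (q : quot) : B := f (repr q).

Lemma qliftE (B : lmodType k) (f : A -> B) x :
  linear f -> (forall x, I x -> f x = 0) -> qlift f (qproj x) = f x.
Proof.
by move=> fl fI; apply/eqP; rewrite -subr_eq0 /qlift -(linB fl); apply/eqP/fI/qrepr.
Qed.

Lemma qlift_linear (B : lmodType k) (f : A -> B) :
  linear f -> (forall x, I x -> f x = 0) -> linear (qlift f).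
Proof.
move=> fl fI c; elim/quot_ind=> x; elim/quot_ind=> y.
by rewrite -linearP !qliftE // fl.
Qed.

Lemma qlift_morph (B : algType k) (f : A -> B) :
  alg_morph f -> (forall x, I x -> f x = 0) -> alg_morph (qlift f).
Proof.
move=> [fl fM f1] fI; split; first exact: qlift_linear.
- by elim/quot_ind=> x; elim/quot_ind=> y; rewrite -rmorphM !qliftE // fM.
- by rewrite -[1]/(qproj 1) qliftE.
Qed.

End Quotient.

(** * The antipode *)

Lemma lin_tlift_param (k : fieldType) (A B N M : lmodType k) (f : N -> A -> B -> M) z :
  (forall a b, linear (fun c => f c a b)) -> linear (fun c => tlift (f c) z).
Proof.
move=> fl c x y; rewrite /tlift /bval scaler_sumr -big_split.
by apply: eq_bigr => p _; apply: fl.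
Qed.

Lemma tlift_mul (k : fieldType) (A B : algType k) (M : lmodType k)
    (h : A -> B -> M) (z w : tensor A B) : bilinear_map h ->
  tlift h (z * w) =
  tlift (fun a b => tlift (fun c d => h (a * c) (b * d)) w) z.
Proof.
move=> hb; have ib a b : bilinear_map (fun c d => h (a * c) (b * d)).
  apply: bilin => [d|c] s t t'; rewrite mulrDr -scalerAr; first exact: hb.1.
  exact: hb.2.
have ob : bilinear_map (fun a b => tlift (fun c d => h (a * c) (b * d)) w).
  by apply: bilin => [b|a]; apply: lin_tlift_param => c d s t t';
    rewrite mulrDl -scalerAl; [exact: hb.1|exact: hb.2].
elim/tensor_ind: z => [z z' e e'|a b].
  by rewrite mulrDl !(linD (tlift_linear _)) // e e'.
rewrite [RHS]tlift_tpure //; elim/tensor_ind: w {ob} => [w w' e e'|c d].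
  by rewrite mulrDr !(linD (tlift_linear _)) // e e'.
by rewrite tpureM !tlift_tpure.
Qed.

Lemma tassoc_bilin (k : fieldType) (A B C : lmodType k) : bilinear_map
  (fun (z : tensor A B) (c : C) => tlift (fun a b => tpure a (tpure b c)) z).
Proof.
apply: bilin => [c|z].
  apply: tlift_linear; apply: bilin => [b|a]; first exact: (tpure_bilinear _ _).1.
  exact: (lin_comp ((tpure_bilinear _ _).1 c) ((tpure_bilinear _ _).2 a)).
apply: lin_tlift_param => a b.
exact: (lin_comp ((tpure_bilinear _ _).2 b) ((tpure_bilinear _ _).2 a)).
Qed.

Lemma tassocE (k : fieldType) (A B C : lmodType k) (a : A) (b : B) (c : C) :
  tassoc (tpure (tpure a b) c) = tpure a (tpure b c).
Proof.
rewrite /tassoc tlift_tpure; last exact: tassoc_bilin.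
rewrite tlift_tpure //; apply: bilin => [b'|a']; first exact: (tpure_bilinear _ _).1.
exact: (lin_comp ((tpure_bilinear _ _).1 c) ((tpure_bilinear _ _).2 a')).
Qed.

Lemma tassocD (k : fieldType) (A B C : lmodType k) (x y : tensor (tensor A B) C) :
  tassoc (x + y) = tassoc x + tassoc y.
Proof. exact: (linD (tlift_linear (@tassoc_bilin k A B C))). Qed.

Lemma tassoc_tmap (k : fieldType) (A A' B B' C C' : lmodType k) (f : {linear A -> A'})
    (g : {linear B -> B'}) (h : {linear C -> C'}) x :
  tassoc (tmap (tmap f g) h x) = tmap f (tmap g h) (tassoc x).
Proof.
elim/tensor_ind: x => [x y hx hy|z c].
  by rewrite tmapD !tassocD tmapD hx hy.
elim/tensor_ind: z => [x y hx hy|a b].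
  by rewrite tpureDl tmapD !tassocD tmapD hx hy.
by rewrite tmap_tpure /= tmap_tpure !tassocE tmap_tpure /= tmap_tpure.
Qed.

Section HopfAntipode.
Variables (k : fieldType) (H : hopfAlg k).
Local Notation D := (comult H).
Local Notation S := (antipode H).
Local Notation eps := (counit H).

Lemma scale_bilinl (A B : lmodType k) (f : A -> k^o) : linear f ->
  bilinear_map (fun (a : A) (b : B) => (f a : k) *: b).
Proof.
move=> fl; apply: bilin => [b|a] c x y; first by rewrite fl scalerDl scalerA.
by rewrite scalerDr !scalerA mulrC.
Qed.

Lemma scale_bilinr (A B : lmodType k) (f : B -> k^o) : linear f ->
  bilinear_map (fun (a : A) (b : B) => (f b : k) *: a).
Proof.
move=> fl; apply: bilin => [b|a] c x y; last by rewrite fl scalerDl scalerA.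
by rewrite scalerDr !scalerA mulrC.
Qed.

(** Coassociativity as an identity of threefold sums, the form in which it is
    used in computations with iterated coproducts. *)
Lemma coassoc (M : lmodType k) (phi : H -> H -> H -> M) x :
  (forall b c, linear (fun a => phi a b c)) ->
  (forall a c, linear (fun b => phi a b c)) ->
  (forall a b, linear (fun c => phi a b c)) ->
  tlift (fun a c => tlift (fun a1 a2 => phi a1 a2 c) (D a)) (D x) =
  tlift (fun a b => tlift (fun b1 b2 => phi a b1 b2) (D b)) (D x).
Proof.
move=> l1 l2 l3.
have pb a : bilinear_map (phi a) by apply: bilin => [b|a']; [apply: l2|apply: l3].
have pb' c : bilinear_map (fun a b => phi a b c).
  by apply: bilin => [b|a']; [apply: l1|apply: l2].
pose F a (z : tensor H H) := tlift (phi a) z.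
pose G (z : tensor H H) c := tlift (fun a b => phi a b c) z.
have Fb : bilinear_map F.
  by apply: bilin => [z|a]; [apply: lin_tlift_param|apply: tlift_linear].
have Gb : bilinear_map G.
  by apply: bilin => [z|a]; [apply: tlift_linear|apply: lin_tlift_param].
transitivity (tlift G (tmap D idfun (D x))); first by rewrite tlift_tmap.
transitivity (tlift F (tmap idfun D (D x))); last by rewrite tlift_tmap.
rewrite -comultA; elim/tensor_ind: (tmap _ _ _) => [x1 x2 h1 h2|z c].
  by rewrite tassocD (linD (tlift_linear Gb)) (linD (tlift_linear Fb)) h1 h2.
elim/tensor_ind: z => [z1 z2 h1 h2|a b].
  rewrite tpureDl tassocD (linD (tlift_linear Gb)) (linD (tlift_linear Fb)).
  by rewrite h1 h2.
by rewrite tassocE !tlift_tpure // /G /F !tlift_tpure.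
Qed.

(** Both sides are inverse to the product map for the convolution of bilinear
    maps on the coalgebra of pairs; N below is S(xy) when it is summed from one
    end and S(y) S(x) when it is summed from the other.  Since a
    lift is by definition a sum over a representative of its argument, sums over
    the two coproducts are exchanged freely. *)
Lemma antipodeM x y : S (x * y) = S y * S x.
Proof.
have [Dl DM D1] := alg_morph_lr D; have [el eM e1] := alg_morph_lr eps.
have Sl := is_linear S.
have Mb (f g : H -> H) : linear f -> linear g ->
    bilinear_map (fun a b => f a * g b) := @mul_bilin _ _ _ _ f g.
have idl : linear (@id H) by [].
(* the triple product S(x1 y1) x2 y2 S(y3) S(x3), with the last two factors of
   x and of y grouped *)
pose N := tlift (fun x1 x' => tlift (fun x2 x3 =>
            tlift (fun y1 y' => tlift (fun y2 y3 =>
               S (x1 * y1) * x2 * y2 * S y3 * S x3) (D y')) (D y)) (D x')) (D x).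
have EL : N = S (x * y).
  have E1 x1 x2 x3 : tlift (fun y1 y' => tlift (fun y2 y3 =>
       S (x1 * y1) * x2 * y2 * S y3 * S x3) (D y')) (D y) = 
       S (x1 * y) * x2 * S x3.
    transitivity (tlift (fun y1 y' => S (x1 * (eps y' *: y1)) * x2 * S x3) (D y)).
      apply: eq_tlift => y1 y'.
      transitivity (S (x1 * y1) * x2 * tlift (fun a b => a * S b) (D y') * S x3).
        rewrite (@lin_tlift _ _ _ _ _ (fun t => S (x1 * y1) * x2 * t * S x3)).
        + by apply: eq_tlift => a b; rewrite !mulrA.
        + exact: (lin_mulrr _ (lin_mulrl _ idl)).
        + exact: Mb.
      by rewrite antipoder mulr_algr -scalerAr linearZ /= -!scalerAl.
    rewrite -[in RHS](counitr y).
    rewrite (@lin_tlift _ _ _ _ _ (fun t => S (x1 * t) * x2 * S x3)) //.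
    + exact: (lin_mulrr _ (lin_mulrr _ (lin_comp (lin_mulrl _ idl) Sl))).
    + exact: scale_bilinr.
  transitivity (tlift (fun x1 x' => S ((eps x' *: x1) * y)) (D x)).
    apply: eq_tlift => x1 x'.
    transitivity (S (x1 * y) * tlift (fun a b => a * S b) (D x')).
      rewrite (lin_tlift _ (lin_mulrl _ idl)); last exact: Mb.
      by apply: eq_tlift => a b; rewrite E1 mulrA.
    by rewrite antipoder mulr_algr -scalerAl linearZ.
  rewrite -[in RHS](counitr x) (lin_tlift _ (lin_comp (lin_mulrr _ idl) Sl)) //.
  exact: scale_bilinr.
rewrite -EL.
(* the same sum, with the first two factors of x and of y grouped *)
transitivity (tlift (fun x' x3 => tlift (fun x1 x2 =>
   tlift (fun y1 y' => tlift (fun y2 y3 =>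
        S (x1 * y1) * x2 * y2 * S y3 * S x3) (D y')) (D y)) (D x')) (D x)).
  symmetry; apply: coassoc => [x2 x3|x1 x3|x1 x2]; apply: lin_tlift_param => y1 y';
    apply: lin_tlift_param => y2 y3.
  - do 4!apply: lin_mulrr; exact: (lin_comp (lin_mulrr _ idl) Sl).
  - do 3!apply: lin_mulrr; exact: lin_mulrl.
  - by apply: lin_mulrl.
transitivity (tlift (fun x' x3 => S (eps x' *: y) * S x3) (D x)).
  apply: eq_tlift => x' x3.
  transitivity (tlift (fun x1 x2 =>
     tlift (fun y' y3 => tlift (fun y1 y2 =>
        S (x1 * y1) * x2 * y2 * S y3 * S x3) (D y')) (D y)) (D x')).
    apply: eq_tlift => x1 x2; symmetry; apply: coassoc => [y2 y3|y1 y3|y1 y2].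
    - do 4!apply: lin_mulrr; exact: (lin_comp (lin_mulrl _ idl) Sl).
    - do 2!apply: lin_mulrr; exact: lin_mulrl.
    - by apply: lin_mulrr; apply: lin_mulrl.
  transitivity (tlift (fun y' y3 => (eps x' * eps y') *: (S y3 * S x3)) (D y)).
    rewrite /tlift /bval exchange_big /=; apply: eq_bigr => -[y' y3] _ /=.
    have E : tlift (fun x1 x2 => tlift (fun y1 y2 => S (x1 * y1) * (x2 * y2))
                                       (D y')) (D x') = (eps x' * eps y')%:A.
      by rewrite -(tlift_mul _ _ (Mb _ _ Sl idl)) -DM antipodel eM.
    rewrite -mulr_algl -E /tlift /bval mulr_suml; apply: eq_bigr => p _.
    by rewrite mulr_suml; apply: eq_bigr => q _; rewrite !mulrA.
  rewrite linearZ /= -scalerAl -[in RHS](counitl y).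
  rewrite (@lin_tlift _ _ _ _ _ (fun t => (eps x' : k) *: (S t * S x3))).
  - by apply: eq_tlift => a b; rewrite linearZ /= -scalerAl scalerA.
  - by move=> c s t; rewrite Sl mulrDl -scalerAl scalerDr !scalerA mulrC.
  - exact: (scale_bilinl _ el).
rewrite -[in RHS](counitl x).
rewrite (@lin_tlift _ _ _ _ _ (fun t => S y * S t)).
- by apply: eq_tlift => a b; rewrite !linearZ /= -scalerAl -scalerAr.
- exact: (lin_mulrl _ Sl).
- exact: (scale_bilinl _ el).
Qed.

End HopfAntipode.

(** * Minimality forbids Hopf ideals *)

Section HopfQuotient.
Variables (k : fieldType) (H : hopfAlg k) (I : ideal H).
Local Notation q := (@qproj k H I).
Local Notation D := (comult H).
Local Notation S := (antipode H).
Local Notation eps := (counit H).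
Hypothesis ID : forall x, I x -> tmap q q (D x) = 0.
Hypothesis Ieps : forall x, I x -> eps x = 0.
Hypothesis IS : forall x, I x -> I (S x).

Lemma qcomult_fun_morph : alg_morph (fun x => tmap q q (D x)).
Proof. by apply: alg_morph_comp (alg_morph_lr D) _; apply: tmap_morph;
  apply: (alg_morph_lr q). Qed.

Definition qcomult : {lrmorphism quot I -> tensor (quot I) (quot I)} :=
  lrmorph_pack (qlift_morph qcomult_fun_morph ID).
Definition qcounit : {lrmorphism quot I -> k^o} :=
  lrmorph_pack (qlift_morph (alg_morph_lr eps) Ieps).

Lemma qS_lin : linear (fun x => q (S x)).
Proof. by move=> c x y; rewrite !linearP. Qed.
Lemma qS_vanish x : I x -> q (S x) = 0.
Proof. by move=> Ix; apply/qproj0/IS. Qed.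

Definition qantipode : {linear quot I -> quot I} :=
  linear_pack (qlift_linear qS_lin qS_vanish).

Lemma qcomultE x : qcomult (q x) = tmap q q (D x).
Proof. by have [l _ _] := qcomult_fun_morph; exact: (qliftE _ l ID). Qed.
Lemma qcounitE x : qcounit (q x) = eps x.
Proof. exact: (qliftE _ (is_linear eps) Ieps). Qed.
Lemma qantipodeE x : qantipode (q x) = q (S x).
Proof. exact: (qliftE _ qS_lin qS_vanish). Qed.

Lemma qcomultA p :
  tassoc (tmap qcomult idfun (qcomult p)) = tmap idfun qcomult (qcomult p).
Proof.
elim/quot_ind: p => x; rewrite qcomultE.
pose F1 : {linear H -> tensor (quot I) (quot I)} :=
  linear_pack (let: And3 l _ _ := qcomult_fun_morph in l).
rewrite (@tmap_comp _ _ _ _ _ _ _ q qcomult F1 q idfun q) //; last first.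
  by move=> y; exact: qcomultE.
rewrite (@tmap_comp _ _ _ _ _ _ _ q idfun q q qcomult F1) //; last first.
  by move=> y; exact: qcomultE.
rewrite -(@tmap_comp _ _ _ _ _ _ _ D (tmap q q) F1 idfun q q) //.
rewrite -(@tmap_comp _ _ _ _ _ _ _ idfun q q D (tmap q q) F1) //.
by rewrite tassoc_tmap comultA.
Qed.

Lemma qcounitl p : tlift (fun a b => qcounit a *: b) (qcomult p) = p.
Proof.
elim/quot_ind: p => x; rewrite qcomultE tlift_tmap; last first.
  exact: (scale_bilinl _ (is_linear qcounit)).
rewrite -[in RHS](counitl x) (lin_tlift _ (is_linear q)).
  by apply: eq_tlift => a b; rewrite qcounitE linearZ.
exact: (scale_bilinl _ (is_linear eps)).
Qed.

Lemma qcounitr p : tlift (fun a b => qcounit b *: a) (qcomult p) = p.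
Proof.
elim/quot_ind: p => x; rewrite qcomultE tlift_tmap; last first.
  exact: (scale_bilinr _ (is_linear qcounit)).
rewrite -[in RHS](counitr x) (lin_tlift _ (is_linear q)).
  by apply: eq_tlift => a b; rewrite qcounitE linearZ.
exact: (scale_bilinr _ (is_linear eps)).
Qed.

Lemma qantipodel p :
  tlift (fun a b => qantipode a * b) (qcomult p) = (qcounit p : k) *: (1 : quot I).
Proof.
have id_lin (R : lmodType k) : linear (@id R) by [].
elim/quot_ind: p => x; rewrite qcomultE tlift_tmap; last first.
  exact: (mul_bilin (is_linear qantipode) (id_lin (quot I))).
rewrite qcounitE.
have -> : (eps x : k) *: (1 : quot I) = q ((eps x)%:A) by rewrite linearZ /= rmorph1.
rewrite -antipodel (lin_tlift _ (is_linear q)).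
  by apply: eq_tlift => a b; rewrite qantipodeE rmorphM.
exact: (mul_bilin (is_linear S) (id_lin H)).
Qed.

Lemma qantipoder p :
  tlift (fun a b => a * qantipode b) (qcomult p) = (qcounit p : k) *: (1 : quot I).
Proof.
have id_lin (R : lmodType k) : linear (@id R) by [].
elim/quot_ind: p => x; rewrite qcomultE tlift_tmap; last first.
  exact: (mul_bilin (id_lin (quot I)) (is_linear qantipode)).
rewrite qcounitE.
have -> : (eps x : k) *: (1 : quot I) = q ((eps x)%:A) by rewrite linearZ /= rmorph1.
rewrite -antipoder (lin_tlift _ (is_linear q)).
  by apply: eq_tlift => a b; rewrite qantipodeE rmorphM.
exact: (mul_bilin (id_lin H) (is_linear S)).
Qed.

Definition qhopf : hopfAlg k :=
  @HopfAlg k (quot I) qcomult qcounit qantipode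
    qcomultA qcounitl qcounitr qantipodel qantipoder.

Definition qhopf_proj : {lrmorphism H -> qhopf} := q.

Lemma qhopf_proj_morph : is_hopf_morphism qhopf_proj.
Proof.
split=> x; first exact: qcomultE.
- exact: qcounitE.
- exact: qantipodeE.
Qed.

End HopfQuotient.

Section HopfIdealModel.
Variables (k : fieldType) (A B : algType k) (w : tensor A B) (M : model w).
Hypothesis Mmin : minimal_model M.
Local Notation H := (model_hopf M).
Local Notation v := (model_corep M).
Local Notation pi := (model_rep M).
Variable I : ideal H.
Local Notation q := (@qproj k H I).
Hypothesis ID : forall x, I x -> tmap q q (comult H x) = 0.
Hypothesis Ieps : forall x, I x -> counit H x = 0.
Hypothesis IS : forall x, I x -> I (antipode H x).
Hypothesis Ipi : forall x, I x -> pi x = 0.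

Local Notation Q := (qhopf ID Ieps IS).
Local Notation p := (qhopf_proj ID Ieps IS).

Definition qcorep : tensor A Q := tmap idfun p v.

Lemma qcorepP : is_corep qcorep.
Proof.
have [pD peps pS] := qhopf_proj_morph ID Ieps IS.
have [vD veps] := model_corepP M.
have [e2 e3] := tmap_legs p v.
have e1 : tmap idfun (comult Q) (tmap idfun p v) =
          tmap idfun (tmap p p) (tmap idfun (comult H) v).
  pose g := linear_pack (lin_comp (is_linear p) (is_linear (comult Q))).
  transitivity (tmap idfun g v); [|symmetry]; apply: tmap_comp => // h.
  by rewrite -[LHS]pD.
split.
  rewrite /qcorep e1 e2 e3 vD tmapM //; apply: tmapM; exact: rmorphM.
rewrite -veps /qcorep (@tmap_comp _ _ _ _ _ _ _ idfun idfun idfun p _ (counit H)) //.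
Qed.

Definition qrep : {lrmorphism Q -> B} :=
  lrmorph_pack (qlift_morph (alg_morph_lr pi) Ipi).

Lemma qrepE x : qrep (p x) = pi x.
Proof. exact: (qliftE _ (is_linear pi) Ipi). Qed.

Lemma qrepP : tmap idfun qrep qcorep = w.
Proof.
transitivity (tmap idfun pi v); last exact: model_repP.
by apply: tmap_comp => // a; apply: qrepE.
Qed.

Definition qmodel : model w := Model qcorepP qrepP.

Lemma qmodel_left_faithful : left_faithful qmodel.
Proof.
have [Mf _] := Mmin; have [pD peps pS] := qhopf_proj_morph ID Ieps IS.
move=> y; have -> : y = p (repr (y : quot I)) by exact: esym (qprojK (y : quot I)).
move=> P Pcl Pgen; have := Mf (repr (y : quot I)) [pred h | p h \in P].
apply.
  case: Pcl => P1 Pl PM; split; rewrite ?inE ?rmorph1 //.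
    by move=> c a b; rewrite !inE linearP; apply: Pl.
  by move=> a b; rewrite !inE rmorphM; apply: PM.
move=> _ [n _ [c [f ->] <-]]; rewrite inE; apply: Pgen.
exists n => //; exists (p (tlift (fun a h => f a *: h) v)).
  exists f; rewrite /= /qcorep tlift_tmap.
    rewrite (lin_tlift _ (is_linear p)).
      by apply: eq_tlift => a b; rewrite linearZ.
    exact: (scale_bilinl _ (is_linear f)).
  exact: (scale_bilinl _ (is_linear f)).
by elim: n => // n IHn; rewrite iterS IHn iterS; apply: pS.
Qed.

(** The quotient by a Hopf ideal below the kernel of the representation is a
    left-faithful model, so terminality makes the projection injective. *)
Lemma minimal_ideal0 x : I x -> x = 0.
Proof.
have [Mf Mterm] := Mmin.
have [f [fmod _]] := Mterm _ qmodel_left_faithful.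
have [g [_ guniq]] := Mterm _ Mf.
have [[fD feps fS] fv fpi] := fmod.
have [pD peps pS] := qhopf_proj_morph ID Ieps IS.
pose f' : {lrmorphism Q -> H} := f.
have e1 : g =1 (f' \o p).
  apply: guniq; split.
  - split=> h.
    + rewrite [LHS](fD (p h)) [comult _ _](pD h); exact: tmap_comp.
    + exact: etrans (feps (p h)) (peps h).
    + exact: etrans (fS (p h)) (congr1 f (pS h)).
  - by rewrite -[RHS]fv; symmetry; apply: tmap_comp.
  - by move=> h; rewrite -[RHS](fpi (p h)); symmetry; apply: qrepE.
have e2 : g =1 idfun.
  apply: guniq; split; first by split=> h //=; rewrite tmap_id.
    by rewrite tmap_id.
  by [].
move=> Ix; have := e2 x; rewrite e1 /= => <-.
by rewrite /qhopf_proj (iffRL (qproj0 _ _) Ix) linear0.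
Qed.

End HopfIdealModel.

(** * Intertwiners of the minimal model *)

Section FiniteDimension.
Variable k : fieldType.

(** Finite dimensionality, in the form that lets an element of A (x) H be
    detected by its slices along A. *)
Definition has_dual_basis (A : lmodType k) :=
  exists (J : finType) (b : J -> A) (f : J -> A -> k^o),
    (forall j, linear (f j)) /\ forall a, a = \sum_j (f j a : k) *: b j.

Lemma dual_basis_tensor (A B : lmodType k) :
  has_dual_basis A -> has_dual_basis B -> has_dual_basis (tensor A B).
Proof.
move=> [I [a [f [fl fE]]]] [J [b [g [gl gE]]]].
exists (I * J)%type, (fun p => tpure (a p.1) (b p.2)).
exists (fun p => tlift (fun x y => (f p.1 x : k) *: g p.2 y)).
have bl p : bilinear_map (fun x y => (f p.1 x : k) *: g p.2 y).
  apply: bilin => [y|x] c s t; first by rewrite fl scalerDl scalerA.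
  by rewrite gl scalerDr !scalerA mulrC.
split=> [p|z]; first exact: tlift_linear.
elim/tensor_ind: z => [z z' h h'|x y].
  rewrite [in LHS]h [in LHS]h' -big_split; apply: eq_bigr => p _ /=.
  by rewrite (linD (tlift_linear (bl p))) scalerDl.
rewrite [x in LHS]fE [y in LHS]gE tpure_suml.
under eq_bigr do rewrite tpure_sumr.
rewrite pair_bigA; apply: eq_bigr => p _.
by rewrite tlift_tpure // tpureZl tpureZr scalerA.
Qed.

Lemma dual_basis_scalar : has_dual_basis (k^o : lmodType k).
Proof.
exists unit, (fun _ => 1), (fun _ => id); split=> [|a]; first by [].
by rewrite big_const /= card_unit /= addr0 [RHS]mulr1.
Qed.

Definition slice (A H : lmodType k) (f : A -> k^o) (z : tensor A H) : H :=
  tlift (fun a h => (f a : k) *: h) z.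

Lemma slice_linear (A H : lmodType k) (f : A -> k^o) :
  linear f -> linear (@slice A H f).
Proof. by move=> fl; apply/tlift_linear/scale_bilinl. Qed.

Lemma slice_tmap (A H H' : lmodType k) (f : A -> k^o) (g : {linear H -> H'}) z :
  linear f -> g (slice f z) = slice f (tmap idfun g z).
Proof.
move=> fl; rewrite /slice tlift_tmap; last exact: scale_bilinl.
rewrite (lin_tlift _ (is_linear g)); last exact: scale_bilinl.
by apply: eq_tlift => a b; rewrite linearZ.
Qed.

Lemma slice_eq0 (A H : lmodType k) (z : tensor A H) : has_dual_basis A ->
  (forall f : {linear A -> k^o}, slice f z = 0) -> z = 0.
Proof.
move=> [J [b [f [fl fE]]]] h.
have -> : z = \sum_j tpure (b j) (slice (f j) z).
  elim/tensor_ind: z {h} => [z z' e e'|x y].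
    rewrite [in LHS]e [in LHS]e' -big_split; apply: eq_bigr => j _ /=.
    by rewrite (linD (slice_linear (fl j))) tpureDr.
  rewrite [x in LHS]fE tpure_suml; apply: eq_bigr => j _.
  rewrite /slice tlift_tpure; last exact: scale_bilinl.
  by rewrite tpureZl tpureZr.
apply: big1 => j _; rewrite -(tpure0r _ (b j)); congr tpure.
exact: (h (linear_pack (fl j))).
Qed.

End FiniteDimension.

Section Corep.
Variables (k : fieldType) (A : algType k) (H : hopfAlg k) (a : tensor A H).
Hypothesis aP : is_corep a.
Local Notation S := (antipode H).

Let id_lin (R : lmodType k) : linear (@id R). Proof. by []. Qed.

Lemma in_alg_linear : linear (fun t : k^o => (t : k) *: (1 : H)).
Proof. by move=> c x y; rewrite scalerDl scalerA. Qed.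

Lemma corep_counit (g : {linear H -> H}) :
  (forall x, g x = (counit H x : k) *: 1) -> tmap idfun g a = 1.
Proof.
move=> gE; have [_ ae] := aP.
transitivity (tmap idfun (linear_pack in_alg_linear) (tmap idfun (counit H) a)).
  by symmetry; apply: tmap_comp => // x; rewrite gE.
by rewrite ae tmap1 //= scale1r.
Qed.

(** Apply the antipode axioms to the second leg of a_12 a_13, which is the
    coproduct of a. *)
Lemma corep_antipode : inverse_of a (tmap idfun S a).
Proof.
have [aD _] := aP; have Sl := is_linear S.
have bl := mul_bilin Sl (@id_lin H); have br := mul_bilin (@id_lin H) Sl.
pose mSl : {linear tensor H H -> H} := linear_pack (tlift_linear bl).
pose mSr : {linear tensor H H -> H} := linear_pack (tlift_linear br).
have lin_D (g : {linear tensor H H -> H}) : linear (fun x => g (comult H x)).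
  exact: (lin_comp (is_linear (comult H)) (is_linear g)).
have el x y : tmap idfun mSl (tmap idfun (@tinl k H H) x * tmap idfun (@tinr k H H) y)
            = tmap idfun S x * y :> tensor A H.
  elim/tensor_ind: x => [x x' e e'|b h].
    by rewrite !tmapD !mulrDl tmapD e e'.
  elim/tensor_ind: y => [y y' e e'|c g].
    by rewrite !tmapD !mulrDr tmapD e e'.
  by rewrite !tmap_tpure !tpureM tmap_tpure /= mulr1 mul1r tlift_tpure.
have er x y : tmap idfun mSr (tmap idfun (@tinl k H H) x * tmap idfun (@tinr k H H) y)
            = x * tmap idfun S y :> tensor A H.
  elim/tensor_ind: x => [x x' e e'|b h].
    by rewrite !tmapD !mulrDl tmapD e e'.
  elim/tensor_ind: y => [y y' e e'|c g].
    by rewrite !tmapD !mulrDr tmapD e e'.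
  by rewrite !tmap_tpure !tpureM tmap_tpure /= mulr1 mul1r tlift_tpure.
split.
- rewrite -er -aD -(corep_counit (g := linear_pack (lin_D mSr))).
    exact: tmap_comp.
  exact: antipoder.
- rewrite -el -aD -(corep_counit (g := linear_pack (lin_D mSl))).
    exact: tmap_comp.
  exact: antipodel.
Qed.

End Corep.

Section GeneratedIdeal.
Variables (k : fieldType) (H : algType k) (E : H -> Prop) (eps : {lrmorphism H -> k^o}).
Hypothesis Eeps : forall x, E x -> eps x = 0.

Definition two_sided (J : H -> Prop) :=
  [/\ forall c x y, J x -> J y -> J (c *: x + y),
      forall x y, J y -> J (x * y), forall x y, J x -> J (x * y) & J 0].

(** As an intersection, so that a property is checked on the generated ideal by
    exhibiting a map whose kernel is a two-sided ideal. *)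
Definition gen_ideal_set (x : H) :=
  forall J, two_sided J -> (forall e, E e -> J e) -> J x.

Lemma kernel_two_sided (R : algType k) (f : H -> R) :
  linear f -> ({morph f : x y / x * y} \/ {morph f : x y / x * y >-> y * x}) ->
  two_sided (fun x => f x = 0).
Proof.
move=> fl fM; split=> [c x y fx fy|x y fy|x y fx|].
- by rewrite fl fx fy scaler0 addr0.
- by case: fM => fM; rewrite fM fy ?mulr0 ?mul0r.
- by case: fM => fM; rewrite fM fx ?mulr0 ?mul0r.
- exact: (lin0 fl).
Qed.

Lemma gen_ideal_vanish (R : algType k) (f : H -> R) :
  linear f -> ({morph f : x y / x * y} \/ {morph f : x y / x * y >-> y * x}) ->
  (forall e, E e -> f e = 0) -> forall x, gen_ideal_set x -> f x = 0.
Proof. by move=> fl fM fE x Ix; exact: (Ix _ (kernel_two_sided fl fM) fE). Qed.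

Lemma gen_ideal_lin c x y :
  gen_ideal_set x -> gen_ideal_set y -> gen_ideal_set (c *: x + y).
Proof. by move=> hx hy J Jt JE; case: (Jt) => l _ _ _; apply: l; [apply: hx|apply: hy]. Qed.
Lemma gen_ideal_mull x y : gen_ideal_set y -> gen_ideal_set (x * y).
Proof. by move=> hy J Jt JE; case: (Jt) => _ l _ _; apply: l; apply: hy. Qed.
Lemma gen_ideal_mulr x y : gen_ideal_set x -> gen_ideal_set (x * y).
Proof. by move=> hy J Jt JE; case: (Jt) => _ _ l _; apply: l; apply: hy. Qed.
Lemma gen_ideal_0 : gen_ideal_set 0.
Proof. by move=> J [_ _ _ ?] _. Qed.
Lemma gen_ideal_1 : ~ gen_ideal_set 1.
Proof.
have [el eM e1] := alg_morph_lr eps.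
move/(gen_ideal_vanish el (or_introl eM) Eeps)/eqP; rewrite e1.
by rewrite oner_eq0.
Qed.

Definition gen_ideal : ideal H :=
  Ideal gen_ideal_lin gen_ideal_mull gen_ideal_mulr gen_ideal_0 gen_ideal_1.

Lemma mem_gen_ideal e : E e -> gen_ideal e.
Proof. by move=> Ee J _; apply. Qed.

End GeneratedIdeal.

Lemma comm_inverse (R : nzRingType) (x y t : R) :
  inverse_of x y -> t * x = x * t -> t * y = y * t.
Proof.
move=> [xy yx] tx.
by rewrite -[LHS]mul1r -yx -!mulrA (mulrA x t) -tx -!mulrA xy mulr1.
Qed.

Section Intertwiners.
Variables (k : fieldType) (A B : algType k) (w : tensor A B) (M : model w).
Hypothesis Mmin : minimal_model M.
Local Notation H := (model_hopf M).
Local Notation pi := (model_rep M).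
Local Notation S := (antipode H).
Variables (C : algType k) (a : tensor C H) (T : C).
Hypotheses (Cfin : has_dual_basis C) (aP : is_corep a).
Local Notation ab := (tmap idfun pi a).

Let z : tensor C H := tinl H T * a - a * tinl H T.
Let E (x : H) := exists f : {linear C -> k^o}, x = slice f z.

Let tmap_commutator (R : algType k) (g : {linear H -> R}) :
  tmap idfun g z = tinl R T * tmap idfun g a - tmap idfun g a * tinl R T.
Proof.
rewrite /z (linB (tmap_linear _ g)); congr (_ - _);
  (elim/tensor_ind: a => [b b' e e'|b h];
   first by rewrite ?mulrDl ?mulrDr !tmapD ?mulrDl ?mulrDr e e').
- by rewrite tpureM !tmap_tpure tpureM !mul1r.
- by rewrite tpureM !tmap_tpure tpureM !mulr1.
Qed.

(* A linear map on H kills the coefficients of z exactly when it kills the second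
   leg of z: this turns each property of the ideal I they generate into a
   commutation of T with an image of a. *)
Let E_vanish (R : lmodType k) (g : {linear H -> R}) :
  tmap idfun g z = 0 -> forall x, E x -> g x = 0.
Proof.
move=> gz x [f ->]; rewrite (slice_tmap _ _ (is_linear f)) gz.
exact: (lin0 (slice_linear (is_linear f))).
Qed.

Let E_vanish' (R : lmodType k) (g : {linear H -> R}) :
  (forall x, E x -> g x = 0) -> tmap idfun g z = 0.
Proof.
move=> gE; apply: slice_eq0 => // f; rewrite -slice_tmap ?gE //.
- by exists f.
- exact: is_linear.
Qed.

Let Eeps x : E x -> counit H x = 0.
Proof.
apply: E_vanish; rewrite tmap_commutator.
by have [_ ->] := aP; rewrite mulr1 mul1r subrr.
Qed.

Local Notation I := (gen_ideal Eeps).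
Local Notation q := (@qproj k H I).

Let q_comm : tinl (quot I) T * tmap idfun q a = tmap idfun q a * tinl (quot I) T.
Proof.
apply/eqP; rewrite -subr_eq0 -tmap_commutator; apply/eqP.
by apply: E_vanish' => x Ex; exact: (iffRL (qproj0 I x) (mem_gen_ideal Eeps Ex)).
Qed.

(* The coproduct of a is a_12 a_13, and T commutes with both factors modulo I. *)
Let I_comult x : I x -> tmap q q (comult H x) = 0.
Proof.
pose g : {lrmorphism H -> tensor (quot I) (quot I)} :=
  lrmorph_pack (alg_morph_comp (alg_morph_lr (comult H))
    (tmap_morph (alg_morph_lr q) (alg_morph_lr q))).
have [gl gM g1] := alg_morph_lr g.
apply: (gen_ideal_vanish gl (or_introl gM)) => {}x; apply: E_vanish.
rewrite tmap_commutator.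
have [tl tr] := tmap_legs q a.
have -> : tmap idfun g a =
    tmap idfun (@tinl k _ _) (tmap idfun q a) * tmap idfun (@tinr k _ _) (tmap idfun q a).
  have [aD _] := aP.
  transitivity (tmap idfun (tmap q q) (tmap idfun (comult H) a)).
    by symmetry; apply: tmap_comp.
  rewrite aD tmapM //; last by apply: tmapM; apply: rmorphM.
  by rewrite tl tr.
have inl (R : algType k) (f : {lrmorphism quot I -> R}) :
    tinl R T * tmap idfun f (tmap idfun q a) = tmap idfun f (tmap idfun q a) * tinl R T.
  have [fl fM f1] := tmap_morph (alg_morph_lr (@idfun C)) (alg_morph_lr f).
  have <- : tmap idfun f (tinl (quot I) T) = tinl R T by rewrite tmap_tpure rmorph1.
  by rewrite -!fM q_comm.
by rewrite mulrA inl -mulrA inl mulrA subrr.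
Qed.

Let I_eps x : I x -> counit H x = 0.
Proof.
have [el eM e1] := alg_morph_lr (counit H).
exact: (gen_ideal_vanish el (or_introl eM) Eeps).
Qed.

(* The antipode turns a into its inverse, with which T commutes as well. *)
Let I_S x : I x -> I (S x).
Proof.
move=> Ix; apply/qproj0; move: x Ix.
have gl : linear (fun x => q (S x)) by apply: lin_comp; apply: is_linear.
apply: (gen_ideal_vanish gl) => [|x].
  by right=> x y; rewrite antipodeM rmorphM.
apply: (@E_vanish _ (linear_pack gl)); rewrite tmap_commutator.
have [al aM a1] := tmap_morph (alg_morph_lr (@idfun C)) (alg_morph_lr q).
have inv : inverse_of (tmap idfun q a) (tmap idfun (linear_pack gl) a).
  have <- : tmap idfun q (tmap idfun S a) = tmap idfun (linear_pack gl) a.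
    exact: tmap_comp.
  by have [i1 i2] := corep_antipode aP; split; rewrite -aM ?i1 ?i2 a1.
by apply/eqP; rewrite subr_eq0; apply/eqP/(comm_inverse inv)/q_comm.
Qed.

Hypothesis Tpi : tinl B T * ab = ab * tinl B T.

Let I_pi x : I x -> pi x = 0.
Proof.
have [el eM e1] := alg_morph_lr pi.
apply: (gen_ideal_vanish el (or_introl eM)) => {}x; apply: E_vanish.
by rewrite tmap_commutator Tpi subrr.
Qed.

(** The coefficients of T a - a T generate a Hopf ideal below the kernel of the
    representation, and minimality leaves no room for one but 0. *)
Lemma corep_End_of_rep : corep_End a T.
Proof.
apply/eqP; rewrite -subr_eq0; apply/eqP; apply: slice_eq0 => // f.
apply: (minimal_ideal0 Mmin I_comult I_eps I_S I_pi).
by apply: mem_gen_ideal; exists f.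
Qed.

End Intertwiners.

(** * Endomorphism algebras, transposition and alternating products *)

Section LendUnits.
Variables (k : fieldType) (V : vectType k) (hV : (0 < dim V)%N).
Let X := vbasis (fullv : {vspace V}).
Let n : nat := \dim (fullv : {vspace V}).

Definition Lend_unit (a b : 'I_n) : Lend hV :=
  linfun (fun v : V => coord X b v *: X`_a).
Definition Lend_coord (a b : 'I_n) (f : Lend hV) : k^o := coord X a (f X`_b).

Lemma Lend_unitE a b v : Lend_unit a b v = coord X b v *: X`_a.
Proof.
have fl : linear (fun v : V => coord X b v *: X`_a).
  by move=> c x y; rewrite linearP scalerDl scalerA.
exact: (lfunE (linear_pack fl) v).
Qed.

Lemma basis_coord v : v = \sum_a coord X a v *: X`_a.
Proof. by apply: coord_vbasis; rewrite memvf. Qed.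

Lemma coord_basis (a b : 'I_n) : coord X a X`_b = (a == b)%:R.
Proof.
have fX : free X by apply: basis_free; apply: vbasisP.
by rewrite (coord_free b a fX) eq_sym.
Qed.

Lemma Lend_coord_linear a b : linear (Lend_coord a b).
Proof.
by move=> c f g; rewrite /Lend_coord add_lfunE scale_lfunE linearP.
Qed.

Lemma Lend_units : matrix_units Lend_unit.
Proof.
split=> [a b c d|].
  apply/lfunP => v; rewrite Lend_mulE comp_lfunE !Lend_unitE linearZ /=.
  rewrite coord_basis; case: (eqVneq b c) => bc.
    by rewrite mulr1 Lend_unitE.
  by rewrite mulr0 scale0r zero_lfunE.
apply/lfunP => v; rewrite sum_lfunE [RHS]id_lfunE [RHS]basis_coord.
by apply: eq_bigr => a _; rewrite Lend_unitE.
Qed.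

Lemma Lend_expand f : f = \sum_a \sum_b (Lend_coord a b f : k) *: Lend_unit a b.
Proof.
apply/lfunP => v; rewrite [v in LHS]basis_coord linear_sum exchange_big /= sum_lfunE.
apply: eq_bigr => b _; rewrite linearZ /= [f _]basis_coord scaler_sumr sum_lfunE.
by apply: eq_bigr => a _; rewrite scale_lfunE Lend_unitE !scalerA mulrC.
Qed.

Lemma Lend_span : units_span Lend_unit.
Proof. by move=> f; exists (fun a b => Lend_coord a b f); exact: Lend_expand. Qed.

Lemma Lend_dual_basis : has_dual_basis (Lend hV).
Proof.
exists ('I_n * 'I_n)%type, (fun p => Lend_unit p.1 p.2), (fun p => Lend_coord p.1 p.2).
split=> [p|f]; first exact: Lend_coord_linear.
by rewrite [LHS]Lend_expand pair_bigA.
Qed.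

Lemma transpM : {morph @transp k V hV : f g / f * g >-> g * f}.
Proof.
move=> f g; apply/lfunP => phi.
by rewrite !Lend_mulE [RHS]comp_lfunE !transpE comp_lfunA.
Qed.

Lemma transp1 : @transp k V hV 1 = 1.
Proof. by apply/lfunP => phi; rewrite transpE [RHS]id_lfunE comp_lfun1r. Qed.

(** The inverse of transposition, that is, the transposition of the dual space
    under the identification of V with its bidual; the coordinate forms of a
    basis stand in for that identification. *)
Definition untransp (g : Lend (dual_proper hV)) : Lend hV :=
  linfun (fun v : V => \sum_a (g (linfun (coord X a : V -> k^o)) : dual V) v *: X`_a).

Lemma untranspE g v :
  untransp g v = \sum_a (g (linfun (coord X a : V -> k^o)) : dual V) v *: X`_a.
Proof.
have fl : linear (fun v : V =>
   \sum_a (g (linfun (coord X a : V -> k^o)) : dual V) v *: X`_a).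
  move=> c x y; rewrite scaler_sumr -big_split; apply: eq_bigr => a _.
  by rewrite linearP scalerDl scalerA.
exact: (lfunE (linear_pack fl) v).
Qed.

Lemma dual_expand (phi : dual V) :
  phi = \sum_(a < n) (phi X`_a : k) *: (linfun (coord X a : V -> k^o) : dual V).
Proof.
apply/lfunP => v; rewrite [v in LHS]basis_coord linear_sum sum_lfunE.
by apply: eq_bigr => a _; rewrite linearZ scale_lfunE lfunE [LHS]mulrC.
Qed.

Lemma untranspK : cancel untransp (@transp k V hV).
Proof.
move=> g; apply/lfunP => phi; rewrite transpE; apply/lfunP => v.
rewrite comp_lfunE untranspE linear_sum [phi in RHS]dual_expand linear_sum sum_lfunE.
by apply: eq_bigr => a _; rewrite !linearZ scale_lfunE [LHS]mulrC.
Qed.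

Lemma transpK : cancel (@transp k V hV) untransp.
Proof.
move=> f; apply/lfunP => v; rewrite untranspE [RHS]basis_coord.
by apply: eq_bigr => a _; rewrite transpE comp_lfunE lfunE.
Qed.

Lemma untransp_linear : linear untransp.
Proof.
move=> c x y; apply: (can_inj transpK); rewrite untranspK.
by rewrite transp_linear !untranspK.
Qed.
HB.instance Definition _ :=
  GRing.isLinear.Build k (Lend (dual_proper hV)) (Lend hV) _ untransp untransp_linear.

Lemma untranspM : {morph untransp : f g / f * g >-> g * f}.
Proof. by move=> f g; apply: (can_inj transpK); rewrite transpM !untranspK. Qed.
Lemma untransp1 : untransp 1 = 1.
Proof. by apply: (can_inj transpK); rewrite untranspK transp1. Qed.

End LendUnits.

Section CorepOps.
Variables (k : fieldType) (H : hopfAlg k).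

Lemma tmap_anti_legs (A A' B1 B2 B : algType k) (t : {linear A -> A'})
    (g1 : {linear B1 -> B}) (g2 : {linear B2 -> B}) x y :
  {morph t : a b / a * b >-> b * a} ->
  (forall a b, g1 a * g2 b = g2 b * g1 a) ->
  tmap t idfun (tmap idfun g1 x * tmap idfun g2 y) = tmap t g2 y * tmap t g1 x.
Proof.
move=> tM gc; elim/tensor_ind: x => [x x' h h'|a b].
  by rewrite !tmapD mulrDl mulrDr tmapD h h'.
elim/tensor_ind: y => [y y' h h'|a' b'].
  by rewrite !tmapD mulrDl mulrDr tmapD h h'.
by rewrite !tmap_tpure !tpureM tmap_tpure /= tM gc.
Qed.

Lemma inverse_unique (R : nzRingType) (x y z : R) :
  inverse_of x y -> inverse_of x z -> y = z.
Proof. by move=> [xy yx] [xz zx]; rewrite -[y]mulr1 -xz mulrA yx mul1r. Qed.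

Lemma inverse_morph (A B : algType k) (f : A -> B) x y :
  alg_morph f -> inverse_of x y -> inverse_of (f x) (f y).
Proof. by move=> [_ fM f1] [e1 e2]; split; rewrite -fM ?e1 ?e2 f1. Qed.

Lemma inverse_mul (R : nzRingType) (x x' y y' : R) :
  inverse_of x x' -> inverse_of y y' -> inverse_of (x * y) (y' * x').
Proof.
move=> [e1 e2] [e3 e4]; split.
  by rewrite -!mulrA (mulrA y) e3 mul1r.
by rewrite -!mulrA (mulrA x') e2 mul1r.
Qed.

Lemma corep_comult_antipode (A : algType k) (v : tensor A H) : is_corep v ->
  let v' := tmap idfun (antipode H) v in
  tmap idfun (comult H) v' =
    tmap idfun (@tinr k H H) v' * tmap idfun (@tinl k H H) v' /\
  tmap idfun (counit H) v' = 1.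
Proof.
move=> vP v'; have inv := corep_antipode vP; have [vD ve] := vP.
have im := alg_morph_lr (@idfun A).
split.
  apply: (@inverse_unique _ (tmap idfun (comult H) v)).
    by apply: (inverse_morph (tmap_morph im (alg_morph_lr _))).
  rewrite vD; apply: inverse_mul.
    exact: (inverse_morph (tmap_morph im (alg_morph_lr (@tinl k H H))) inv).
  exact: (inverse_morph (tmap_morph im (alg_morph_lr (@tinr k H H))) inv).
apply: (@inverse_unique _ (tmap idfun (counit H) v)).
  by apply: (inverse_morph (tmap_morph im (alg_morph_lr _))).
by rewrite ve; split; rewrite mulr1.
Qed.

(** The contragredient is a corepresentation because the coproduct of the
    inverse has its legs in reverse order, and transposition restores it. *)
Lemma corep_hat_corep (V : vectType k) (hV : (0 < dim V)%N)
    (v : tensor (Lend hV) H) : is_corep v -> is_corep (corep_hat v).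
Proof.
move=> vP; have [D' e'] := corep_comult_antipode vP.
set v' := tmap idfun _ v in D' e'.
have -> : corep_hat v = tmap (@transp k V hV) idfun v'.
  by symmetry; apply: tmap_comp.
have flip (B : lmodType k) (g : {linear H -> B}) :
    tmap idfun g (tmap (@transp k V hV) idfun v') =
    tmap (@transp k V hV) idfun (tmap idfun g v').
  transitivity (tmap (@transp k V hV) g v'); [|symmetry]; exact: tmap_comp.
split; last by rewrite flip e' tmap1 //; apply: transp1.
rewrite flip D' tmap_anti_legs; first last.
- by move=> a b; rewrite tinlr_comm.
- exact: transpM.
by congr (_ * _); symmetry; apply: tmap_comp.
Qed.

Lemma corep_tensor_corep (A B : algType k) (a : tensor A H) (b : tensor B H) :
  is_corep a -> is_corep b -> is_corep (corep_tensor a b).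
Proof.
move=> [aD ae] [bD be].
pose il := @tinl k A B; pose ir := @tinr k A B.
have flipl (R : lmodType k) (g : {linear H -> R}) x :
    tmap idfun g (tmap il idfun x) = tmap il idfun (tmap idfun g x).
  transitivity (tmap il g x); [|symmetry]; exact: tmap_comp.
have flipr (R : lmodType k) (g : {linear H -> R}) x :
    tmap idfun g (tmap ir idfun x) = tmap ir idfun (tmap idfun g x).
  transitivity (tmap ir g x); [|symmetry]; exact: tmap_comp.
have TM (R : algType k) (g : {lrmorphism H -> R}) :
    {morph tmap (@idfun (tensor A B)) g : x y / x * y}.
  by apply: tmapM => //; apply: rmorphM.
split; last first.
  rewrite TM flipl flipr ae be !tmap1 ?mulr1 //; exact: rmorph1.
rewrite /corep_tensor !TM !(flipl, flipr) aD bD.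
rewrite (tmapM (f := il)) //; last exact: rmorphM.
rewrite (tmapM (f := ir)) //; last exact: rmorphM.
rewrite !mulrA; congr (_ * _); rewrite -!mulrA; congr (_ * _).
rewrite (@tmap_comp _ _ _ _ _ _ _ _ _ il _ _ (@tinr k H H)) //.
rewrite (@tmap_comp _ _ _ _ _ _ _ _ _ ir _ _ (@tinl k H H)) //.
by apply: tmap_comm => x y; rewrite tinlr_comm.
Qed.

Variables (V : vectType k) (hV : (0 < dim V)%N) (v : tensor (Lend hV) H).

Lemma alt_corepP b m : is_corep v -> is_corep (alt_corep v b m).
Proof.
move=> vP; elim: m b => [|m IHm] b /=.
  split; rewrite !tmap1 ?mulr1 ?rmorph1 //.
apply: corep_tensor_corep => //; case: b => //; exact: corep_hat_corep.
Qed.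

Lemma alt_alg_dual_basis b m : has_dual_basis (alt_alg hV b m).
Proof.
elim: m b => [|m IHm] b /=; first exact: dual_basis_scalar.
by apply: dual_basis_tensor => //; case: b; apply: Lend_dual_basis.
Qed.

End CorepOps.

(** * The alternating products of u and their intertwiners *)

Section LegLemmas.
Variable k : fieldType.

Lemma tmap_anti (A A' B B' : algType k) (f : {linear A -> A'}) (g : {linear B -> B'}) :
  {morph f : a b / a * b >-> b * a} -> {morph g : a b / a * b >-> b * a} ->
  {morph tmap f g : a b / a * b >-> b * a}.
Proof.
move=> fM gM x y; elim/tensor_ind: x => [x x' h h'|a b].
  by rewrite mulrDl !tmapD mulrDr h h'.
elim/tensor_ind: y => [y y' h h'|a' b'].
  by rewrite mulrDr !tmapD mulrDl h h'.
by rewrite tpureM !tmap_tpure fM gM tpureM.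
Qed.

Lemma tmap_anti_legsr (A1 A2 A B B' : algType k) (t : {linear B -> B'})
    (g1 : {linear A1 -> A}) (g2 : {linear A2 -> A}) x y :
  {morph t : a b / a * b >-> b * a} ->
  (forall a b, g1 a * g2 b = g2 b * g1 a) ->
  tmap idfun t (tmap g1 idfun x * tmap g2 idfun y) = tmap g2 t y * tmap g1 t x.
Proof.
move=> tM gc; elim/tensor_ind: x => [x x' h h'|a b].
  by rewrite !tmapD mulrDl mulrDr tmapD h h'.
elim/tensor_ind: y => [y y' h h'|a' b'].
  by rewrite !tmapD mulrDl mulrDr tmapD h h'.
by rewrite !tmap_tpure !tpureM tmap_tpure /= tM gc.
Qed.

(** All coefficients of x along the second leg come from A, while commutation
    makes x itself its own diagonal coefficient. *)
Lemma commutant_tinr (A P : algType k) (I : finType) (e : I -> I -> P)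
    (x : tensor A P) : matrix_units e -> units_span e ->
  (forall p, x * tinr A p = tinr A p * x) -> exists a, x = tinl P a.
Proof.
move=> eP eS xc; have [y xE] := tensor_units_expand x eS.
pose e' a b := tinr A (e a b).
have e'P : matrix_units e' := matrix_units_morph (alg_morph_lr (@tinr k A P)) eP.
have [i _] := units_nonempty e'P; exists (y i i).
have E : x = \sum_a \sum_b tinl P (y a b) * e' a b.
  rewrite xE; apply: eq_bigr => a _; apply: eq_bigr => b _.
  by rewrite tpureM mulr1 mul1r.
have <- : mcoef e' x i i = tinl P (y i i).
  rewrite E; apply: (mcoef_sum e'P) => a b p q; exact: tinlr_comm.
rewrite -[x in mcoef _ x]mulr1 mcoef_mull; last by move=> p q; apply: xc.
by rewrite (mcoef1 e'P) eqxx mulr1.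
Qed.

Lemma tmap_tinl_inj (A P Q : algType k) :
  injective (tmap (@idfun A) (@tinl k P Q)).
Proof.
have [f [fl f1]] := unit_form Q.
have bl := scale_bilinr P fl.
apply: (can_inj (g := tmap idfun (linear_pack (tlift_linear bl)))) => x.
elim/tensor_ind: x => [x x' h h'|a b]; first by rewrite !tmapD h h'.
by rewrite !tmap_tpure /= tlift_tpure // f1 scale1r.
Qed.

End LegLemmas.

Section Intertwiners.
Variables (k : fieldType) (L L' : algType k) (tau : {linear L -> L'}) (A : algType k).

Definition in12 : tensor A L -> tensor A (tensor L L') :=
  tmap idfun (@tinl k L L').
Definition in13 : tensor A L' -> tensor A (tensor L L') :=
  tmap idfun (@tinr k L L').
Local Notation rt := (tmap (@idfun A) tau).

Lemma in12_morph : alg_morph in12.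
Proof. exact: (tmap_morph (alg_morph_lr (@idfun A)) (alg_morph_lr (@tinl k L L'))). Qed.
Lemma in13_morph : alg_morph in13.
Proof. exact: (tmap_morph (alg_morph_lr (@idfun A)) (alg_morph_lr (@tinr k L L'))). Qed.

Lemma in12_inj : injective in12. Proof. exact: tmap_tinl_inj. Qed.

Lemma rt_mulr z y : rt (z * tinl L y) = rt z * tinl L' y.
Proof.
elim/tensor_ind: z => [z z' h h'|a b].
  by rewrite mulrDl !tmapD mulrDl h h'.
by rewrite tpureM !tmap_tpure tpureM !mulr1.
Qed.
Lemma rt_mull z y : rt (tinl L y * z) = tinl L' y * rt z.
Proof.
elim/tensor_ind: z => [z z' h h'|a b].
  by rewrite mulrDr !tmapD mulrDr h h'.
by rewrite tpureM !tmap_tpure tpureM !mul1r.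
Qed.

(** Writing the intertwining relation as an equality between an element on legs
    1,2 and one on legs 1,3 forces both to sit on the first leg alone. *)
Lemma intertwiner_criterion (I : finType) (e : I -> I -> L)
    (U U' : tensor A L) (Z' : tensor A L') y :
  matrix_units e -> units_span e -> inverse_of U U' -> inverse_of (rt U') Z' ->
  (tinl _ y * (in12 U * in13 (rt U')) = in12 U * in13 (rt U') * tinl _ y) <->
  (forall p, U' * tinl L y * U * tinr A p = tinr A p * (U' * tinl L y * U)).
Proof.
move=> eP eS UU' ZZ'; have [l2 M2 o2] := in12_morph; have [l3 M3 o3] := in13_morph.
have Y2 x : in12 (tinl L x) = tinl (tensor L L') x by exact: tmap_tpure.
have Y3 x : in13 (tinl L' x) = tinl (tensor L L') x by exact: tmap_tpure.
have [PP' P'P] := inverse_morph in12_morph UU'.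
have [ZZ Z'Z] := inverse_morph in13_morph ZZ'.
split=> [YPZ p|c].
  apply: in12_inj; rewrite !M2 Y2.
  set P := in12 U in PP' P'P YPZ *; set P' := in12 U' in PP' P'P *.
  set Z := in13 (rt U') in ZZ Z'Z YPZ; set Y := tinl _ y in YPZ *.
  have E : P' * Y * P = Z * Y * in13 Z'.
    rewrite -[LHS]mulr1 -ZZ !mulrA; congr (_ * _).
    by rewrite -!mulrA YPZ !mulrA P'P mul1r.
  rewrite E; set b := in12 (tinr A p).
  have bE : b = tpure 1 (tinl L' p) by exact: tmap_tpure.
  have bZ x : in13 x * b = b * in13 x.
    rewrite bE /in13.
    elim/tensor_ind: x => [x x' h h'|s t]; first by rewrite tmapD mulrDl mulrDr h h'.
    by rewrite tmap_tpure !tpureM /= !mulr1 !mul1r.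
  have bY : Y * b = b * Y.
    by rewrite bE /Y tpureM mulr1 mul1r tpureM mulr1 mul1r.
  by rewrite -[LHS]mulrA bZ !mulrA -(mulrA Z) bY (mulrA Z) bZ.
have [x xE] := commutant_tinr eP eS c.
have [UU1 UU2] := UU'.
have e1 : tinl L y * U = U * tinl L x by rewrite -xE !mulrA UU1 mul1r.
have e2 : U' * tinl L y = tinl L x * U' by rewrite -xE -!mulrA UU1 mulr1.
have {}e1 := congr1 in12 e1; have {}e2 := congr1 (fun t => in13 (rt t)) e2.
rewrite /= !M2 !Y2 in e1; rewrite /= rt_mulr rt_mull !M3 !Y3 in e2.
by rewrite mulrA e1 -!mulrA e2.
Qed.

End Intertwiners.

Lemma inverse_sym (R : nzRingType) (x y : R) : inverse_of x y -> inverse_of y x.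
Proof. by case. Qed.

Lemma inverse_anti (k : fieldType) (A B : algType k) (f : A -> B) x y :
  {morph f : a b / a * b >-> b * a} -> f 1 = 1 ->
  inverse_of x y -> inverse_of (f x) (f y).
Proof. by move=> fM f1 [e1 e2]; split; rewrite -fM ?e1 ?e2 f1. Qed.

Section AltProduct.
Variables (k : fieldType) (V W : vectType k).
Variables (hV : (0 < dim V)%N) (hW : (0 < dim W)%N).
Variables (u ui : tensor (Lend hV) (Lend hW)).
Hypothesis inv1 : inverse_of u ui.
Hypothesis inv2 : inverse_of (ltransp u) (ltransp ui).
Local Notation L := (Lend hW).
Local Notation L' := (Lend (dual_proper hW)).
Local Notation tV := (@transp k V hV).
Local Notation tW := (@transp k W hW).

(** The element u, or its contragredient (t (x) id) u^-1, which the hypothesis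
    on u makes invertible with inverse (t (x) id) u. *)
Definition alt_u (b : bool) : tensor (alt_factor hV b) L :=
  if b return tensor (alt_factor hV b) L then ltransp ui else u.
Definition alt_ui (b : bool) : tensor (alt_factor hV b) L :=
  if b return tensor (alt_factor hV b) L then ltransp u else ui.

Lemma alt_u_inv b : inverse_of (alt_u b) (alt_ui b).
Proof. by case: b; [apply: inverse_sym|]. Qed.

(** The alternating product of u and its contragredient, all multiplied together
    on the leg L(W); it relates to u as the alternating corepresentation relates
    to v. *)
Fixpoint alt_U (b : bool) (m : nat) : tensor (alt_alg hV b m) L :=
  match m return tensor (alt_alg hV b m) L with
  | 0 => 1
  | m'.+1 => tmap (@tinl k (alt_factor hV b) (alt_alg hV (~~ b) m')) idfun (alt_u b) *
             tmap (@tinr k (alt_factor hV b) (alt_alg hV (~~ b) m')) idfun (alt_U (~~ b) m')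
  end.
Fixpoint alt_Ui (b : bool) (m : nat) : tensor (alt_alg hV b m) L :=
  match m return tensor (alt_alg hV b m) L with
  | 0 => 1
  | m'.+1 => tmap (@tinr k (alt_factor hV b) (alt_alg hV (~~ b) m')) idfun (alt_Ui (~~ b) m') *
             tmap (@tinl k (alt_factor hV b) (alt_alg hV (~~ b) m')) idfun (alt_ui b)
  end.

Lemma leg_inverse (A B C D : algType k) (f : {lrmorphism A -> B})
    (g : {lrmorphism C -> D}) x y :
  inverse_of x y -> inverse_of (tmap f g x) (tmap f g y).
Proof. by apply: inverse_morph; apply: tmap_morph; apply: alg_morph_lr. Qed.

Lemma alt_U_inv b m : inverse_of (alt_U b m) (alt_Ui b m).
Proof.
elim: m b => [|m IHm] b /=; first by split; rewrite mulr1.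
apply: inverse_mul; first exact:
  (leg_inverse (@tinl k (alt_factor hV b) (alt_alg hV (~~ b) m)) idfun (alt_u_inv b)).
exact: (leg_inverse (@tinr k (alt_factor hV b) (alt_alg hV (~~ b) m)) idfun (IHm _)).
Qed.

(** Transposing both legs reverses products, so the hypothesis on u also makes
    the transpose on the second leg invertible. *)
Lemma rtransp_inv b : inverse_of (rtransp (alt_ui b)) (rtransp (alt_u b)).
Proof.
have [i1 i2] := inv1; have [j1 j2] := inv2.
case: b; last first.
  have uE x : rtransp x = tmap (@untransp k V hV) tW (ltransp x).
    by symmetry; apply: tmap_comp => // a; rewrite /= transpK.
  rewrite /= !uE; apply: inverse_anti; last exact: inverse_sym.
    apply: tmap_anti; [exact: untranspM|exact: transpM].
  by rewrite tmap1 //; [exact: untransp1|exact: transp1].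
have uE x : rtransp (ltransp x) = tmap tV tW x by apply: tmap_comp.
rewrite /= !uE; apply: inverse_anti; last exact: inv1.
  by apply: tmap_anti; exact: transpM.
by rewrite tmap1 //; exact: transp1.
Qed.

Lemma rtransp_alt_Ui b m :
  rtransp (alt_Ui b m.+1) =
  tmap (@tinl k _ _) tW (alt_ui b) * tmap (@tinr k _ _) tW (alt_Ui (~~ b) m).
Proof.
apply: tmap_anti_legsr; first exact: transpM.
by move=> x y; rewrite tinlr_comm.
Qed.

Lemma rtransp_alt_inv b m : exists Z, inverse_of (rtransp (alt_Ui b m)) Z.
Proof.
elim: m b => [|m IHm] b.
  exists 1; rewrite /rtransp tmap1 //; last exact: transp1.
  by split; rewrite mulr1.
have [Z ZP] := IHm (~~ b).
exists (tmap (@tinr k _ _) idfun Z * tmap (@tinl k _ _) idfun (rtransp (alt_u b))).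
rewrite rtransp_alt_Ui; apply: inverse_mul.
  have := leg_inverse (@tinl k (alt_factor hV b) (alt_alg hV (~~ b) m)) idfun (rtransp_inv b).
  congr inverse_of; exact: tmap_comp.
have := leg_inverse (@tinr k (alt_factor hV b) (alt_alg hV (~~ b) m)) idfun ZP.
congr inverse_of; exact: tmap_comp.
Qed.

Section Model.
Variable M : model (uprime u ui).
Local Notation H := (model_hopf M).
Local Notation v := (model_corep M).
Local Notation pi := (model_rep M).

(** Transposing the first leg of the inverse of u' restores the order of the two
    factors, since they share no other leg; so the contragredient of u' is
    built from the contragredient of u in the way u' is built from u. *)
Lemma rep_alt_corep1 b :
  tmap idfun pi (alt_corep1 v b) = in12 L' (alt_u b) * in13 L (rtransp (alt_ui b)).
Proof.
case: b; last exact: model_repP.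
have hv : alt_corep1 v true = tmap tV idfun (tmap idfun (antipode H) v).
  by symmetry; apply: tmap_comp.
have piv : tmap idfun pi (tmap idfun (antipode H) v) =
    in13 L (rtransp u) * in12 L' ui.
  apply: (@inverse_unique _ (tmap idfun pi v)).
    exact: (leg_inverse idfun pi (corep_antipode (model_corepP M))).
  rewrite model_repP; apply: inverse_mul.
    exact: (leg_inverse idfun (@tinl k L L') inv1).
  exact: (leg_inverse idfun (@tinr k L L') (rtransp_inv false)).
transitivity (tmap tV idfun (tmap idfun pi (tmap idfun (antipode H) v))).
  by rewrite hv; transitivity (tmap tV pi (tmap idfun (antipode H) v)); [|symmetry];
    apply: tmap_comp.
rewrite piv tmap_anti_legs; first last.
- by move=> x y; rewrite tinlr_comm.
- exact: transpM.
congr (_ * _); first by symmetry; apply: tmap_comp.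
transitivity (tmap tV (@tinr k L L' \o tW) u); first exact: tmap_comp.
transitivity (tmap idfun (@tinr k L L') (tmap tV tW u)).
  by symmetry; apply: tmap_comp.
by congr (tmap _ _ _); symmetry; apply: tmap_comp.
Qed.

(** Factors on the legs W and W* commute past one another, so those on W can be
    collected on the left and those on W* on the right. *)
Lemma rep_alt_corep b m :
  tmap idfun pi (alt_corep v b m) = in12 L' (alt_U b m) * in13 L (rtransp (alt_Ui b m)).
Proof.
elim: m b => [|m IHm] b.
  have [_ _ o2] := in12_morph L L' k^o; have [_ _ o3] := in13_morph L L' k^o.
  have rt1 : rtransp (1 : tensor (k^o : algType k) L) = 1.
    by rewrite /rtransp tmap1 //; exact: transp1.
  by rewrite /= rt1 o2 o3 mulr1 tmap1 // rmorph1.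
rewrite rtransp_alt_Ui.
set il := @tinl k (alt_factor hV b) (alt_alg hV (~~ b) m).
set ir := @tinr k (alt_factor hV b) (alt_alg hV (~~ b) m).
have piM : {morph tmap (@idfun (alt_alg hV b m.+1)) pi : x y / x * y}.
  by apply: tmapM => //; apply: rmorphM.
have [_ M2 _] := in12_morph L L' (alt_alg hV b m.+1).
have [_ M3 _] := in13_morph L L' (alt_alg hV b m.+1).
rewrite [LHS]piM [in12 _ _]M2 M3.
have -> : tmap (@idfun (alt_alg hV b m.+1)) pi (tmap il idfun (alt_corep1 v b)) =
    tmap il (@tinl k L L') (alt_u b) * tmap il (@tinr k L L') (rtransp (alt_ui b)).
  transitivity (tmap il idfun (tmap idfun pi (alt_corep1 v b))).
    by transitivity (tmap il pi (alt_corep1 v b)); [|symmetry]; apply: tmap_comp.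
  rewrite rep_alt_corep1 (tmapM (f := il)) //; last exact: rmorphM.
  by congr (_ * _); apply: tmap_comp.
have -> : tmap (@idfun (alt_alg hV b m.+1)) pi (tmap ir idfun (alt_corep v (~~ b) m)) =
    tmap ir (@tinl k L L') (alt_U (~~ b) m) *
    tmap ir (@tinr k L L') (rtransp (alt_Ui (~~ b) m)).
  transitivity (tmap ir idfun (tmap idfun pi (alt_corep v (~~ b) m))).
    by transitivity (tmap ir pi (alt_corep v (~~ b) m)); [|symmetry]; apply: tmap_comp.
  rewrite IHm (tmapM (f := ir)) //; last exact: rmorphM.
  by congr (_ * _); apply: tmap_comp.
have c : tmap il (@tinr k L L') (rtransp (alt_ui b)) * tmap ir (@tinl k L L') (alt_U (~~ b) m)
       = tmap ir (@tinl k L L') (alt_U (~~ b) m) * tmap il (@tinr k L L') (rtransp (alt_ui b)).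
  by apply: tmap_comm => x y; rewrite tinlr_comm.
have e1 : in12 L' (tmap il idfun (alt_u b)) = tmap il (@tinl k L L') (alt_u b).
  exact: tmap_comp.
have e2 : in12 L' (tmap ir idfun (alt_U (~~ b) m)) = tmap ir (@tinl k L L') (alt_U (~~ b) m).
  exact: tmap_comp.
have e3 : in13 L (tmap il tW (alt_ui b)) = tmap il (@tinr k L L') (rtransp (alt_ui b)).
  transitivity (tmap il (@tinr k L L' \o tW) (alt_ui b)); first exact: tmap_comp.
  by symmetry; apply: tmap_comp.
have e4 : in13 L (tmap ir tW (alt_Ui (~~ b) m)) =
          tmap ir (@tinr k L L') (rtransp (alt_Ui (~~ b) m)).
  transitivity (tmap ir (@tinr k L L' \o tW) (alt_Ui (~~ b) m)); first exact: tmap_comp.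
  by symmetry; apply: tmap_comp.
by rewrite e1 e2 e3 e4 -!mulrA; congr (_ * _); rewrite !mulrA c.
Qed.

Hypothesis Mmin : minimal_model M.

Lemma corep_End_alt b m T :
  corep_End (alt_corep v b m) T <->
  forall p, alt_Ui b m * tinl L T * alt_U b m * tinr _ p =
            tinr _ p * (alt_Ui b m * tinl L T * alt_U b m).
Proof.
have [Z ZP] := rtransp_alt_inv b m.
rewrite -(intertwiner_criterion T (Lend_units hW) (@Lend_span _ _ hW) (alt_U_inv b m) ZP).
rewrite -rep_alt_corep; split=> [e|e]; last first.
  apply: (corep_End_of_rep Mmin (alt_alg_dual_basis hV b m) _ e).
  exact/alt_corepP/model_corepP.
have [_ piM _] := tmap_morph (alg_morph_lr (@idfun (alt_alg hV b m))) (alg_morph_lr pi).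
have tE : tmap idfun pi (tinl H T) = tinl _ T by rewrite tmap_tpure rmorph1.
by rewrite -tE -!piM e.
Qed.

End Model.
End AltProduct.

(** * One step of the basic construction *)

Section RightMult.
Variables (k : fieldType) (I : inclusion k).
Local Notation A := (itgt I).
Local Notation i := (iemb I).

Lemma rmult_lin (p : A) : linear (fun x : A => x * p).
Proof. by move=> c x y; rewrite mulrDl -scalerAl. Qed.

(** Total, although right multiplication is a module map only for elements
    commuting with the smaller algebra: the tower is then defined by plain
    recursion, before its commutation relations are known. *)
Definition rmult (p : A) : rend I :=
  match pselect (forall b, i b * p = p * i b) with
  | left h => @Rend k I (fun x : A => x * p) (@rmult_lin p)
      (fun x b => etrans (esym (mulrA x (i b) p))
                    (etrans (congr1 (fun y => x * y) (h b)) (mulrA x p (i b))))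
  | right _ => 0
  end.

Lemma rmultE p x : (forall b, i b * p = p * i b) -> rmult p x = x * p.
Proof. by rewrite /rmult; case: pselect. Qed.

End RightMult.

Section Step.
Variables (k : fieldType) (N M P : algType k).
Variables (j : {lrmorphism N -> M}) (r : P -> M).
Variables (J : finType) (e : J -> J -> P).
Hypothesis eP : matrix_units e.
Hypothesis eS : units_span e.
Hypothesis j_inj : injective j.
Hypothesis r_morph : alg_morph r.
Hypothesis jr : forall n p, j n * r p = r p * j n.

(** Generation of M by the products of the two subalgebras, as an induction
    principle for additive properties. *)
Definition spanned_by := forall S : M -> Prop,
  (forall x y, S x -> S y -> S (x + y)) -> (forall n p, S (j n * r p)) ->
  forall x, S x.
Hypothesis gen : spanned_by.

Local Notation E := (fun a b => r (e a b)).
Let EP : matrix_units E. Proof. exact: matrix_units_morph. Qed.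
Let rl : linear r. Proof. by case: r_morph. Qed.
Let rM : {morph r : x y / x * y}. Proof. by case: r_morph. Qed.
Let r1 : r 1 = 1. Proof. by case: r_morph. Qed.

Lemma step_coef x a b : exists n, mcoef E x a b = j n.
Proof.
move: x; apply: gen => [x y [n hn] [m hm]|n p].
  by exists (n + m); rewrite (linD (mcoef_linear E a b)) hn hm rmorphD.
rewrite mcoef_mull // mcoef_morph //.
have [c ->] := mcoef_scalar eP eS p a b.
by exists (c *: n); rewrite (linZ rl) r1 mulr_algr linearZ.
Qed.

Lemma step_expand x : exists y : J -> J -> N,
  (forall a b, mcoef E x a b = j (y a b)) /\
  x = \sum_a \sum_b j (y a b) * E a b.
Proof.
have [y yE] := boolp.choice (fun ab => step_coef x ab.1 ab.2).
exists (fun a b => y (a, b)); split=> [a b|]; first exact: (yE (a, b)).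
rewrite {1}(mcoef_expand EP x); apply: eq_bigr => a _; apply: eq_bigr => b _.
by rewrite (yE (a, b)).
Qed.

(** A central element is its own diagonal coefficient, so it lies in N, and it is
    central there. *)
Lemma step_center :
  (forall n : N, (forall n', n * n' = n' * n) -> exists c : k, n = c%:A) ->
  forall x : M, (forall y, x * y = y * x) -> exists c : k, x = c%:A.
Proof.
move=> Ncen x xc; have [a _] := units_nonempty EP.
have [n nE] := step_coef x a a.
have xn : x = j n.
  rewrite -nE -[x in mcoef _ x]mulr1 mcoef_mull; last by move=> p q; apply: xc.
  by rewrite (mcoef1 EP) eqxx mulr1.
have [|c cE] := Ncen n; last by exists c; rewrite xn cE linearZ /= rmorph1.
by move=> n'; apply: j_inj; rewrite !rmorphM /= -xn; apply: xc.
Qed.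

Definition avg_sum (x : M) : M := \sum_a mcoef E x a a.

Lemma avg_sum_linear : linear avg_sum.
Proof.
move=> c x y; rewrite /avg_sum scaler_sumr -big_split; apply: eq_bigr => a _.
exact: mcoef_linear.
Qed.

Hypothesis char0 : [pchar k] =i pred0.
Local Notation cI := (#|J|%:R^-1 : k).

Lemma card_neq0 : #|J|%:R != 0 :> k.
Proof.
have [a _] := units_nonempty EP; rewrite (pcharf0P k).1 // -lt0n.
by apply/card_gt0P; exists a.
Qed.

(** The conditional expectation of M onto N, still with values in M: averaging
    over the matrix units is the normalized trace on the factor P. *)
Definition avg (x : M) : M := cI *: avg_sum x.

Lemma avg_linear : linear avg.
Proof. by move=> c x y; rewrite /avg avg_sum_linear scalerDr !scalerA mulrC. Qed.

Lemma avg_in x : exists n, avg x = j n.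
Proof.
have [y yE] := boolp.choice (fun a => step_coef x a a).
exists (cI *: \sum_a y a); rewrite linearZ /= linear_sum /avg; congr (_ *: _).
by apply: eq_bigr.
Qed.

Lemma avg_mull n x : avg (j n * x) = j n * avg x.
Proof.
rewrite /avg -scalerAr /avg_sum mulr_sumr; congr (_ *: _).
by apply: eq_bigr => a _; rewrite mcoef_mull.
Qed.

Lemma avg_mulr n x : avg (x * j n) = avg x * j n.
Proof.
rewrite /avg -scalerAl /avg_sum mulr_suml; congr (_ *: _).
by apply: eq_bigr => a _; rewrite mcoef_mulr.
Qed.

Lemma avg1 : avg 1 = 1.
Proof.
rewrite /avg /avg_sum; under eq_bigr do rewrite (mcoef1 EP) eqxx.
by rewrite sumr_const -scaler_nat scalerA mulVf ?card_neq0 ?scale1r.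
Qed.

Lemma avg_j n : avg (j n) = j n.
Proof. by rewrite -[j n in LHS]mulr1 avg_mull avg1 mulr1. Qed.

Lemma avg_unit a b : avg (E a b) = if a == b then cI *: 1 else 0.
Proof.
rewrite /avg /avg_sum; under eq_bigr do rewrite (mcoef_unit EP).
have -> : \sum_c (if (c == a) && (b == c) then 1 else 0 : M) =
          \sum_c (if c == a then (if a == b then 1 else 0) else 0).
  apply: eq_bigr => c _; case: (eqVneq c a) => [->|//] /=.
  by rewrite eq_sym.
by rewrite sum_if; case: ifP => // _; rewrite scaler0.
Qed.

Lemma avg_sum_comm p x : avg_sum (r p * x) = avg_sum (x * r p).
Proof.
have [c ->] := eS p.
have l1 := lin_comp (lin_mulrr x rl) avg_sum_linear.
have l2 := lin_comp (lin_mulrl x rl) avg_sum_linear.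
rewrite (lin_sum l1) (lin_sum l2); apply: eq_bigr => s _.
rewrite (lin_sum l1) (lin_sum l2); apply: eq_bigr => t _.
rewrite (linZ l1) (linZ l2); congr (_ *: _); rewrite /avg_sum.
transitivity (\sum_c E c t * x * E s c).
  rewrite /mcoef exchange_big; apply: eq_bigr => c' _.
  rewrite -(sum_if (fun a => E c' t * x * E a c') s); apply: eq_bigr => a _.
  by rewrite !mulrA EP.1; case: ifP => // _; rewrite !mul0r.
rewrite /mcoef exchange_big; apply: eq_bigr => c' _.
rewrite -(sum_if' (fun a => E c' a * x * E s c') t); apply: eq_bigr => a _.
by rewrite -!mulrA EP.1; case: ifP => // _; rewrite !mulr0.
Qed.

Lemma avg_comm p x : avg (r p * x) = avg (x * r p).
Proof. by rewrite /avg avg_sum_comm. Qed.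

Definition normalized_trace (A : algType k) (tr : A -> k^o) :=
  [/\ linear tr, forall x y, tr (x * y) = tr (y * x) & tr 1 = 1].

Lemma cond_exp_exists : exists F : M -> N,
  [/\ linear F, forall n, F (j n) = n,
      forall n x n', F (j n * x * j n') = n * F x * n' & forall x, j (F x) = avg x].
Proof.
have [F FE] := boolp.choice avg_in; exists F.
split=> [c x y|n|n x n'|x]; last by rewrite FE.
- by apply: j_inj; rewrite -FE avg_linear !FE linearP.
- by apply: j_inj; rewrite -FE avg_j.
- by apply: j_inj; rewrite -FE avg_mulr avg_mull FE !rmorphM.
Qed.

(** The expectation is insensitive to moving an element of P across, and the
    trace of N takes care of what is left. *)
Lemma trace_step (F : M -> N) (trN : N -> k^o) :
  linear F -> (forall x, j (F x) = avg x) -> normalized_trace trN ->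
  normalized_trace (fun x => trN (F x)).
Proof.
move=> Fl FE [tl tc t1]; have trl := lin_comp Fl tl.
have F1 : F 1 = 1 by apply: j_inj; rewrite FE avg1 rmorph1.
split=> [|x y|] //=; last by rewrite F1.
move: x; apply: gen => [x x' h h'|n p].
  by rewrite mulrDl mulrDr (linD trl) (linD trl (y * x)) h h'.
have -> : F (j n * r p * y) = n * F (y * r p).
  by apply: j_inj; rewrite rmorphM /= !FE -mulrA avg_mull avg_comm.
rewrite tc; congr trN; apply: j_inj; rewrite rmorphM /= !FE.
by rewrite -avg_mulr -mulrA jr mulrA.
Qed.

Lemma trace_unit (tr : M -> k^o) a b : normalized_trace tr ->
  tr (E a b) = if a == b then cI else 0.
Proof.
move=> [tl tc t1].
have tab s t : tr (E s s) = tr (E t t).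
  by have := tc (E s t) (E t s); rewrite !EP.1 !eqxx.
have taa : tr (E a a) = cI.
  have := t1; rewrite -EP.2 (lin_sum tl).
  rewrite (eq_bigr (fun _ => tr (E a a))) => [|s _]; last exact: tab.
  rewrite sumr_const => h; have n0 := card_neq0.
  apply: (mulfI n0); rewrite mulfV // mulr_natl; exact: h.
case: (eqVneq a b) => [<-//|ab].
have := tc (E a a) (E a b); rewrite !EP.1 eqxx eq_sym (negbTE ab) => ->.
exact: (lin0 tl).
Qed.

(** A conditional expectation is determined on the matrix units, where it is
    scalar because N has trivial centre, and there the trace prescribes it. *)
Lemma cond_exp_unique (F : M -> N) (tr : M -> k^o) :
  (forall n : N, (forall n', n * n' = n' * n) -> exists c : k, n = c%:A) ->
  linear F -> (forall n, F (j n) = n) ->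
  (forall n x n', F (j n * x * j n') = n * F x * n') ->
  normalized_trace tr -> (forall x, tr (j (F x)) = tr x) ->
  forall x, j (F x) = avg x.
Proof.
move=> Ncen Fl Fj Fb trP trF.
have Fl' n x : F (j n * x) = n * F x.
  by have := Fb n x 1; rewrite rmorph1 !mulr1.
have Fr' n x : F (x * j n) = F x * n.
  by have := Fb 1 x n; rewrite rmorph1 !mul1r.
have jF := lin_comp Fl (is_linear j).
have FE a b : j (F (E a b)) = avg (E a b).
  have [n'|c cE] := Ncen (F (E a b)); first by rewrite -Fl' -Fr' jr.
  have [tl _ t1] := trP.
  have := trF (E a b); rewrite cE linearZ /= rmorph1 (linZ tl) t1.
  rewrite (trace_unit a b trP) avg_unit => h.
  have -> : c = if a == b then cI else 0 by rewrite -h [RHS]mulr1.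
  by case: ifP => // _; rewrite scale0r.
apply: gen => [x y hx hy|n p].
  by rewrite (linD jF) (linD avg_linear) /= hx hy.
rewrite Fl' rmorphM /= avg_mull; congr (_ * _).
have [c ->] := eS p.
have l1 := lin_comp rl jF; have l2 := lin_comp rl avg_linear.
rewrite (lin_sum l1) (lin_sum l2); apply: eq_bigr => a _.
rewrite (lin_sum l1) (lin_sum l2); apply: eq_bigr => b _.
by rewrite (linZ l1) (linZ l2) /= FE.
Qed.

End Step.

Section NextStep.
Variables (k : fieldType) (I : inclusion k) (P Q : algType k).
Local Notation N := (isrc I).
Local Notation M := (itgt I).
Local Notation j := (iemb I).
Variables (r : P -> M) (J : finType) (e : J -> J -> P).
Variables (sigma : {linear Q -> P}) (tau : {linear P -> Q}).
Hypothesis eP : matrix_units e.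
Hypothesis eS : units_span e.
Hypothesis j_inj : injective j.
Hypothesis r_morph : alg_morph r.
Hypothesis jr : forall n p, j n * r p = r p * j n.
Hypothesis gen : spanned_by j r.
Hypothesis sigmaM : {morph sigma : x y / x * y >-> y * x}.
Hypothesis sigma1 : sigma 1 = 1.
Hypothesis tauK : cancel tau sigma.
Hypothesis char0 : [pchar k] =i pred0.

Local Notation E := (fun a b => r (e a b)).
Let EP : matrix_units E. Proof. exact: matrix_units_morph. Qed.
Let rl : linear r. Proof. by case: r_morph. Qed.
Let rM : {morph r : x y / x * y}. Proof. by case: r_morph. Qed.
Let r1 : r 1 = 1. Proof. by case: r_morph. Qed.
Local Notation avg := (avg r e).

(** The new factor of the basic construction acts by right multiplications by
    the old one, so it is its opposite; sigma turns the opposite algebra into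
    the next factor of the alternating product. *)
Definition next_rho (q : Q) : rend I := rmult (r (sigma q)).

Lemma next_rhoE q x : next_rho q x = x * r (sigma q).
Proof. by apply: rmultE => b; apply: jr. Qed.

Lemma next_rho_morph : alg_morph next_rho.
Proof.
split=> [c p q|p q|]; apply: rendP => x.
- by rewrite [RHS]/= !next_rhoE linearP rl mulrDr -scalerAr.
- by rewrite [RHS]/= !next_rhoE sigmaM rM mulrA.
- by rewrite next_rhoE sigma1 r1 mulr1.
Qed.

Lemma next_comm (m : M) q : lmult m * next_rho q = next_rho q * lmult m.
Proof. by apply: rendP => x; rewrite /= !next_rhoE mulrA. Qed.

Lemma lmult_inj : injective (@lmult k I).
Proof. by move=> a b /(congr1 (fun f : rend I => f 1)); rewrite /= !mulr1. Qed.

Lemma rend_sumE (K : Type) (s : seq K) (F : K -> rend I) x :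
  (\sum_(i <- s) F i) x = \sum_(i <- s) F i x.
Proof. by elim/big_rec2: _ => //= i y z _ <-. Qed.

(** A module endomorphism is known from its values on the matrix units, and the
    coefficient of x on each of them is read off by multiplying x on both
    sides. *)
Lemma next_expand (T : rend I) :
  T = \sum_b \sum_c lmult (\sum_a T (E a b) * E c a) * next_rho (tau (e b c)).
Proof.
apply: rendP => x; rewrite [x in LHS](mcoef_expand EP).
have TE a b : T (mcoef E x a b * E a b) = \sum_c T (E a b) * E c a * x * E b c.
  have [n nE] := step_coef eP eS r_morph jr gen x a b.
  rewrite nE jr rend_mod -nE /mcoef mulr_sumr.
  by apply: eq_bigr => c _; rewrite !mulrA.
rewrite (lin_sum (rend_lin T)).
under eq_bigr do rewrite (lin_sum (rend_lin T)).
rewrite exchange_big rend_sumE; apply: eq_bigr => b _.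
under eq_bigr do rewrite TE.
rewrite exchange_big rend_sumE; apply: eq_bigr => c _.
rewrite [RHS]/= next_rhoE tauK mulr_suml; apply: eq_bigr => a _.
by rewrite !mulrA.
Qed.

Lemma next_spanned : spanned_by (@lmult k I) next_rho.
Proof.
move=> S SD Sp T; rewrite (next_expand T).
have S0 : S 0 by rewrite -(mul0r (next_rho 0)) -(linear0 (@lmult k I)); apply: Sp.
elim/big_rec: _ => // b y _ Sy; apply: (SD) => //.
by elim/big_rec: _ => // c z _ Sz; apply: (SD) => //; apply: Sp.
Qed.

Hypothesis Ncen : forall n : N, (forall n', n * n' = n' * n) -> exists c : k, n = c%:A.
Hypothesis trN : exists tr : N -> k^o, normalized_trace tr.

Lemma next_trace : exists tr : M -> k^o, normalized_trace tr.
Proof.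
have [F [Fl _ _ FE]] := cond_exp_exists eP eS j_inj r_morph jr gen char0.
have [tr trP] := trN; exists (fun x => tr (F x)).
exact: (trace_step eP eS j_inj r_morph jr gen char0 Fl FE trP).
Qed.

(** For existence, the trace of N composed with the average is a trace on M that
    the average preserves. *)
Lemma jones_projectionE (T : rend I) : jones_projection T <-> forall x, T x = avg x.
Proof.
split=> [[F [Fl Fj Fb [tr trP trF]] TE] x|TE].
  rewrite TE; exact: (cond_exp_unique eP eS r_morph jr gen char0 Ncen Fl Fj Fb trP trF).
have [F [Fl Fj Fb FE]] := cond_exp_exists eP eS j_inj r_morph jr gen char0.
have [tr trP] := trN; exists F; last by move=> x; rewrite TE FE.
split=> //; exists (fun x => tr (F x)); last by move=> x; rewrite Fj.
exact: (trace_step eP eS j_inj r_morph jr gen char0 Fl FE trP).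
Qed.

Lemma jones_exists : exists T : rend I, jones_projection T.
Proof.
have al := @avg_linear _ M P r J e.
have am x b : avg (x * j b) = avg x * j b by apply: avg_mulr.
by exists (Rend al am); apply/jones_projectionE.
Qed.

Variable T : rend I.
Hypothesis TP : jones_projection T.
Let TE x : T x = avg x. Proof. exact: (jones_projectionE T).1. Qed.

Lemma jones_comm n : lmult (j n) * T = T * lmult (j n).
Proof. by apply: rendP => x; rewrite /= !TE avg_mull. Qed.

(** The projection sums E_ab x E_ba; placed between two matrix units of the old
    copy of P it gives all operators E_ab x E_cd up to a scalar, and a sum over
    the diagonal removes the factor on the left of x. *)
Lemma next_rho_jones b c :
  next_rho (tau (e b c)) =
  (#|J|%:R : k) *: \sum_a lmult (E a c) * T * lmult (E b a).
Proof.
apply: rendP => x; rewrite next_rhoE tauK [RHS]/= rend_sumE.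
transitivity ((#|J|%:R : k) *: \sum_a (#|J|%:R^-1 : k) *: (E a a * x * E b c)).
  have n0 := card_neq0 eP r_morph char0.
  rewrite -scaler_sumr scalerA mulfV // scale1r.
  by rewrite -mulr_suml -mulr_suml EP.2 mul1r.
congr (_ *: _); apply: eq_bigr => a _; rewrite /= TE /avg -scalerAr.
congr (_ *: _); rewrite /avg_sum mulr_sumr.
transitivity (\sum_i E a i * (E b a * x) * E i c); last first.
  by apply: eq_bigr => i _; rewrite mul_mcoef.
rewrite -(sum_if' (fun i => E a a * x * E i c) b); apply: eq_bigr => i _.
rewrite !mulrA EP.1 eq_sym; case: ifP => [/eqP ->|_] //.
by rewrite !mul0r.
Qed.

Section Twist.
Variables (L : algType k) (o : L -> N).
Hypothesis o_morph : alg_morph o.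
Local Notation W := (mul_lift r (fun q => j (o q))).
Local Notation W' := (mul_lift next_rho (fun q => lmult (j (o q)))).
Let jol : linear (fun q => j (o q)).
Proof. by have [l _ _] := alg_morph_comp o_morph (alg_morph_lr j). Qed.
Let jol' : linear (fun q => lmult (j (o q)) : rend I).
Proof. by move=> c x y; rewrite jol linearP. Qed.
Let nl : linear next_rho. Proof. by case: next_rho_morph. Qed.
Let Wl : linear W. Proof. exact: mul_lift_linear. Qed.
Let Wl' : linear W'. Proof. exact: mul_lift_linear. Qed.
Let W_morph : alg_morph W.
Proof.
apply: mul_lift_morph => //; first exact: alg_morph_comp (alg_morph_lr j).
Qed.

Lemma twist_on_N z n : W' (tmap tau idfun z) (j n) = W z * j n.
Proof.
elim/tensor_ind: z => [z z' h h'|p q].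
  by rewrite tmapD (linD Wl') (linD Wl) mulrDl /= h h'.
rewrite tmap_tpure !mul_lift_pure //= next_rhoE tauK.
by rewrite -rmorphM jr rmorphM mulrA.
Qed.

(** On functionals, the elements of P that multiply on the right are brought to
    the left by the trace property; there they meet those of a in the opposite
    order, which is what conjugating the product by tau and sigma expresses. *)
Lemma avg_twist a z x :
  avg (W a * W' (tmap tau idfun z) x) =
  avg (W (tmap sigma idfun (tmap tau idfun a * tmap tau idfun z)) * x).
Proof.
have al := @avg_linear _ M P r J e.
elim/tensor_ind: a => [a a' h h'|p q].
  by rewrite (linD Wl) mulrDl (linD al) h h' tmapD mulrDl tmapD (linD Wl) mulrDl (linD al).
elim/tensor_ind: z => [z z' h h'|p' q'].
  by rewrite tmapD (linD Wl') mulrDr /= mulrDr (linD al) h h' tmapD (linD Wl) mulrDl (linD al).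
rewrite !tmap_tpure tpureM tmap_tpure !mul_lift_pure //= next_rhoE tauK sigmaM !tauK.
have [_ oM _] := o_morph.
rewrite !mulrA -(avg_comm eP eS r_morph) rM oM rmorphM /= !mulrA.
by congr (avg (_ * _ * _)); rewrite -mulrA.
Qed.

(** T has rank one along P: the twist fixes both the vector onto which it projects
    and the linear form that it evaluates.  With a = u and z its inverse, the
    equation on the transposes is the hypothesis of the theorem. *)
Lemma jones_twist a z :
  inverse_of a z -> tmap tau idfun a * tmap tau idfun z = 1 ->
  T * (lmult (W a) * W' (tmap tau idfun z)) = T /\
  (lmult (W a) * W' (tmap tau idfun z)) * T = T.
Proof.
have [_ WM W1] := W_morph.
move=> [az za] tt; split; apply: rendP => x /=.
  by rewrite !TE avg_twist tt tmap1 // W1 mul1r.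
rewrite TE; have [n ->] := avg_in eP eS r_morph jr gen x.
by rewrite twist_on_N mulrA -WM az W1 mul1r.
Qed.

End Twist.
End NextStep.

(** * The tower of the square *)

Lemma tinr_inj (k : fieldType) (A B : algType k) : injective (@tinr k A B).
Proof.
have [f [fl f1]] := unit_form A; have bl := scale_bilinl B fl.
apply: (can_inj (g := tlift (fun a b => (f a : k) *: b))) => b.
by rewrite tlift_tpure // f1 scale1r.
Qed.

Lemma conj_cancel (R : nzRingType) (a b x : R) :
  inverse_of a b -> b * (a * x * b) * a = x.
Proof. by move=> [_ ba]; rewrite !mulrA ba mul1r -mulrA ba mulr1. Qed.

Lemma conj_mul (R : nzRingType) (a b x y : R) :
  inverse_of a b -> b * (x * y) * a = (b * x * a) * (b * y * a).
Proof. by move=> [ab _]; rewrite -[in LHS](mul1r y) -ab !mulrA. Qed.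

Section Tower.
Variables (k : fieldType) (V W : vectType k).
Variables (hV : (0 < dim V)%N) (hW : (0 < dim W)%N).
Hypothesis char0 : [pchar k] =i pred0.
Local Notation L := (Lend hW).
Local Notation F := (alt_factor hV).
Local Notation twr := (tower hV hW).
Local Notation A := (A1 hV hW).

Definition ftr (b : bool) : {linear F b -> F (~~ b)} :=
  if b return {linear F b -> F (~~ b)}
  then @untransp k V hV : {linear Lend (dual_proper hV) -> Lend hV}
  else @transp k V hV : {linear Lend hV -> Lend (dual_proper hV)}.
Definition funtr (b : bool) : {linear F (~~ b) -> F b} :=
  if b return {linear F (~~ b) -> F b}
  then @transp k V hV : {linear Lend hV -> Lend (dual_proper hV)}
  else @untransp k V hV : {linear Lend (dual_proper hV) -> Lend hV}.

Lemma ftrK b : cancel (ftr b) (funtr b).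
Proof. by case: b => x /=; [apply: untranspK|apply: transpK]. Qed.
Lemma funtrK b : cancel (funtr b) (ftr b).
Proof. by case: b => x /=; [apply: transpK|apply: untranspK]. Qed.
Lemma funtrM b : {morph funtr b : x y / x * y >-> y * x}.
Proof. by case: b => x y /=; [apply: transpM|apply: untranspM]. Qed.
Lemma funtr1 b : funtr b 1 = 1.
Proof. by case: b => /=; [apply: transp1|apply: untransp1]. Qed.

Lemma factor_units b : exists (J : finType) (e : J -> J -> F b),
  matrix_units e /\ units_span e.
Proof.
by case: b; do 2!eexists; (split; [exact: Lend_units|exact: Lend_span]).
Qed.

(** Instead of identifying A1 l with a tensor product, each factor is followed
    inside the tower, at the level where it appears. *)
Fixpoint rho (l : nat) : F (odd l) -> A l.+1 :=
  match l return F (odd l) -> A l.+1 with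
  | 0 => @tinl k (Lend hV) L
  | l'.+1 => @next_rho k (twr l') (F (odd l')) (F (odd l'.+1)) (@rho l') (funtr (odd l'))
  end.

(** What the passage from one level to the next needs and reproduces. *)
Definition stage l :=
  [/\ alg_morph (@rho l),
      forall n p, iemb (twr l) n * @rho l p = @rho l p * iemb (twr l) n,
      spanned_by (iemb (twr l)) (@rho l),
      injective (iemb (twr l)) &
      (forall n : A l, (forall n', n * n' = n' * n) -> exists c : k, n = c%:A) /\
      exists tr : A l -> k^o, normalized_trace tr].

(** L(W) is the first step of a tower over k, so the construction of traces along
    a tower covers it. *)
Lemma Lend_trace : exists tr : L -> k^o, normalized_trace tr.
Proof.
have am : alg_morph (fun c : k^o => (c : k) *: (1 : L)).
  split; first by move=> c x y; rewrite scalerDl scalerA.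
    by move=> x y; rewrite -scalerAl mul1r scalerA.
  by rewrite scale1r.
pose I := @Inclusion k k^o L (lrmorph_pack am).
have ji : injective (iemb I).
  move=> x y /= /eqP; rewrite -subr_eq0 -scalerBl scaler_eq0 oner_eq0 orbF.
  by rewrite subr_eq0 => /eqP.
have jr n p : iemb I n * p = p * iemb I n by rewrite /= mulr_algl mulr_algr.
have sp : spanned_by (iemb I) (@id L).
  by move=> S _ Sp x; rewrite -[x]mul1r -[1]scale1r; apply: (Sp 1).
have trI : exists tr : isrc I -> k^o, normalized_trace tr.
  by exists id; split=> //; apply: mulrC.
exact: (next_trace (Lend_units hW) (@Lend_span _ _ hW) ji
   (alg_morph_lr idfun) jr sp char0 trI).

Qed.

Lemma stageP l : stage l.
Proof.
elim: l => [|l [rm rc rs ri [cen tr]]].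
  split; [exact: alg_morph_lr| | |exact: tinr_inj|split].
  - by move=> n p; rewrite [RHS]tinlr_comm.
  - move=> S SD Sp; apply: tensor_ind => // a b.
    by have := Sp b a; rewrite tpureM mulr1 mul1r.
  - by move=> n; apply: (units_center (Lend_units hW)); exact: Lend_span.
  - exact: Lend_trace.
have [J [e [eP eS]]] := factor_units (odd l).
have uM := @funtrM (odd l); have u1 := funtr1 (odd l); have uK := @ftrK (odd l).
split; [exact: next_rho_morph|exact: next_comm|exact: (next_spanned eP eS)|
  exact: lmult_inj|split].
  exact: (step_center eP eS ri rm rc rs cen).
exact: (next_trace eP eS ri rm rc rs char0 tr).
Qed.

Section Square.
Variables (u ui : tensor (Lend hV) L).
Hypothesis inv1 : inverse_of u ui.
Hypothesis inv2 : inverse_of (ltransp u) (ltransp ui).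
Local Notation emb l := (iemb (twr l)).

(** The copy of L(W), that is of A_{01}, at each level. *)
Fixpoint om (l : nat) : L -> A l :=
  match l return L -> A l with
  | 0 => id
  | l'.+1 => fun p => emb l' (om l' p)
  end.

Lemma om_morph l : alg_morph (om l).
Proof.
elim: l => [|l IHl]; first exact: (alg_morph_lr (@idfun L)).
exact: (alg_morph_comp IHl (alg_morph_lr (emb l))).
Qed.

Definition centr (l : nat) (x : A l) := forall p, x * om l p = om l p * x.

(** For z = u or its contragredient, the l-th factor of u_1 u^_2 u_3 and so on,
    placed on the l-th factor of the tower and on A_{01}. *)
Definition tw (l : nat) : tensor (F (odd l)) L -> A l.+1 :=
  mul_lift (@rho l) (om l.+1).

Lemma rho_om l p q : @rho l p * om l.+1 q = om l.+1 q * @rho l p.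
Proof. by have [_ rc _ _ _] := stageP l; rewrite /= rc. Qed.

Lemma tw_morph l : alg_morph (@tw l).
Proof.
have [rm _ _ _ _] := stageP l.
exact: (mul_lift_morph rm (om_morph l.+1) (@rho_om l)).
Qed.

(** The product of the first l twists, whose conjugation straightens A_{l,0}. *)
Fixpoint Up (l : nat) : A l :=
  match l return A l with
  | 0 => 1
  | l'.+1 => emb l' (Up l') * @tw l' (alt_u u ui (odd l'))
  end.
Fixpoint Um (l : nat) : A l :=
  match l return A l with
  | 0 => 1
  | l'.+1 => @tw l' (alt_ui u ui (odd l')) * emb l' (Um l')
  end.

Lemma Up_inv l : inverse_of (Up l) (Um l).
Proof.
elim: l => [|l IHl]; first by split; rewrite mulr1.
apply: inverse_mul; first exact: (inverse_morph (alg_morph_lr (emb l)) IHl).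
exact: (inverse_morph (tw_morph l) (alt_u_inv inv1 inv2 _)).
Qed.

Lemma alt_u_next b : alt_u u ui (~~ b) = tmap (ftr b) idfun (alt_ui u ui b).
Proof.
case: b => //=; symmetry.
rewrite (@tmap_comp _ _ _ _ _ _ _ _ _ idfun _ _ idfun) ?tmap_id //.
exact: transpK.
Qed.

Lemma twist_cond b :
  tmap (ftr b) idfun (alt_u u ui b) * tmap (ftr b) idfun (alt_ui u ui b) = 1.
Proof.
case: b; last by case: inv2.
have tK x : tmap (@untransp k V hV) idfun (ltransp x) = x :> tensor (Lend hV) L.
  rewrite (@tmap_comp _ _ _ _ _ _ _ _ _ idfun _ _ idfun) ?tmap_id //.
  exact: transpK.
by rewrite /= !tK; case: inv1.
Qed.

Lemma centr_emb l (x : A l) : centr x -> @centr l.+1 (emb l x).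
Proof. by move=> xc p; rewrite /= -!rmorphM xc. Qed.

Lemma centr_embK l (x : A l) : @centr l.+1 (emb l x) -> centr x.
Proof.
have [_ _ _ ei _] := stageP l; move=> xc p; apply: ei; rewrite !rmorphM; exact: xc.
Qed.

(** The l-th twist lives on A_{01} and on the l-th factor, and the latter commutes
    with all of A1 l. *)
Lemma centr_tw l (x : A l) z : centr x -> emb l x * @tw l z = @tw l z * emb l x.
Proof.
move=> xc; have [rm rc _ _ _] := stageP l; have [twl _ _] := tw_morph l.
have [rl _ _] := rm; have [ol _ _] := om_morph l.+1.
elim/tensor_ind: z => [z z' h h'|p q].
  by rewrite (linD twl) mulrDl mulrDr h h'.
rewrite /tw mul_lift_pure // mulrA rc -!mulrA; congr (_ * _).
by rewrite /= -!rmorphM xc.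
Qed.

Lemma Um_emb l (x : A l) : centr (Um l * x * Up l) ->
  Um l.+1 * emb l x * Up l.+1 = emb l (Um l * x * Up l).
Proof.
move=> xc; have [_ twM tw1] := tw_morph l.
have [_ tt] := alt_u_inv inv1 inv2 (odd l).
transitivity (@tw l (alt_ui u ui (odd l)) * emb l (Um l * x * Up l) *
              @tw l (alt_u u ui (odd l))).
  by rewrite /= !rmorphM !mulrA.
by rewrite -mulrA (centr_tw _ xc) mulrA -twM tt tw1 mul1r.
Qed.

(** The first l factors of Up l.+2 lie below the range of the projection, and
    the last two act trivially on it. *)
Lemma jones_Up l (T : rend (twr l)) : jones_projection T ->
  Up l.+2 * T = T * Up l.+2 /\ @centr l.+2 T.
Proof.
move=> TP; have [rm rc rs ri [cen tr]] := stageP l.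
have [J [e [eP eS]]] := factor_units (odd l).
have jc n := jones_comm eP eS ri rm rc rs char0 cen tr TP n.
have [t1 t2] := jones_twist eP eS ri rm rc rs (@funtrM (odd l))
    (funtr1 (odd l)) (@ftrK (odd l)) char0
  cen tr TP (om_morph l) (alt_u_inv inv1 inv2 (odd l)) (twist_cond (odd l)).
split; last by move=> p; rewrite /= [RHS]jc.
have UE : Up l.+2 = lmult (emb l (Up l)) *
   (lmult (@tw l (alt_u u ui (odd l))) *
    @tw l.+1 (tmap (ftr (odd l)) idfun (alt_ui u ui (odd l)))).
  by rewrite -alt_u_next /= rmorphM mulrA.
by rewrite UE -[LHS]mulrA [X in _ * X]t2 [LHS]jc mulrA -jc -[RHS]mulrA t1 jc.
Qed.

Lemma subalg_closed_sum (R : algType k) (P : {pred R}) (K : Type) (r : seq K)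
    (G : K -> R) : subalg_closed P -> (forall i, G i \in P) -> \sum_(i <- r) G i \in P.
Proof.
move=> [P1 Pl PM] GP.
have P0 : 0 \in P by rewrite -(addNr (1 : R)) -scaleN1r; apply: Pl.
elim/big_rec: _ => // i y _ Py; rewrite -[G i]scale1r; exact: Pl.
Qed.

Lemma subalg_closed_scale (R : algType k) (P : {pred R}) c x :
  subalg_closed P -> x \in P -> c *: x \in P.
Proof.
move=> [P1 Pl PM] Px.
have P0 : 0 \in P by rewrite -(addNr (1 : R)) -scaleN1r; apply: Pl.
by rewrite -[_ *: _]addr0; apply: Pl.
Qed.

Lemma rho_centr l p : @centr l.+1 (@rho l p).
Proof. by move=> q; apply: rho_om. Qed.

(** Both sides are generated in the same way.  Conjugation by Up l.+2 fixes the
    Jones projection and agrees, on the image of A_{l+1,0}, with conjugation by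
    Up l.+1; and the commutant of A_{01} at level l.+2 is generated by the
    previous one and the projection, because the new factor is. *)
Lemma A0_conj l (x : A l) : A0 u ui x <-> centr (Um l * x * Up l).
Proof.
have conjK i (y : A i) : Um i * (Up i * y * Um i) * Up i = y.
  by apply: conj_cancel; apply: Up_inv.
have conjK' i (y : A i) : Up i * (Um i * y * Up i) * Um i = y.
  by apply/conj_cancel/inverse_sym/Up_inv.
case: l x => [|l] x.
  rewrite /= mul1r mulr1; split=> [[c _ <-] p|xc].
    by rewrite mulr_algl mulr_algr.
  have [c cE] := units_center (Lend_units hW) (@Lend_span _ _ hW) xc.
  by exists c.
elim: l x => [|l IHl] x.
  have tw0 z : @tw 0 z = z.
    have [twl _ _] := tw_morph 0.
    elim/tensor_ind: z => [z z' h h'|a b]; first by rewrite (linD twl) h h'.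
    rewrite /tw mul_lift_pure; [|exact: is_linear|exact: is_linear].
    by rewrite /= tpureM mulr1 mul1r.
  have [Up1 Um1] : Up 1 = u /\ Um 1 = ui.
    by rewrite /= !tw0 !rmorph1 mul1r mulr1.
  rewrite Up1 Um1; split=> [[T _ <-]|xc].
    by rewrite [X in centr X](conj_cancel _ inv1) => p; apply: tinlr_comm.
  have [T TE] := commutant_tinr (Lend_units hW) (@Lend_span _ _ hW) xc.
  by exists T => //; rewrite -TE; apply/conj_cancel/inverse_sym.
have [rm rc rs ri [cen tr]] := stageP l.
have [J [e [eP eS]]] := factor_units (odd l).
split=> [xg|xc P Pcl Pgen].
  pose P := [pred y : A l.+2 | `[< @centr l.+2 (Um l.+2 * y * Up l.+2) >]].
  suff /asboolP : x \in P by [].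
  apply: xg => [|y].
    have [pm mp] := Up_inv l.+2.
    split.
    - by apply/asboolP => p; rewrite mulr1 mp mulr1 mul1r.
    - move=> c y z /asboolP yc /asboolP zc; apply/asboolP => p.
      rewrite mulrDr mulrDl -scalerAr -scalerAl mulrDl mulrDr -scalerAl -scalerAr.
      by rewrite yc zc.
    - move=> y z /asboolP yc /asboolP zc; apply/asboolP => p.
      by rewrite (conj_mul _ _ (Up_inv l.+2)) -[LHS]mulrA zc [LHS]mulrA yc -[LHS]mulrA.
  case=> [[z /IHl zc <-]|yJ]; apply/asboolP.
    by rewrite [X in centr X](Um_emb zc); apply: centr_emb.
  have [Uy yc] := jones_Up yJ; have [_ mp] := Up_inv l.+2.
  by rewrite -mulrA -Uy mulrA mp mul1r.
rewrite -(conjK' _ x); set y := Um _ * x * _ in xc *.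
have PE (n : A l.+1) : centr n -> Up l.+2 * emb l.+1 n * Um l.+2 \in P.
  move=> nc; have nc' : centr (Um l.+1 * (Up l.+1 * n * Um l.+1) * Up l.+1).
    by rewrite conjK.
  have E := Um_emb nc'; rewrite conjK in E; rewrite -E conjK'.
  by apply: Pgen; left; exists (Up l.+1 * n * Um l.+1) => //; apply/IHl.
have PM (a b : A l.+2) : Up l.+2 * a * Um l.+2 \in P ->
    Up l.+2 * b * Um l.+2 \in P -> Up l.+2 * (a * b) * Um l.+2 \in P.
  move=> aP bP; have [_ _ cM] := Pcl.
  rewrite (conj_mul _ _ (inverse_sym (Up_inv l.+2))); exact: cM.
have conjl : linear (fun a : A l.+2 => Up l.+2 * a * Um l.+2).
  by move=> c a b; rewrite mulrDr mulrDl -scalerAr -scalerAl.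
have [T TP] := jones_exists eP eS ri rm rc rs char0 cen tr.
have PT : Up l.+2 * T * Um l.+2 \in P.
  have [-> _] := jones_Up TP; have [pm _] := Up_inv l.+2.
  by rewrite -mulrA pm mulr1; apply: Pgen; right.
have Prho q : Up l.+2 * @rho l.+1 q * Um l.+2 \in P.
  have rl : linear (@rho l.+1) by have [[]] := stageP l.+1.
  have fK : ftr (odd l) (funtr (odd l) q) = q by apply: funtrK.
  rewrite -fK; have [c ->] := eS (funtr (odd l) q); rewrite linear_sum.
  rewrite (lin_sum (lin_comp rl conjl)); apply: subalg_closed_sum => // a.
  rewrite linear_sum (lin_sum (lin_comp rl conjl)); apply: subalg_closed_sum => // b.
  rewrite linearZ (linZ (lin_comp rl conjl)); apply: subalg_closed_scale => //.
  rewrite [rho _](next_rho_jones eP eS ri rm rc rs (@ftrK (odd l)) char0 cen tr TP).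
  rewrite (linZ conjl); apply: subalg_closed_scale => //.
  rewrite (lin_sum conjl); apply: subalg_closed_sum => // s.
  by apply: (PM _ _ _ (PE _ (@rho_centr l _))); apply: PM => //; apply/PE/rho_centr.
have [rm' rc' rs' ri' _] := stageP l.+1.
have [J' [e' [eP' eS']]] := factor_units (odd l.+1).
have [n [nE ->]] := step_expand eP' eS' rm' rc' rs' y.
rewrite (lin_sum conjl); apply: subalg_closed_sum => // a.
rewrite (lin_sum conjl); apply: subalg_closed_sum => // b.
apply: PM => //; apply: PE; apply: centr_embK => p; rewrite -nE.
symmetry; apply: mcoef_centr; last by rewrite xc.
by move=> s t; rewrite rho_om.
Qed.

End Square.
End Tower.

(** * Relative commutants in the tower *)

Section Commutants.
Variables (k : fieldType) (V W : vectType k).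
Variables (hV : (0 < dim V)%N) (hW : (0 < dim W)%N).
Hypothesis char0 : [pchar k] =i pred0.
Local Notation L := (Lend hW).
Local Notation F := (alt_factor hV).
Local Notation A := (A1 hV hW).
Local Notation emb l := (iemb (tower hV hW l)).
Local Notation rho l := (@rho k V W hV hW l).
Local Notation om := (@om k V W hV hW).
Local Notation cast := A1_cast.

Lemma incl_morph j m : alg_morph (@A1_incl k V W hV hW j m).
Proof.
elim: m => [|m IHm]; first exact: (alg_morph_lr (@idfun (A j))).
exact: (alg_morph_comp IHm (alg_morph_lr (emb (m + j)))).
Qed.

Lemma cast_morph i i' (e : i = i') : alg_morph (@A1_cast k V W hV hW i i' e).
Proof. by case: i' / e; exact: (alg_morph_lr (@idfun (A i))). Qed.

Lemma cast_inj i i' (e : i = i') : injective (@A1_cast k V W hV hW i i' e).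
Proof. by case: i' / e. Qed.

Lemma cast_surj i i' (e : i = i') (x : A i') : exists x' : A i, cast e x' = x.
Proof. by case: i' / e x => x; exists x. Qed.

Lemma cast_id i (e : i = i) (x : A i) : cast e x = x.
Proof. by rewrite (eq_irrelevance e (erefl i)). Qed.

Lemma cast_emb i i' (e : i = i') (e' : i.+1 = i'.+1) (x : A i) :
  cast e' (emb i x) = emb i' (cast e x).
Proof. by case: i' / e e' => e'; rewrite cast_id. Qed.

Lemma cast_incl j m (n : A j) :
  cast (addnS m j) (@A1_incl k V W hV hW j.+1 m (emb j n)) = emb (m + j) (A1_incl m n).
Proof.
elim: m => [|m IHm] /=; first by rewrite cast_id.
rewrite /A1_emb -IHm; exact: (cast_emb (addnS m j) (addnS m.+1 j)).
Qed.

Lemma cast_om i i' (e : i = i') q : cast e (om i q) = om i' q.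
Proof. by case: i' / e. Qed.

Lemma incl_om j m q : A1_incl m (om j q) = om (m + j) q.
Proof. by elim: m => //= m ->. Qed.

(** The alternating product of the m factors that appear after level j.  The first
    of them is split off, as in the definition of the alternating algebra, and
    the remaining ones start at level j.+1; this changes the index of the
    ambient algebra by an equality of sums, hence the cast. *)
Fixpoint theta (m j : nat) {struct m} : alt_alg hV (odd j) m -> A (m + j) :=
  match m return alt_alg hV (odd j) m -> A (m + j) with
  | 0 => fun c => (c : k) *: 1
  | m'.+1 => fun z => cast (addnS m' j)
      (mul_lift (fun p => A1_incl m' (rho j p)) (@theta m' j.+1) z)
  end.

Lemma theta_comm_morph m j : alg_morph (@theta m j) /\
  forall (n : A j) y, A1_incl m n * @theta m j y = @theta m j y * A1_incl m n.
Proof.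
elim: m j => [|m IHm] j.
  split=> [|n c /=]; last by rewrite mulr_algl mulr_algr.
  split=> [c x y|x y|] /=; first by rewrite scalerDl scalerA.
    by rewrite -scalerAl mul1r scalerA.
  by rewrite scale1r.
have [tm tc] := IHm j.+1; have [rm rc _ _ _] := stageP hV hW char0 j.
have im := incl_morph j.+1 m; have [il iM i1] := im.
have mm := mul_lift_morph (alg_morph_comp rm im) tm (fun p => tc (rho j p)).
split; first exact: (alg_morph_comp mm (cast_morph (addnS m j))).
move=> n y; rewrite /= /A1_emb -cast_incl.
have [_ cM _] := cast_morph (addnS m j); rewrite -!cM; congr (cast _ _).
have [ml _ _] := mm; have [rl _ _] := alg_morph_comp rm im; have [tl _ _] := tm.
elim/tensor_ind: y => [y y' h h'|p y].
  by rewrite (linD ml) mulrDl mulrDr h h'.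
by rewrite mul_lift_pure // mulrA -iM rc iM -!mulrA tc.
Qed.

Lemma theta_morph m j : alg_morph (@theta m j).
Proof. exact: (theta_comm_morph m j).1. Qed.
Lemma theta_comm m j (n : A j) y :
  A1_incl m n * @theta m j y = @theta m j y * A1_incl m n.
Proof. exact: (theta_comm_morph m j).2. Qed.

Lemma theta_pure m j p y :
  @theta m.+1 j (tpure p y) =
  cast (addnS m j) (A1_incl m (rho j p) * @theta m j.+1 y).
Proof.
have [rm _ _ _ _] := stageP hV hW char0 j.
have [rl _ _] := alg_morph_comp rm (incl_morph j.+1 m).
have [tl _ _] := theta_morph m j.+1.
by rewrite /= mul_lift_pure.
Qed.

Lemma theta_inj m j : injective (@theta m j).
Proof.
elim: m j => [|m IHm] j.
  move=> x y /= /eqP; rewrite -subr_eq0 -scalerBl scaler_eq0 oner_eq0 orbF.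
  by rewrite subr_eq0 => /eqP.
have [rm _ _ _ _] := stageP hV hW char0 j.
have am := alg_morph_comp rm (incl_morph j.+1 m); have [al _ _] := am.
have [tl _ _] := theta_morph m j.+1.
have [J [e [eP eS]]] := factor_units hV (odd j).
apply: (inj_comp (@cast_inj _ _ (addnS m j))).
apply: (mul_lift_injl eP eS am tl _ (IHm j.+1)) => p y.
exact: (theta_comm (rho j p)).
Qed.

(** Expanding along the first factor, the coefficients commute with one more
    level of the tower. *)
Lemma theta_commutant m j (x : A (m + j)) :
  (forall n : A j, x * A1_incl m n = A1_incl m n * x) ->
  exists y, @theta m j y = x.
Proof.
elim: m j x => [|m IHm] j x xc.
  have [_ _ _ _ [cen _]] := stageP hV hW char0 j.
  by have [c ->] := cen x xc; exists c.
have [x' x'E] := cast_surj (addnS m j) x.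
have [rm rc rs _ _] := stageP hV hW char0 j.
have im := incl_morph j.+1 m; have [il iM i1] := im.
have am := alg_morph_comp rm im.
have [J [e [eP eS]]] := factor_units hV (odd j).
have EP := matrix_units_morph am eP.
have x'c n : x' * @A1_incl k V W hV hW j.+1 m (emb j n) =
             @A1_incl k V W hV hW j.+1 m (emb j n) * x'.
  apply: (cast_inj (e := addnS m j)).
  have [_ cM _] := cast_morph (addnS m j).
  by rewrite !cM cast_incl x'E; apply: xc.
have coef a b : exists y, @theta m j.+1 y = mcoef (fun a b => A1_incl m (rho j (e a b))) x' a b.
  apply: IHm => n; symmetry; move: n; apply: rs => [n n' h h'|n p].
    by rewrite (linD il) mulrDl mulrDr h h'.
  rewrite iM -mulrA.
  have cE q y : (forall s t, A1_incl m (rho j (e s t)) * y = y * A1_incl m (rho j (e s t))) ->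
     A1_incl m (rho j q) * y = y * A1_incl m (rho j q).
    have [al _ _] := am; have [c ->] := eS q; move=> yc.
    rewrite (lin_sum al) mulr_sumr mulr_suml; apply: eq_bigr => s _.
    rewrite (lin_sum al) mulr_sumr mulr_suml; apply: eq_bigr => t _.
    by rewrite (linZ al) -scalerAl -scalerAr yc.
  rewrite (cE p); last by move=> s t; apply: (mcoef_comm EP).
  rewrite !mulrA; congr (_ * _); apply: mcoef_centr; last by rewrite x'c.
  by move=> s t; rewrite -!iM rc.
have [y yE] := boolp.choice (fun ab => coef ab.1 ab.2).
exists (\sum_a \sum_b tpure (e a b) (y (a, b))); rewrite -x'E.
have [tl _ _] := theta_morph m.+1 j.
have [cl _ _] := cast_morph (addnS m j).
rewrite (lin_sum tl) [in RHS](mcoef_expand EP x') (lin_sum cl); apply: eq_bigr => a _.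
rewrite (lin_sum tl) (lin_sum cl); apply: eq_bigr => b _.
by rewrite theta_pure theta_comm (yE (a, b)).
Qed.

Lemma theta_append m j y :
  @theta m.+1 j (alt_append hV (odd j) m y) = emb (m + j) (@theta m j y).
Proof.
elim: m j y => [|m IHm] j y.
  have [[_ _ r1] _ _ _ _] := stageP hV hW char0 j.
  rewrite [alt_append _ _ _ _]/(tpure 1 y) theta_pure r1 cast_id mul1r /=.
  by rewrite linearZ /= rmorph1.
have [tl _ _] := theta_morph m.+2 j; have [tl' _ _] := theta_morph m.+1 j.
elim/tensor_ind: y => [y y' h h'|p y].
  by rewrite linearD (linD tl) (linD tl') rmorphD h h'.
have -> : alt_append hV (odd j) m.+1 (tpure p y) = tpure p (alt_append hV (odd j.+1) m y).
  exact: tmap_tpure.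
rewrite !theta_pure IHm /= /A1_emb.
have := cast_emb (addnS m j) (addnS m.+1 j) (A1_incl m (rho j p) * @theta m j.+1 y).
by rewrite rmorphM.
Qed.

Lemma theta_prepend m j y :
  @theta m.+1 j (alt_prepend (hV := hV) (b := odd j) y) =
  cast (addnS m j) (@theta m j.+1 y).
Proof.
have [[_ _ r1] _ _ _ _] := stageP hV hW char0 j.
have [_ _ i1] := incl_morph j.+1 m.
by rewrite /alt_prepend /tinr theta_pure r1 i1 mul1r.
Qed.

Definition theta_om m j : tensor (alt_alg hV (odd j) m) L -> A (m + j) :=
  mul_lift (@theta m j) (om (m + j)).

Lemma theta_om_comm m j y q :
  @theta m j y * om (m + j) q = om (m + j) q * @theta m j y.
Proof. by rewrite -incl_om theta_comm. Qed.

Lemma theta_om_morph m j : alg_morph (@theta_om m j).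
Proof.
exact: (mul_lift_morph (theta_morph m j) (om_morph _ _ _) (@theta_om_comm m j)).
Qed.

Lemma theta_om_inj m j : injective (@theta_om m j).
Proof.
have [tl _ _] := theta_morph m j.
exact: (mul_lift_inj (Lend_units hW) (@Lend_span _ _ hW) tl (om_morph _ _ _)
  (@theta_om_comm m j) (@theta_inj m j)).
Qed.

Section Square.
Variables (u ui : tensor (Lend hV) L).
Hypothesis inv1 : inverse_of u ui.
Hypothesis inv2 : inverse_of (ltransp u) (ltransp ui).
Local Notation Up := (Up u ui).
Local Notation Um := (Um u ui).

Lemma theta_om_inl m j (z : tensor (F (odd j)) L) :
  @theta_om m.+1 j (tmap (@tinl k (F (odd j)) (alt_alg hV (~~ odd j) m)) idfun z) =
  cast (addnS m j) (A1_incl m (@tw k V W hV hW j z)).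
Proof.
have [tol _ _] := theta_om_morph m.+1 j; have [tl _ _] := theta_morph m.+1 j.
have [ol _ _] := om_morph hV hW (m.+1 + j); have [ol' _ _] := om_morph hV hW j.+1.
have [twl _ _] := tw_morph hV hW char0 j.
have [[rl _ _] _ _ _ _] := stageP hV hW char0 j.
have [_ _ t1] := theta_morph m j.+1.
have [il iM _] := incl_morph j.+1 m; have [cl cM _] := cast_morph (addnS m j).
elim/tensor_ind: z => [z z' h h'|p q].
  by rewrite tmapD (linD tol) h h' (linD twl) (linD il) (linD cl).
rewrite tmap_tpure [LHS]mul_lift_pure // [tw _]mul_lift_pure //.
rewrite iM cM incl_om cast_om; congr (_ * _).
by apply: etrans (theta_pure p 1) _; rewrite t1 mulr1.
Qed.

Lemma theta_om_inr m j (z : tensor (alt_alg hV (odd j.+1) m) L) :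
  @theta_om m.+1 j (tmap (@tinr k (F (odd j)) (alt_alg hV (~~ odd j) m)) idfun z) =
  cast (addnS m j) (@theta_om m j.+1 z).
Proof.
have [tol _ _] := theta_om_morph m.+1 j; have [tl _ _] := theta_morph m.+1 j.
have [tol' _ _] := theta_om_morph m j.+1; have [tl' _ _] := theta_morph m j.+1.
have [ol _ _] := om_morph hV hW (m.+1 + j); have [ol' _ _] := om_morph hV hW (m + j.+1).
have [cl cM _] := cast_morph (addnS m j).
elim/tensor_ind: z => [z z' h h'|p q].
  by rewrite tmapD (linD tol) h h' (linD tol') (linD cl).
rewrite tmap_tpure [LHS]mul_lift_pure // [theta_om _]mul_lift_pure //.
by rewrite cM cast_om; congr (_ * _); apply: theta_prepend.
Qed.

Lemma Up_cast i i' (e : i = i') : cast e (Up i) = Up i'.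
Proof. by case: i' / e. Qed.

(** The twists beyond level j only involve A_{01} and the factors beyond level j,
    where they form the alternating product of u. *)
Lemma Up_theta m j :
  Up (m + j) = A1_incl m (Up j) * @theta_om m j (alt_U u ui (odd j) m).
Proof.
elim: m j => [|m IHm] j.
  by have [_ _ t1] := theta_om_morph 0 j; rewrite [theta_om _]t1 mulr1.
have [_ tM _] := theta_om_morph m.+1 j.
have [_ iM _] := incl_morph j.+1 m; have [_ cM _] := cast_morph (addnS m j).
rewrite -(Up_cast (addnS m j)) IHm cM [Up j.+1]/= iM cM cast_incl.
by rewrite [alt_U _ _ _ _]/= tM theta_om_inl theta_om_inr mulrA.
Qed.

(** The part of Up coming from the first j levels commutes with theta y and
    cancels; what remains takes place in alt_alg (x) L(W). *)
Lemma A0_theta m j y :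
  A0 u ui (@theta m j y) <->
  forall p, alt_Ui u ui (odd j) m * tinl L y * alt_U u ui (odd j) m * tinr _ p =
            tinr _ p * (alt_Ui u ui (odd j) m * tinl L y * alt_U u ui (odd j) m).
Proof.
have tm := theta_om_morph m j; have [_ tM _] := tm.
have im := incl_morph j m; have [_ iM _] := im.
have UmE : Um (m + j) = @theta_om m j (alt_Ui u ui (odd j) m) * A1_incl m (Um j).
  apply: (@inverse_unique (A (m + j)) (Up (m + j))); first exact: Up_inv.
  rewrite Up_theta; apply: inverse_mul.
    by apply: (inverse_morph im); exact: Up_inv.
  by apply: (inverse_morph tm); exact: alt_U_inv.
have om_tinr p : om (m + j) p = @theta_om m j (tinr _ p).
  by rewrite [RHS](mul_lift_inr (theta_morph m j) (om_morph hV hW _)).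
have E : Um (m + j) * @theta m j y * Up (m + j) =
    @theta_om m j (alt_Ui u ui (odd j) m * tinl L y * alt_U u ui (odd j) m).
  have ty : @theta m j y = @theta_om m j (tinl L y).
    by rewrite [RHS](mul_lift_inl (theta_morph m j) (om_morph hV hW _)).
  have UUj : inverse_of (Up j) (Um j) by exact: Up_inv.
  have [_ mp] := inverse_morph im UUj.
  rewrite UmE Up_theta !tM -ty -!mulrA; congr (_ * _).
  by rewrite !mulrA theta_comm -(mulrA (theta y)) mp mulr1.
rewrite (A0_conj char0 inv1 inv2) E; split=> h p.
  by apply: (@theta_om_inj m j); rewrite [LHS]tM [RHS]tM -om_tinr; apply: h.
by rewrite om_tinr -[LHS]tM -[RHS]tM h.
Qed.

End Square.
End Commutants.

(** * The isomorphism of lattices *)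

Lemma alg_iso_of_inverse (k : fieldType) (A B : algType k) (S : set A) (T : set B)
    (g : B -> A) (f : A -> B) :
  alg_morph g -> cancel g f -> (forall y, T y -> S (g y)) ->
  (forall x, S x -> exists2 y, T y & g y = x) -> is_alg_iso_on S T f.
Proof.
move=> [gl gM g1] gK gS gT; split.
- split=> [x /gT [y Ty <-]|x x'|y Ty]; first by rewrite gK.
    by move=> /set_mem/gT [y _ <-] /set_mem/gT [y' _ <-]; rewrite !gK => ->.
  by exists (g y); [apply: gS|rewrite gK].
- by rewrite -g1 gK.
- by move=> x x' /gT [y _ <-] /gT [y' _ <-]; rewrite -gM !gK.
- by move=> c x x' /gT [y _ <-] /gT [y' _ <-]; rewrite -gl !gK.
Qed.

Theorem theorem4p1 (k : fieldType) (k_char0 : [pchar k] =i pred0)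
    (V W : vectType k) (hV : (0 < dim V)%N) (hW : (0 < dim W)%N)
    (u ui : tensor (Lend hV) (Lend hW)) :
  inverse_of u ui ->
  inverse_of (ltransp u) (ltransp ui) ->
  forall M : model (uprime u ui), minimal_model M ->
    lattice_eq (square_lattice u ui) (corep_lattice (model_corep M)).
Proof.
move=> inv1 inv2 M Mmin.
pose th j m := @theta k V W hV hW m j.
have thi j m : injective (th j m) := @theta_inj k V W hV hW k_char0 m j.
have inverse j m : exists f : A1 hV hW (m + j) -> alt_alg hV (odd j) m, cancel (th j m) f.
  have h x : exists y, (exists y', th j m y' = x) -> th j m y = x.
    have [[y yx]|nx] := pselect (exists y', th j m y' = x); first by exists y.
    by exists 0 => -[y yx]; case: nx; exists y.
  have [f fE] := boolp.choice h; exists f => y.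
  by apply: (thi j m); apply: fE; exists y.
pose f j m := projT1 (cid (inverse j m)).
have fK j m : cancel (th j m) (f j m) := projT2 (cid (inverse j m)).
have mem j m y : corep_End (alt_corep (model_corep M) (odd j) m) y <-> A0 u ui (th j m y).
  by rewrite (A0_theta k_char0 inv1 inv2) (corep_End_alt inv1 inv2 Mmin).
have onto j m x : lat_alg (l := square_lattice u ui) (j := j) (m := m) x ->
    exists2 y, corep_End (alt_corep (model_corep M) (odd j) m) y & th j m y = x.
  move=> [xA xc]; have [y yx] := theta_commutant k_char0 xc.
  by exists y => //; apply/mem; rewrite /th yx.
exists f; split=> [j m|j m x /onto [y _ <-]|j m x /onto [y _ <-]].
- apply: (alg_iso_of_inverse (theta_morph hV hW k_char0 m j) (fK j m)) => [y Ty|x Sx].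
    split; first exact/mem.
    by move=> n; rewrite theta_comm.
  exact: onto.
- have e := theta_append hW k_char0 y; rewrite fK.
  exact: etrans (congr1 (f j m.+1) (esym e)) (fK j m.+1 _).
- have e := theta_prepend hW k_char0 y; rewrite fK.
  exact: etrans (congr1 (f j m.+1) (esym e)) (fK j m.+1 _).
Qed.
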